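(* Let $0<\varepsilon\leq1$ and $n,d\in\mathbb{N}^*$. Let $H$ be a $\mathrm{Lip}-(n+\varepsilon)$ vector field defined on a subset $V$ of $\mathbb{R}^d$. Let $T>0$ and let $U$ be an open convex subset of $\mathbb{R}^d$. Let $G$ be a flow of $H$ on $(-T,T)\times U$ (assuming that $G((-T,T)\times U)\subseteq V$). Then $\mathrm{d}G$ is $\mathrm{Lip}-(n+\varepsilon-1)$ on $(-T,T)\times U$ and its $\mathrm{Lip}-(n+\varepsilon-1)$ norm is bounded from above by a constant depending only on $\|H\|_{\mathrm{Lip}-(n+\varepsilon)}$, $\varepsilon$ and $T$ ($n$, $d$ and the norms on the spaces involved being fixed).
   Context: Notation. $\mathbb{N}=\{0,1,2,\dots\}$, $\mathbb{N}^*=\mathbb{N}\setminus\{0\}$. $E^{\otimes k}$ is the $k$-fold algebraic tensor power of a normed space $E$, with a fixed norm also denoted $\|\cdot\|$. $\mathcal{L}_s(E^{\otimes k},F)$ is the space of symmetric $k$-linear mappings from $E$ to $F$, seen as linear maps on $E^{\otimes k}$. Spaces of linear maps carry the operator norm. Lipschitz maps. Let $n\in\mathbb{N}$, $0<\varepsilon\leq1$, $U\subseteq E$ any subset, $f^0:U\to F$ and $f^k:U\to\mathcal{L}_s(E^{\otimes k},F)$ for $1\leq k\leq n$. The remainder of order $k$ ($0\leq k\leq n$) of $f=(f^0,\dots,f^n)$ is defined by $$f^k(x)(v)=\sum_{j=k}^n f^j(y)\Big(\frac{v\otimes(x-y)^{\otimes(j-k)}}{(j-k)!}\Big)+R_k(x,y)(v),\quad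 x,y\in U,\ v\in E^{\otimes k}.$$ $f$ is $\mathrm{Lip}-(n+\varepsilon)$ on $U$ if there is $M$ such that for all $0\leq k\leq n$, $x,y\in U$, $v_1,\dots,v_k\in E$: $\|f^k(x)(v_1\otimes\cdots\otimes v_k)\|\leq M\|v_1\otimes\cdots\otimes v_k\|$ and $\|R_k(x,y)(v_1\otimes\cdots\otimes v_k)\|\leq M\|x-y\|^{n+\varepsilon-k}\|v_1\otimes\cdots\otimes v_k\|$. The smallest such $M$ is $\|f\|_{\mathrm{Lip}-(n+\varepsilon)}$. One often says that $f^0$ is Lip, the maps $f^1,\dots,f^n$ being understood; on open sets they are necessarily the successive derivatives of $f^0$. Flows. A vector field on $V\subseteq\mathbb{R}^d$ is a map $H:V\to\mathbb{R}^d$. A flow of $H$ on $(-T,T)\times U$ is a map $G:(-T,T)\times U\to V$ such that for every $y\in U$ the path $t\mapsto G(t,y)$ is $\mathcal{C}^1$, satisfies $\partial_tG(t,y)=H(G(t,y))$ for all $t\in(-T,T)$, and $G(0,y)=y$. $\mathrm{d}G$ denotes the (space-time) Fréchet derivative of $G$, with values in the linear maps $\mathbb{R}\times\mathbb{R}^d\to\mathbb{R}^d$; the assertion that $\mathrm{d}G$ is Lipschitz includes that $G$ is differentiable. Standing assumption. The norms on the base spaces $E$ (here $\mathbb{R}^d$ and $\mathbb{R}\times\mathbb{R}^d$) and on their tensor powers satisfy $\|v\otimes\tilde v\|=\|v\|\|\tilde v\|$ for all $k$, $v\in E^{\otimes k}$, $\tilde v\in E$, and the projective property $\|a\otimes b\|\leq\|a\|\|b\|$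 for $a\in E^{\otimes p}$, $b\in E^{\otimes q}$. *)

(* Defs.v *)
From HB Require Import structures.
From mathcomp Require Import all_boot all_order all_algebra.
From mathcomp Require Import perm.
From mathcomp Require Import all_classical all_reals all_analysis.

Set Implicit Arguments.
Unset Strict Implicit.
Unset Printing Implicit Defensive.

Import Order.TTheory GRing.Theory Num.Theory numFieldNormedType.Exports.

Local Open Scope classical_set_scope.
Local Open Scope ring_scope.

(* The k-fold tensor power of a finite-dimensional space E, in coordinates:
   an element is the family of its coefficients on the basis
   e_(I 0) (x) ... (x) e_(I (k-1)), where e is the basis [vbasis {:E}] and I
   ranges over the functions from 'I_k to the indices of e.  In particular the
   0-th power is the line of scalars, on which [tens] of the empty family is 1. *)
Definition tpower (R : realType) (E : vectType R) (k : nat) :=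
  {ffun {ffun 'I_k -> 'I_(\dim {:E})} -> R^o}.

Section Tensors.
Variables (R : realType) (E : vectType R).

(* v_0 (x) ... (x) v_(k-1) *)
Definition tens (k : nat) (v : 'I_k -> E) : tpower E k :=
  [ffun I : {ffun 'I_k -> 'I_(\dim {:E})} =>
     \prod_(i < k) coord (vbasis {:E}) (I i) (v i)].

Definition tprod (p q : nat) (a : tpower E p) (b : tpower E q) :
    tpower E (p + q) :=
  [ffun I : {ffun 'I_(p + q) -> 'I_(\dim {:E})} =>
     a [ffun i => I (lshift q i)] * b [ffun j => I (rshift p j)]].

Definition tpow (v : E) (k : nat) : tpower E k := tens (fun _ : 'I_k => v).

(* the empty tensor, i.e. the scalar 1 *)
Definition tone : tpower E 0 := tens (fun _ : 'I_0 => 0).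

(* the identification of E with its first tensor power *)
Definition tvec (v : E) : tpower E 1 := tens (fun _ : 'I_1 => v).

End Tensors.
Arguments tone {R E}.

Definition is_norm (R : realType) (E : lmodType R) (N : E -> R) : Prop :=
  [/\ forall x, N x = 0 -> x = 0,
      forall x y, N (x + y) <= N x + N y
    & forall (a : R) x, N (a *: x) = `|a| * N x].

Definition tensor_norms (R : realType) (E : vectType R)
    (N : forall k, tpower E k -> R) : Prop :=
  [/\ forall k, is_norm (N k),
      forall k (v : tpower E k) (w : E),
        N (k + 1)%N (tprod v (tvec w)) = N k v * N 1%N (tvec w)
    & forall p q (a : tpower E p) (b : tpower E q),
        N (p + q)%N (tprod a b) <= N p a * N q b].

(* The norm on E itself, E being its own first tensor power.  It need not be the
   library's norm on E; the two are equivalent in finite dimension, so openness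
   and Frechet derivatives can be those of the library. *)
Definition base_norm (R : realType) (E : vectType R)
    (N : forall k, tpower E k -> R) (v : E) : R := N 1%N (tvec v).

(* E and F being finite-dimensional, the supremum is finite for any norms. *)
Definition opnorm (R : realType) (E F : vectType R) (NE : E -> R) (NF : F -> R)
    (L : 'Hom(E, F)) : R :=
  sup [set NF (L v) | v in [set v | NE v <= 1]].

Section Lipschitz.
Variables (R : realType) (E F : vectType R).

(* A family (f^0, f^1, ...) with f^k(x) a linear map from the k-th tensor power
   of E to F.  For k = 0 this is a linear map from the scalars to F, identified
   with its value at 1. *)
Definition jet := forall k, E -> 'Hom(tpower E k, F).

Definition jet_base (f : jet) (x : E) : F := f 0%N x tone.

Definition symmetric_map (k : nat) (L : 'Hom(tpower E k, F)) : Prop :=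
  forall (s : {perm 'I_k}) (v : 'I_k -> E),
    L (tens (fun i => v (s i))) = L (tens v).

(* The sum over k <= j <= n of the informal definition is indexed by
   i = j - k, so that the argument of f^j lies in the (k + i)-th power. *)
Definition remainder (n : nat) (f : jet) (k : nat) (x y : E)
    (v : tpower E k) : F :=
  f k x v -
  \sum_(i < (n - k).+1)
     (i`!%:R : R)^-1 *: f (k + i)%N y (tprod v (tpow (x - y) i)).

Variables (NE : forall k, tpower E k -> R) (NF : F -> R).

(* M bounds the Lip-(n + eps) data of f on U; 0 <= M only matters for U empty. *)
Definition lip_bound (n : nat) (eps : R) (U : set E) (f : jet) (M : R) : Prop :=
  0 <= M /\
  forall k, (k <= n)%N -> forall x y, U x -> U y -> forall v : 'I_k -> E,
    NF (f k x (tens v)) <= M * NE (tens v) /\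
    NF (remainder n f x y (tens v)) <=
      M * (base_norm NE (x - y) `^ (n%:R + eps - k%:R)) * NE (tens v).

Definition is_lip (n : nat) (eps : R) (U : set E) (f : jet) : Prop :=
  (forall k x, (k <= n)%N -> U x -> symmetric_map (f k x)) /\
  exists M, lip_bound n eps U f M.

Definition lip_norm (n : nat) (eps : R) (U : set E) (f : jet) : R :=
  inf [set M | lip_bound n eps U f M].

End Lipschitz.

(* [G] is a flow on (-T, T) x U of the vector field [H] on V; only the values
   of [G] on (-T, T) x U and those of [H] on V are used. *)
Definition is_flow (R : realType) (d : nat) (V : set 'rV[R]_d)
    (H : 'rV[R]_d -> 'rV[R]_d) (T : R) (U : set 'rV[R]_d)
    (G : R * 'rV[R]_d -> 'rV[R]_d) : Prop :=
  (forall t y, t \in `]-T, T[ -> U y -> V (G (t, y))) /\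
  forall y, U y ->
    [/\ forall t, t \in `]-T, T[ -> derivable (fun s => G (s, y)) t 1,
        {in `]-T, T[, continuous (derive1 (fun s => G (s, y)))},
        forall t, t \in `]-T, T[ -> derive1 (fun s => G (s, y)) t = H (G (t, y))
      & G (0, y) = y].

(* Main.v *)
(* The spatial derivative J of the flow solves the linear equation J' = (H^1 o G) J
   with J = id at time 0, and dG = (H^0 o G, J).  A Gronwall argument on difference
   quotients gives J and the expansion |G(q) - G(p) - dG(p)(q - p)| <= C |q - p|^(1+eps).
   The regularity is then bootstrapped: if dG is C^{m,eps}, so are H^0 o G and H^1 o G to
   order m+1 (the chain rule only uses the Taylor expansions of H at points of V, which
   need not be open), and the solution of a linear equation with C^{m+1,eps} coefficients
   is C^{m+1,eps} in time and space; this continues up to m = n-1.  On the convex set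
   (-T,T) x U, Taylor's formula along segments turns the C^{n-1,eps} bounds on dG into
   bounds on all remainders, and Schwarz's theorem makes the derivatives symmetric.  All
   of this is done for coordinates in sup norms, the given norms being equivalent. *)
Require Import Defs.
From HB Require Import structures.
From mathcomp Require Import all_boot all_order all_algebra.
From mathcomp Require Import fingroup perm.
From mathcomp Require Import all_classical all_reals all_analysis.
From mathcomp Require Import ring lra.

Set Implicit Arguments.
Unset Strict Implicit.
Unset Printing Implicit Defensive.

Import Order.TTheory GRing.Theory Num.Theory numFieldNormedType.Exports.

Local Open Scope classical_set_scope.
Local Open Scope ring_scope.

(** No existence theorem for differential equations is invoked. The difference quotients of the flow
    with step h solve the variational equation up to an error of order h^eps, uniformly in time; by
    Gronwall's inequality, approximate solutions with the same initial value are uniformly close to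
    each other, and their limit is an exact solution. The same device differentiates [J] at every
    later round, so it is set up once, for an unknown whose right-hand side expands as a matrix
    acting on the increments of the unknown plus a linear map acting on the increments of the point.

    The second concern is uniformity: the final constant may depend only on the norm of [H], on eps
    and on [T]. Hence the constants of the composition, linear-equation and flow lemmas are produced
    before the sets, the vector field and the flow are introduced. Neither [U] nor the orbits need
    be bounded, so bounds are kept on derivatives of the flow but never on the flow itself, and
    error estimates are stated for increments of norm at most 1; longer increments are handled by
    the triangle inequality and the bounds. *)

Section RealTools.
Variable R : realType.

Lemma powR_onePlus (x e : R) : 0 <= x -> 0 < e -> x `^ (1 + e) = x * x `^ e.
Proof.
move=> x0 e0; rewrite powRD ?powRr1 //.
by apply/implyP => /eqP h; move: e0; rewrite lt_def; lra.
Qed.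

Lemma le_powR_of_le1 (x e : R) : 0 <= x <= 1 -> 0 < e <= 1 -> x <= x `^ e.
Proof.
move=> /andP[x0 x1] /andP[e0 e1].
have [->|xn0] := eqVneq x 0; first exact: powR_ge0.
rewrite -[leLHS](powRr1 x0) ger_powR //.
by rewrite lt_def xn0 x0.
Qed.

Lemma powR_le1 (x e : R) : 0 <= x <= 1 -> 0 <= e -> x `^ e <= 1.
Proof.
move=> /andP[x0 x1] e0.
have <- : 1 `^ e = 1 :> R by rewrite powR1.
by apply: ge0_ler_powR; rewrite ?nnegrE.
Qed.

Lemma ler_powR2 (x y e : R) : 0 <= e -> 0 <= x -> x <= y -> x `^ e <= y `^ e.
Proof.
move=> e0 x0 xy; apply: ge0_ler_powR; rewrite ?nnegrE //.
exact: le_trans xy.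
Qed.

Lemma powR_near0 (K e eta : R) : 0 <= K -> 0 < e -> 0 < eta ->
  exists2 de, 0 < de & forall r, 0 <= r -> r <= de -> K * r `^ e <= eta.
Proof.
move=> K0 e0 eta0.
have eta1 : 0 < eta / (K + 1) by rewrite divr_gt0 // ltr_wpDl.
exists ((eta / (K + 1)) `^ e^-1); first exact: powR_gt0.
move=> r r0 rde; have h : r `^ e <= eta / (K + 1).
  apply: le_trans (ler_powR2 (ltW e0) r0 rde) _.
  by rewrite -powRrM mulVf ?powRr1 ?gt_eqF // ltW.
apply: le_trans (ler_wpM2l K0 h) _.
by rewrite mulrA ler_pdivrMr ?ltr_wpDl // mulrC ler_pM2l // lerDl.
Qed.

Lemma diff_quotient_err (h l x y : R) : h != 0 ->
  l - h^-1 *: (x - y) = - (h^-1 * (x - y - h * l)).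
Proof. by move=> h0; rewrite /GRing.scale /=; field. Qed.

Lemma is_derive_approx (V : normedModType R) (f : V -> R) (a v : V) (l : R) :
  (forall eta, 0 < eta ->
     \forall h \near (0 : R)^', `|f (h *: v + a) - f a - h * l| <= eta * `|h|) ->
  is_derive a v f l.
Proof.
move=> H.
have cv : (fun h : R => h^-1 *: ((f \o shift a) (h *: v) - f a)) @ (0 : R)^' --> l.
  apply/cvgrPdist_le => eta eta0; near=> h.
  have h0 : h != 0 by near: h; exact: nbhs_dnbhs_neq.
  have -> : l - h^-1 *: ((f \o shift a) (h *: v) - f a) =
    - (h^-1 * (f (h *: v + a) - f a - h * l)).
    exact: diff_quotient_err.
  rewrite normrN normrM normfV mulrC ler_pdivrMr ?normr_gt0 //.
  by near: h; exact: H.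
by split; [apply/cvg_ex; exists l | exact: cvg_lim].
Unshelve. all: by end_near. Qed.

Lemma is_derive_near (V : normedModType R) (f : V -> R) (a v : V) (l eta : R) :
  is_derive a v f l -> 0 < eta ->
  \forall h \near (0 : R)^', `|f (h *: v + a) - f a - h * l| <= eta * `|h|.
Proof.
move=> [/cvg_ex[l' cv] dl] eta0.
have ll' : l' = l by rewrite -dl; apply/esym; exact: cvg_lim.
rewrite ll' in cv; move/cvgrPdist_le : cv => /(_ _ eta0) cv.
near=> h.
have h0 : h != 0 by near: h; exact: nbhs_dnbhs_neq.
have : `|l - h^-1 *: ((f \o shift a) (h *: v) - f a)| <= eta by near: h; exact: cv.
have -> : l - h^-1 *: ((f \o shift a) (h *: v) - f a) =
    - (h^-1 * (f (h *: v + a) - f a - h * l)).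
    exact: diff_quotient_err.
by rewrite normrN normrM normfV mulrC ler_pdivrMr ?normr_gt0.
Unshelve. all: by end_near. Qed.

Lemma is_derive_bigsum (V : normedModType R) (L : finType) (h : L -> V -> R)
    (dh : L -> R) (x v : V) :
  (forall l, is_derive x v (h l) (dh l)) ->
  is_derive x v (fun y => \sum_l h l y) (\sum_l dh l).
Proof.
move=> H; have -> : (fun y => \sum_l h l y) = \sum_l h l.
  by apply/funext => y; rewrite fct_sumE.
by elim/big_ind2 : _ => // [|] *; [exact: is_derive_cst|exact: is_deriveD].
Qed.

Lemma is_derive_continuous1 (f : R -> R) (x l : R) :
  is_derive x 1 f l -> {for x, continuous f}.
Proof.
move=> [d _]; apply: differentiable_continuous.
exact/derivable1_diffP.
Qed.

(** The endpoints come in no particular order, because time increments of both signs occur later. *)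
Lemma MVT_any (f df : R -> R) (a b : R) :
  (forall x, Num.min a b <= x <= Num.max a b -> is_derive x 1 f (df x)) ->
  exists2 c, Num.min a b <= c <= Num.max a b & f b - f a = df c * (b - a).
Proof.
move=> H.
wlog ab : a b H / a <= b.
  move=> W; have /orP[ab|ba] := le_total a b; first exact: W.
  have [|c cab E] := W b a _ ba.
    by move=> x; rewrite minC maxC; exact: H.
  exists c; first by rewrite minC maxC.
  by rewrite -opprB E -mulrN opprB.
have -> : Num.min a b = a by rewrite min_l.
have -> : Num.max a b = b by rewrite max_r.
have H' x : a <= x <= b -> is_derive x 1 f (df x).
  by move=> xab; apply: H; rewrite min_l // max_r.
have [||c cab E] := @MVT_segment R f df a b ab.
- by move=> x; rewrite in_itv /= => /andP[? ?]; apply: H'; rewrite !ltW.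
- apply: continuous_in_subspaceT => x; rewrite inE /= in_itv /= => xab.
  exact: is_derive_continuous1 (H' _ xab).
- by exists c => //; move: cab; rewrite in_itv.
Qed.

Lemma mean_value_le (f df : R -> R) (a b M : R) :
  (forall x, Num.min a b <= x <= Num.max a b -> is_derive x 1 f (df x)) ->
  (forall x, Num.min a b <= x <= Num.max a b -> `|df x| <= M) ->
  `|f b - f a| <= M * `|b - a|.
Proof.
move=> H HM; have [c cab ->] := MVT_any H.
by rewrite normrM ler_wpM2r // HM.
Qed.

Lemma between_dist (t u s : R) :
  Num.min t u <= s <= Num.max t u -> `|s - t| <= `|u - t|.
Proof.
by have /orP[tu|tu] := le_total t u; [rewrite min_l // max_r //|rewrite min_r // max_l //];
  move=> /andP[? ?]; [rewrite !ger0_norm|rewrite !ler0_norm]; lra.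
Qed.

End RealTools.

(** * Gronwall's inequality and linear differential equations *)

Section Gronwall.
Variables (R : realType) (T : R) (L : finType).

(** With c = 2 * A * #|L| + 1, the energy in [gronwall_forward] is at most #|L| * (S + B)^2 at time
    0 and grows at most by the factor e^(c T). The summand 1 makes the constant at least 1, hence at
    most its own square, which saves a square root. *)
Definition gronwall_const (A : R) : R :=
  1 + #|L|%:R * expR ((2 * A * #|L|%:R + 1) * T).

Lemma gronwall_const_ge1 A : 1 <= gronwall_const A.
Proof. by rewrite lerDl mulr_ge0 // expR_ge0. Qed.

Lemma is_derive_expRM (c s : R) :
  is_derive s 1 (fun s : R => expR (c * s)) (c * expR (c * s)).
Proof.
have h : is_derive s 1 (fun x : R => c *: x) (c *: 1) by exact: is_deriveZ.
have h2 : is_derive s 1 (fun x : R => c * x) c.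
  by apply: (is_derive_eq h); exact: mulr1.
have := @is_derive1_comp R expR (fun x => c * x) s _ _ (is_derive_expR (c * s)) h2.
by rewrite mulrC.
Qed.

(** A sum of squares is differentiable where a sum of absolute values may fail to be, and the
    summand [N * B ^+ 2] of the energy [psi] absorbs the inhomogeneity: psi' <= c psi, so psi(s)
    e^(- c s) does not increase. *)
Lemma gronwall_forward (phi dphi : L -> R -> R) (A B S t : R) :
  0 <= A -> 0 <= B -> 0 <= S -> 0 <= t <= T ->
  (forall s, 0 <= s <= t -> forall l, is_derive s 1 (phi l) (dphi l s)) ->
  (forall s, 0 <= s <= t -> forall l,
     `|dphi l s| <= A * (\sum_j `|phi j s|) + B) ->
  (forall l, `|phi l 0| <= S) ->
  forall l, `|phi l t| <= gronwall_const A * (S + B).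
Proof.
move=> A0 B0 S0 /andP[t0 tT] Hd Hb HS l.
set N : R := #|L|%:R.
have N0 : 0 <= N by [].
set c := 2 * A * N + 1.
have c1 : 1 <= c by rewrite /c lerDr !mulr_ge0.
pose psi s := \sum_j phi j s ^+ 2 + N * B ^+ 2.
pose chi s := psi s * expR (- c * s).
have psi0 s : 0 <= psi s.
  by rewrite addr_ge0 ?mulr_ge0 ?sqr_ge0 // sumr_ge0 // => j _; exact: sqr_ge0.
pose dpsi s := \sum_j 2 * (phi j s * dphi j s).
have dpsiP s : 0 <= s <= t -> is_derive s 1 psi (dpsi s).
  move=> st; rewrite /psi /dpsi -[X in is_derive _ _ _ X]addr0.
  apply: is_deriveD; apply: is_derive_bigsum => j.
  have h := Hd _ st j.
  have := is_deriveM h h => /is_derive_eq; apply.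
  by rewrite /GRing.scale /=; ring.
have dpsi_le s : 0 <= s <= t -> dpsi s <= c * psi s.
  move=> st.
  (* The inequality 2 x y <= x^2 + y^2, applied to each pair [phi j], [phi k] and to [phi j],
     [B]. *)
  have h1 : dpsi s <= \sum_j (A * \sum_k (phi j s ^+ 2 + phi k s ^+ 2) + (B ^+ 2 + phi j s ^+ 2)).
    apply: ler_sum => j _.
    have h : 2 * (phi j s * dphi j s) <= 2 * (`|phi j s| * (A * (\sum_k `|phi k s|) + B)).
      rewrite ler_pM2l //; apply: le_trans (ler_norm _) _.
      by rewrite normrM ler_wpM2l //; exact: Hb.
    apply: le_trans h _.
    rewrite mulrDr mulrDr lerD //.
      have -> : 2 * (`|phi j s| * (A * \sum_k `|phi k s|)) =
                A * \sum_k (2 * (`|phi j s| * `|phi k s|)).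
        by rewrite -!mulr_sumr; ring.
      rewrite ler_wpM2l //; apply: ler_sum => k _.
      rewrite -[phi j s ^+ 2]real_normK ?num_real // -[phi k s ^+ 2]real_normK ?num_real //.
      have := sqr_ge0 (`|phi j s| - `|phi k s|); rewrite sqrrB; lra.
    rewrite -[phi j s ^+ 2]real_normK ?num_real //.
    have := sqr_ge0 (`|phi j s| - B); rewrite sqrrB; lra.
  apply: le_trans h1 _.
  set X := \sum_j phi j s ^+ 2.
  have E1 : \sum_j \sum_k (phi j s ^+ 2 + phi k s ^+ 2) = 2 * N * X.
    transitivity (\sum_j (N * phi j s ^+ 2 + X)).
      by apply: eq_bigr => j _; rewrite big_split /= sumr_const -mulr_natl.
    by rewrite big_split /= -mulr_sumr sumr_const -mulr_natl -/N -/X; ring.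
  have E2 : \sum_(j : L) (B ^+ 2 + phi j s ^+ 2) = N * B ^+ 2 + X.
    by rewrite big_split /= sumr_const -mulr_natl.
  rewrite big_split /= -mulr_sumr E1 E2 /psi -/X /c.
  have X0 : 0 <= X by apply: sumr_ge0 => j _; exact: sqr_ge0.
  have P : 0 <= A * N * (N * B ^+ 2) by rewrite !mulr_ge0 // sqr_ge0.
  nra.
pose dchi s := (dpsi s - c * psi s) * expR (- c * s).
have chi_le : chi t <= chi 0.
  have [|u uu E] := @MVT_any R chi dchi 0 t.
    move=> s; rewrite min_l // max_r // => st.
    have := is_deriveM (dpsiP _ st) (is_derive_expRM (- c) s) => /is_derive_eq; apply.
    by rewrite /GRing.scale /= /dchi; ring.
  rewrite -subr_le0 E subr0 mulr_le0_ge0 // mulr_le0_ge0 ?expR_ge0 //.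
  by rewrite subr_le0 dpsi_le //; move: uu; rewrite min_l // max_r.
have psit : psi t <= psi 0 * expR (c * T).
  have : psi t <= psi 0 * expR (c * t).
    move: chi_le; rewrite /chi mulr0 expR0 mulr1 mulNr expRN.
    by rewrite ler_pdivrMr ?expR_gt0.
  move=> /le_trans; apply; rewrite ler_wpM2l // ler_expR ler_wpM2l //.
  exact: le_trans c1.
have psi00 : psi 0 <= N * (S + B) ^+ 2.
  have : psi 0 <= \sum_(j : L) S ^+ 2 + N * B ^+ 2.
    rewrite lerD2r; apply: ler_sum => j _.
    by rewrite -[phi j 0 ^+ 2]real_normK ?num_real // lerXn2r ?nnegrE.
  move/le_trans; apply; rewrite sumr_const -mulr_natl -/N -mulrDr ler_wpM2l //.
  by rewrite sqrrD; have := mulr_ge0 S0 B0; nra.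
have C1 := gronwall_const_ge1 A.
have C0 : 0 <= gronwall_const A by exact: le_trans ler01 C1.
rewrite -ler_sqr ?nnegrE ?mulr_ge0 ?addr_ge0 //.
rewrite real_normK ?num_real //.
have h1 : phi l t ^+ 2 <= psi t.
  rewrite /psi (bigD1 l) //= -addrA lerDl addr_ge0 ?mulr_ge0 ?sqr_ge0 //.
  by apply: sumr_ge0 => j _; exact: sqr_ge0.
apply: le_trans h1 _; apply: le_trans psit _.
rewrite exprMn.
have E0 := expR_ge0 (c * T).
apply: (@le_trans _ _ (gronwall_const A * (S + B) ^+ 2)).
  have -> : gronwall_const A * (S + B) ^+ 2 =
      (S + B) ^+ 2 + N * (S + B) ^+ 2 * expR (c * T).
    by rewrite /gronwall_const -/N -/c; ring.
  have Q := sqr_ge0 (S + B).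
  by have := ler_wpM2r E0 psi00; lra.
rewrite ler_wpM2r ?sqr_ge0 // expr2 ler_peMl //.
Qed.

(** Negative times reduce to positive ones by the reversal s -> - s, since the hypotheses only
    involve absolute values. *)
Lemma gronwall (phi dphi : L -> R -> R) (A B S t : R) :
  0 <= A -> 0 <= B -> 0 <= S -> t \in `]- T, T[ ->
  (forall s, s \in `]- T, T[ -> forall l, is_derive s 1 (phi l) (dphi l s)) ->
  (forall s, s \in `]- T, T[ -> forall l,
     `|dphi l s| <= A * (\sum_j `|phi j s|) + B) ->
  (forall l, `|phi l 0| <= S) ->
  forall l, `|phi l t| <= gronwall_const A * (S + B).
Proof.
move=> A0 B0 S0; rewrite in_itv /= => /andP[t1 t2] Hd Hb HS l.
have [t0|t0] := leP 0 t.
  apply: (@gronwall_forward phi dphi) => //.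
  - by rewrite t0 ltW.
  - by move=> s /andP[s0 st]; apply: Hd; rewrite in_itv /=; lra.
  - by move=> s /andP[s0 st]; apply: Hb; rewrite in_itv /=; lra.
have := @gronwall_forward (fun l s => phi l (- s)) (fun l s => - dphi l (- s)) A B S (- t).
rewrite opprK; apply => //.
- by lra.
- move=> s /andP[s0 st] j.
  have h : is_derive (- s) 1 (phi j) (dphi j (- s)) by apply: Hd; rewrite in_itv /=; lra.
  have := @is_derive1_comp R (phi j) -%R s (dphi j (- s)) (- 1) h _.
  by rewrite mulrN1; apply; exact: is_deriveNid.
- by move=> s /andP[s0 st] j; rewrite normrN; apply: Hb; rewrite in_itv /=; lra.
- by move=> j; rewrite oppr0.
Qed.

End Gronwall.

Section LinearODE.
Variables (R : realType) (T : R) (L : finType).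

Lemma ler_all_eps (D x y : R) :
  0 <= D -> (forall eta, 0 < eta -> x <= y + D * eta) -> x <= y.
Proof.
move=> D0 H; apply/ler_addgt0Pr => e e0.
have D1 : 0 < D + 1 by lra.
apply: le_trans (H (e / (D + 1)) (divr_gt0 e0 D1)) _.
rewrite lerD2l mulrA ler_pdivrMr // mulrC ler_pM2l //; lra.
Qed.

(** Approximate solutions of every precision stand in for an existence theorem. By Gronwall's
    inequality they are uniformly close to each other; their limit [k] is continuous, hence so is
    [w], the right-hand side along [k], and comparing the increments of [k] with those of an
    approximate solution shows that its derivative is [w]. *)
Lemma linear_ode_exists (a : L -> L -> R -> R) (b : L -> R -> R) (c : L -> R) (K : R) :
  0 < T -> 0 <= K ->
  (forall i j s, s \in `]- T, T[ -> `|a i j s| <= K) ->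
  (forall i j, {in `]- T, T[, continuous (a i j)}) ->
  (forall i, {in `]- T, T[, continuous (b i)}) ->
  (forall eta, 0 < eta -> exists e de : L -> R -> R,
     [/\ forall s i, s \in `]- T, T[ -> is_derive s 1 (e i) (de i s),
         forall s i, s \in `]- T, T[ ->
           `|de i s - (\sum_j a i j s * e j s + b i s)| <= eta
       & forall i, e i 0 = c i]) ->
  exists k : L -> R -> R, (forall i, k i 0 = c i) /\
    forall s i, s \in `]- T, T[ ->
      is_derive s 1 (k i) (\sum_j a i j s * k j s + b i s).
Proof.
move=> T0 K0 aK ca cb Hex.
pose P (e : L -> R -> R) eta := exists2 de : L -> R -> R,
     (forall s i, s \in `]- T, T[ -> is_derive s 1 (e i) (de i s)) &
     (forall s i, s \in `]- T, T[ ->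
           `|de i s - (\sum_j a i j s * e j s + b i s)| <= eta)
      /\ forall i, e i 0 = c i.
have {}Hex eta : 0 < eta -> exists e, P e eta.
  by move=> /Hex[e [de [h1 h2 h3]]]; exists e; exists de.
have asum i s (x y : L -> R) : s \in `]- T, T[ ->
    `|\sum_j a i j s * x j - \sum_j a i j s * y j| <= K * \sum_j `|x j - y j|.
  move=> sI; rewrite -sumrB; apply: le_trans (ler_norm_sum _ _ _) _.
  rewrite mulr_sumr; apply: ler_sum => j _.
  by rewrite -mulrBr normrM ler_wpM2r // aK.
set C := gronwall_const T L K.
have C1 : 1 <= C := gronwall_const_ge1 T L K.
have C0 : 0 <= C := le_trans ler01 C1.
have Pclose e e' eta eta' t i : 0 < eta -> 0 < eta' -> P e eta -> P e' eta' ->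
    t \in `]- T, T[ -> `|e i t - e' i t| <= C * (eta + eta').
  move=> eta0 eta'0 [de d1 [d2 d3]] [de' d1' [d2' d3']] tI.
  rewrite -[eta + eta']add0r.
  apply: (@gronwall R T L (fun i s => e i s - e' i s) (fun i s => de i s - de' i s)) => //.
  - by rewrite addr_ge0 // ltW.
  - by move=> s sI l; apply: is_deriveB; [exact: d1|exact: d1'].
  - move=> s sI l.
    have -> : de l s - de' l s = (de l s - (\sum_j a l j s * e j s + b l s)) -
       (de' l s - (\sum_j a l j s * e' j s + b l s)) +
       (\sum_j a l j s * e j s - \sum_j a l j s * e' j s) by ring.
    apply: le_trans (ler_normD _ _) _; rewrite addrC lerD ?asum //.
    by rewrite (le_trans (ler_normB _ _)) // lerD ?d2 ?d2'.
  - by move=> l; rewrite d3 d3' subrr normr0.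
(* By Gronwall, [e t - C * eta <= e' t + C * eta'] for all approximate solutions
   [e] and [e'] with errors [eta] and [eta']: the supremum separates the two sides. *)
pose k i t := sup [set x | exists e eta, [/\ 0 < eta, P e eta & x = e i t - C * eta]].
have kclose e eta t i : 0 < eta -> P e eta -> t \in `]- T, T[ ->
    `|k i t - e i t| <= C * eta.
  move=> eta0 Pe tI; rewrite ler_distl; apply/andP; split.
    apply: ub_le_sup; last by exists e, eta.
    exists (e i t + C * eta) => _ [e' [eta' [eta'0 Pe' ->]]].
    have := Pclose _ _ _ _ _ i eta'0 eta0 Pe' Pe tI.
    by rewrite ler_norml => /andP[_]; lra.
  apply: ge_sup; first by exists (e i t - C * eta), e, eta.
  move=> _ [e' [eta' [eta'0 Pe' ->]]].
  have := Pclose _ _ _ _ _ i eta'0 eta0 Pe' Pe tI.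
  by rewrite ler_norml => /andP[_]; lra.
have I0 : 0 \in `]- T, T[ by rewrite in_itv /=; lra.
exists k; split.
  move=> i; apply/eqP; rewrite -subr_eq0 -normr_le0.
  apply: (ler_all_eps C0) => eta eta0; rewrite add0r.
  have [e Pe] := Hex _ eta0.
  have := kclose _ _ _ i eta0 Pe I0.
  by case: Pe => de _ [_ ->].
have kcont j : {in `]- T, T[, continuous (k j)}.
  move=> t tI; apply/cvgrPdist_le => eps eps0.
  have eta0 : 0 < eps / (3 * C) by rewrite divr_gt0 // mulr_gt0 // (lt_le_trans _ C1).
  have [e Pe] := Hex _ eta0.
  have Ce : C * (eps / (3 * C)) = eps / 3.
    by field; rewrite gt_eqF // (lt_le_trans _ C1).
  have /(@cvgrPdist_le _ _ _ (nbhs t)) ce : {for t, continuous (e j)}.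
    by case: Pe => de d1 _; exact: is_derive_continuous1 (d1 _ _ tI).
  have e30 : 0 < eps / 3 by rewrite divr_gt0.
  have := ce _ e30 => {}ce.
  near=> s.
  have sI : s \in `]- T, T[ by near: s; exact: near_in_itvoo.
  have h1 := kclose _ _ _ j eta0 Pe tI.
  have h2 := kclose _ _ _ j eta0 Pe sI.
  have h3 : `|e j t - e j s| <= eps / 3 by near: s.
  rewrite Ce in h1 h2.
  by move: h1 h2 h3; rewrite !ler_norml => /andP[? ?] /andP[? ?] /andP[? ?]; apply/andP; split; lra.
move=> t i tI.
pose w s := \sum_j a i j s * k j s + b i s.
have cw : {for t, continuous w}.
  apply: cvgD; last exact: cb.
  apply: cvg_big => [|j _]; first exact: add_continuous.
   apply: cvgM; [exact: ca|exact: kcont].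
apply: is_derive_approx => eta0 eta00.
have e2 : 0 < eta0 / 2 by rewrite divr_gt0.
move: cw => /(@cvgrPdist_le _ _ _ (nbhs t)) /(_ _ e2) /nbhs_ballP[d /= d0 dw].
have /nbhs_ballP[d' /= d'0 d'I] : \forall s \near t, s \in `]- T, T[.
  exact: near_in_itvoo.
have m0 : 0 < Num.min d d' by rewrite lt_min d0.
near=> h.
have hm : `|h| < Num.min d d' by near: h; apply: dnbhs0_lt.
have near_t s : Num.min t (h + t) <= s <= Num.max t (h + t) -> `|t - s| <= `|h|.
  by move=> /between_dist; rewrite addrK distrC.
have sI s : Num.min t (h + t) <= s <= Num.max t (h + t) -> s \in `]- T, T[.
  move=> /near_t st; apply: d'I; rewrite /ball /=.
  by rewrite (le_lt_trans st) // (lt_le_trans hm) // ge_min lexx orbT.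
have sw s : Num.min t (h + t) <= s <= Num.max t (h + t) -> `|w t - w s| <= eta0 / 2.
  move=> /near_t st; apply: dw; rewrite /ball /=.
  by rewrite (le_lt_trans st) // (lt_le_trans hm) // ge_min lexx.
have thI : h + t \in `]- T, T[ by apply: sI; rewrite ge_min le_max lexx !orbT.
rewrite -/(w t) [h *: 1]mulr1.
apply: (@le_trans _ _ (eta0 / 2 * `|h|)); last by rewrite ler_wpM2r //; lra.
(* The increment [h] is now fixed while the precision [eta] tends to 0. Replacing [k] by an
   approximate solution costs [C * eta] at each of the two ends, and [(1 + K * (#|L|%:R * C)) * eta]
   in the derivative on a segment of length |h|. *)
have D0 : 0 <= 2 * C + `|h| * (1 + K * (#|L|%:R * C)) by rewrite !(addr_ge0, mulr_ge0).
apply: (ler_all_eps D0) => eta etap.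
have [e Pe] := Hex _ etap.
have h1 := kclose _ _ _ i etap Pe tI.
have h2 := kclose _ _ _ i etap Pe thI.
have kc s : s \in `]- T, T[ -> \sum_j `|e j s - k j s| <= #|L|%:R * (C * eta).
  move=> ssI; rewrite mulr_natl -sumr_const; apply: ler_sum => j _.
  by rewrite distrC; exact: kclose.
case: Pe => de d1 [d2 _].
(* Once the linear function [s * w t] is subtracted, the mean value inequality measures how far the
   slope of [e i] is from [w t]; the continuity of [w] at [t] contributes the only term without
   [eta]. *)
have h3 : `|(e i (h + t) - (h + t) * w t) - (e i t - t * w t)| <=
    (eta0 / 2 + (1 + K * (#|L|%:R * C)) * eta) * `|h + t - t|.
  apply: (@mean_value_le R (fun s => e i s - s * w t) (fun s => de i s - w t) t (h + t)).
    move=> s /sI ssI; apply: is_deriveB; first exact: d1.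
    have hw : is_derive s 1 (w t \*: @id R) (w t *: 1) by exact: is_deriveZ.
    have -> : (fun s => s * w t) = w t \*: @id R by apply/funext => z; exact: mulrC.
    by apply: (is_derive_eq hw); exact: mulr1.
  move=> s ss; have ssI := sI _ ss.
  have q1 := d2 _ i ssI.
  have q2 := asum i s (e^~ s) (k^~ s) ssI.
  have q3 := kc _ ssI.
  have q4 := sw _ ss.
  have q5 := ler_wpM2l K0 q3.
  have q6 := le_trans q2 q5.
  have -> : de i s - w t = (de i s - (\sum_j a i j s * e j s + b i s)) +
    (\sum_j a i j s * e j s - \sum_j a i j s * k j s) + (w s - w t) by rewrite /w; ring.
  apply: le_trans (ler_normD _ _) _; rewrite [`|w s - w t|]distrC.
  have q7 := ler_normD (de i s - (\sum_j a i j s * e j s + b i s))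
    (\sum_j a i j s * e j s - \sum_j a i j s * k j s).
  by lra.
rewrite addrK in h3.
move: h1 h2 h3; rewrite !ler_norml => /andP[? ?] /andP[? ?] /andP[? ?].
by apply/andP; split; nra.
Unshelve. all: by end_near. Qed.

End LinearODE.

(** * Scalar functions with Hoelder derivatives *)

Section Smooth.
Variables (R : realType) (eps : R).
Hypotheses (eps_gt0 : 0 < eps) (eps_le1 : eps <= 1).

Definition real_linear (V : lmodType R) (f : V -> R) : Prop :=
  forall a u v, f (a *: u + v) = a * f u + f v.

Lemma real_linear0 (V : lmodType R) (f : V -> R) : real_linear f -> f 0 = 0.
Proof.
by move=> lf; have := lf 1 0 0; rewrite scaler0 addr0 mul1r => h; lra.
Qed.

Lemma real_linearZ (V : lmodType R) (f : V -> R) a u :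
  real_linear f -> f (a *: u) = a * f u.
Proof. by move=> lf; have := lf a u 0; rewrite !addr0 real_linear0 // addr0. Qed.

Lemma real_linearD (V : lmodType R) (f : V -> R) u v :
  real_linear f -> f (u + v) = f u + f v.
Proof. by move=> lf; have := lf 1 u v; rewrite scale1r mul1r. Qed.

Section Class.
Variables (V : normedModType R) (D : set V).

Definition bounded_on (K : R) (g : V -> R) : Prop := forall p, D p -> `|g p| <= K.

(** For increments of norm r <= 1 one has r^2 <= r^(1 + eps) <= r <= r^eps <= 1, so that error terms
    of different orders can be added up. Longer increments are left to boundedness. *)
Definition hoelder_on (K : R) (g : V -> R) : Prop :=
  forall p q, D p -> D q -> `|q - p| <= 1 -> `|g q - g p| <= K * `|q - p| `^ eps.

Definition expands_on (K : R) (g : V -> R) (dg : V -> V -> R) : Prop :=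
  (forall p, D p -> real_linear (dg p)) /\
  forall p q, D p -> D q -> `|q - p| <= 1 ->
    `|g q - g p - dg p (q - p)| <= K * `|q - p| `^ (1 + eps).

(* [C^{m,eps}] functions with bounds [K], described by first-order expansions
   alone, so that composing with a jet given on a set without interior (where
   only expansions are available) stays within the class. *)
Fixpoint smooth (m : nat) (K : R) (g : V -> R) : Prop :=
  bounded_on K g /\
  match m with
  | 0 => hoelder_on K g
  | m'.+1 => exists dg : V -> V -> R, expands_on K g dg /\
      forall u, smooth m' (K * `|u|) (dg^~ u)
  end.

(* The bound on [g] itself is left out: a flow need not be bounded. *)
Definition smooth_diff (m : nat) (K : R) (g : V -> R) (dg : V -> V -> R) : Prop :=
  expands_on K g dg /\ forall u, smooth m (K * `|u|) (dg^~ u).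

Lemma smooth_bounded m K g : smooth m K g -> bounded_on K g.
Proof. by case: m => [|m] []. Qed.

Lemma powR_small (r : R) : 0 <= r <= 1 ->
  [/\ r `^ (1 + eps) <= r, r <= r `^ eps, r `^ eps <= 1,
      r * r <= r `^ (1 + eps) & r `^ (1 + eps) = r * r `^ eps].
Proof.
move=> /andP[r0 r1].
have E : r `^ (1 + eps) = r * r `^ eps by exact: powR_onePlus.
have h1 : r `^ eps <= 1 by rewrite powR_le1 ?r0 // ltW.
have h2 : r <= r `^ eps by rewrite le_powR_of_le1 ?r0 ?eps_gt0.
split => //; rewrite ?powR_ge0 // E.
- by rewrite ler_piMr.
- by rewrite ler_wpM2l.
Qed.

Lemma smooth_ge0 m K g p : smooth m K g -> D p -> 0 <= K.
Proof. by move=> /smooth_bounded h Dp; exact: le_trans (h _ Dp). Qed.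

Lemma smooth_mono m K K' g : K <= K' -> smooth m K g -> smooth m K' g.
Proof.
elim: m K K' g => [|m IH] K K' g KK [bg hg].
  split; first by move=> p Dp; exact: le_trans (bg _ Dp) KK.
  move=> p q Dp Dq pq; apply: le_trans (hg _ _ Dp Dq pq) _.
  by rewrite ler_wpM2r // powR_ge0.
split; first by move=> p Dp; exact: le_trans (bg _ Dp) KK.
case: hg => dg [[ldg hg] hdg]; exists dg; split.
  split => // p q Dp Dq pq; apply: le_trans (hg _ _ Dp Dq pq) _.
  by rewrite ler_wpM2r // powR_ge0.
by move=> u; apply: IH (hdg u); rewrite ler_wpM2r.
Qed.

Lemma smooth_ext m K g g' : (forall p, D p -> g p = g' p) ->
  smooth m K g -> smooth m K g'.
Proof.
move=> E; case: m => [|m] [bg hg]; split.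
- by move=> p Dp; rewrite -E //; exact: bg.
- by move=> p q Dp Dq pq; rewrite -!E //; exact: hg.
- by move=> p Dp; rewrite -E //; exact: bg.
case: hg => dg [[ldg hg] hdg]; exists dg; split => //; split => //.
by move=> p q Dp Dq pq; rewrite -!E //; exact: hg.
Qed.

Lemma smooth_scale m K g a : smooth m K g -> smooth m (`|a| * K) (fun p => a * g p).
Proof.
elim: m K g => [|m IH] K g [bg hg]; split.
- by move=> p Dp; rewrite normrM ler_wpM2l // bg.
- by move=> p q Dp Dq pq; rewrite -mulrBr normrM -mulrA ler_wpM2l // hg.
- by move=> p Dp; rewrite normrM ler_wpM2l // bg.
case: hg => dg [[ldg hg] hdg]; exists (fun p u => a * dg p u); split.
  split; first by move=> p Dp b u v; rewrite ldg //; ring.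
  by move=> p q Dp Dq pq; rewrite -!mulrBr normrM -mulrA ler_wpM2l // hg.
by move=> u; rewrite -mulrA; exact: (IH _ _ (hdg u)).
Qed.

Lemma smoothD m K1 K2 g1 g2 : smooth m K1 g1 -> smooth m K2 g2 ->
  smooth m (K1 + K2) (fun p => g1 p + g2 p).
Proof.
elim: m K1 K2 g1 g2 => [|m IH] K1 K2 g1 g2 [b1 h1] [b2 h2].
  split; first by move=> p Dp; rewrite (le_trans (ler_normD _ _)) // lerD ?b1 ?b2.
  move=> p q Dp Dq pq; rewrite opprD addrACA (le_trans (ler_normD _ _)) //.
  by rewrite mulrDl lerD ?h1 ?h2.
split; first by move=> p Dp; rewrite (le_trans (ler_normD _ _)) // lerD ?b1 ?b2.
case: h1 => d1 [[l1 h1] s1]; case: h2 => d2 [[l2 h2] s2].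
exists (fun p u => d1 p u + d2 p u); split.
  split; first by move=> p Dp a u v; rewrite l1 // l2 //; ring.
  move=> p q Dp Dq pq.
  have -> : g1 q + g2 q - (g1 p + g2 p) - (d1 p (q - p) + d2 p (q - p)) =
    (g1 q - g1 p - d1 p (q - p)) + (g2 q - g2 p - d2 p (q - p)) by ring.
  by rewrite (le_trans (ler_normD _ _)) // mulrDl lerD ?h1 ?h2.
by move=> u; rewrite mulrDl; exact: (IH _ _ _ _ (s1 u) (s2 u)).
Qed.

Lemma smooth_cst m (a : R) : smooth m `|a| (fun=> a).
Proof.
elim: m a => [|m IH] a; split => //.
  by move=> p q _ _ _; rewrite subrr normr0 mulr_ge0 // powR_ge0.
exists (fun _ _ => 0); split.
  split; first by move=> p _ b u v; rewrite mulr0 addr0.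
  by move=> p q _ _ _; rewrite !subrr normr0 mulr_ge0 // powR_ge0.
by move=> u; apply: smooth_mono (IH 0); rewrite normr0 mulr_ge0.
Qed.

Lemma smooth_sum m (L : finType) (K : L -> R) (g : L -> V -> R) :
  (forall l, smooth m (K l) (g l)) -> smooth m (\sum_l K l) (fun p => \sum_l g l p).
Proof.
move=> H; have : forall s : seq L, smooth m (\sum_(l <- s) K l) (fun p => \sum_(l <- s) g l p).
  elim=> [|l s IH].
    rewrite big_nil; apply: (@smooth_ext _ _ (fun=> 0)).
      by move=> p _; rewrite big_nil.
    by rewrite -[X in smooth _ X](@normr0 _ R); exact: smooth_cst.
  rewrite big_cons; apply: (@smooth_ext _ _ (fun p => g l p + \sum_(l <- s) g l p)).
    by move=> p _; rewrite big_cons.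
  exact: smoothD.
exact.
Qed.

Lemma smooth_lipschitz m K g p q : smooth m.+1 K g -> D p -> D q -> `|q - p| <= 1 ->
  `|g q - g p| <= 2 * K * `|q - p|.
Proof.
move=> sg Dp Dq pq; have K0 := smooth_ge0 sg Dp.
case: sg => bg [dg [[ldg hg] hdg]].
have h1 := hg _ _ Dp Dq pq.
have h2 : `|dg p (q - p)| <= K * `|q - p| := smooth_bounded (hdg (q - p)) Dp.
have [|h3 _ _ _ _] := @powR_small `|q - p|; first by rewrite normr_ge0.
have h4 := ler_wpM2l K0 h3.
have := ler_normD (g q - g p - dg p (q - p)) (dg p (q - p)); rewrite subrK.
by move/le_trans; apply; lra.
Qed.

(** The factor 2 arises at the bottom, where a Lipschitz bound collects [K] from the error of the
    expansion and [K] from its linear part; above it the same [dg] serves. *)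
Lemma smooth_down m K g : smooth m.+1 K g -> smooth m (2 * K) g.
Proof.
elim: m K g => [|m IH] K g sg.
  split.
    move=> p Dp; have := smooth_ge0 sg Dp; have := smooth_bounded sg Dp; lra.
  move=> p q Dp Dq pq; apply: le_trans (smooth_lipschitz sg Dp Dq pq) _.
  have K0 := smooth_ge0 sg Dp.
  rewrite ler_wpM2l ?mulr_ge0 //.
  by have [] := @powR_small `|q - p|; first by rewrite normr_ge0.
have [bg [dg [[ldg hg] hdg]]] := sg.
split.
  move=> p Dp; have := smooth_ge0 sg Dp; have := bg _ Dp; lra.
exists dg; split.
  split => // p q Dp Dq pq; apply: le_trans (hg _ _ Dp Dq pq) _.
  rewrite ler_wpM2r ?powR_ge0 //; have := smooth_ge0 sg Dp; lra.
by move=> u; rewrite -mulrA; exact: (IH _ _ (hdg u)).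
Qed.

Lemma smooth_hoelder m K g : smooth m K g -> smooth 0 (2 ^+ m * K) g.
Proof.
elim: m K g => [|m IH] K g sg; first by rewrite expr0 mul1r.
by rewrite exprSr -mulrA; apply: IH; exact: smooth_down.
Qed.

(** Leibniz's rule. Each derivative is a sum of two products, in each of which the undifferentiated
    factor is lowered by one degree at the cost of a factor 2; hence a factor 4 per order. *)
Lemma smoothM m K1 K2 g1 g2 : smooth m K1 g1 -> smooth m K2 g2 ->
  smooth m (4 ^+ m.+1 * (K1 * K2)) (fun p => g1 p * g2 p).
Proof.
have bnd K K' f g : bounded_on K f -> bounded_on K' g -> forall c, 1 <= c ->
    bounded_on (c * (K * K')) (fun p => f p * g p).
  move=> bf bg c c1 p Dp; rewrite normrM.
  have h : `|f p| * `|g p| <= K * K' by rewrite ler_pM ?bf ?bg.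
  apply: (le_trans h); rewrite ler_peMl //; apply: le_trans h; exact: mulr_ge0.
elim: m K1 K2 g1 g2 => [|m IH] K1 K2 g1 g2 s1 s2.
  have [b1 h1] := s1; have [b2 h2] := s2.
  split; first by apply: bnd => //; rewrite expr1; lra.
  move=> p q Dp Dq pq.
  have -> : g1 q * g2 q - g1 p * g2 p = (g1 q - g1 p) * g2 q + g1 p * (g2 q - g2 p) by ring.
  apply: le_trans (ler_normD _ _) _; rewrite !normrM.
  have e0 : 0 <= `|q - p| `^ eps by exact: powR_ge0.
  have H1 : `|g1 q - g1 p| * `|g2 q| <= K1 * `|q - p| `^ eps * K2.
    by rewrite ler_pM ?h1 ?b2.
  have H2 : `|g1 p| * `|g2 q - g2 p| <= K1 * (K2 * `|q - p| `^ eps).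
    by rewrite ler_pM ?h2 ?b1.
  have K1K2 : 0 <= K1 * K2 * `|q - p| `^ eps.
    by rewrite !mulr_ge0 // ?(smooth_ge0 s1 Dp) ?(smooth_ge0 s2 Dp).
  rewrite expr1; lra.
have b1 := smooth_bounded s1; have b2 := smooth_bounded s2.
have [_ [d1 [[l1 h1] t1]]] := s1; have [_ [d2 [[l2 h2] t2]]] := s2.
have c4 : 4 <= 4 ^+ m.+2 :> R by rewrite exprS ler_peMr // exprn_ege1 // ler1n.
split; first by apply: bnd => //; lra.
exists (fun p u => g1 p * d2 p u + g2 p * d1 p u); split.
  split; first by move=> p Dp a u v; rewrite l1 // l2 //; ring.
  move=> p q Dp Dq pq.
  have K10 := smooth_ge0 s1 Dp; have K20 := smooth_ge0 s2 Dp.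
  have [|q2 q3 q4 q6 q5] := @powR_small `|q - p|; first by rewrite normr_ge0.
  (* The cross term [d1 p (q - p) * (g2 q - g2 p)] is quadratic in the increment, and r^2 <= r^(1 +
     eps). *)
  have -> : g1 q * g2 q - g1 p * g2 p - (g1 p * d2 p (q - p) + g2 p * d1 p (q - p)) =
    (g1 q - g1 p - d1 p (q - p)) * g2 q + d1 p (q - p) * (g2 q - g2 p) +
    g1 p * (g2 q - g2 p - d2 p (q - p)) by ring.
  do 2 (apply: le_trans (ler_normD _ _) _; rewrite -?lerBrDr); rewrite !normrM.
  have H1 : `|g1 q - g1 p - d1 p (q - p)| * `|g2 q| <= K1 * `|q - p| `^ (1 + eps) * K2.
    by rewrite ler_pM ?h1 ?b2.
  have H2 : `|d1 p (q - p)| * `|g2 q - g2 p| <= K1 * `|q - p| * (2 * K2 * `|q - p|).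
    rewrite ler_pM ?(smooth_lipschitz s2) //.
    exact: (smooth_bounded (t1 (q - p)) Dp).
  have H3 : `|g1 p| * `|g2 q - g2 p - d2 p (q - p)| <= K1 * (K2 * `|q - p| `^ (1 + eps)).
    by rewrite ler_pM ?h2 ?b1.
  have K12 : 0 <= K1 * K2 by rewrite mulr_ge0.
  have H4 := ler_wpM2l K12 q6.
  have H5 : 4 * (K1 * K2 * `|q - p| `^ (1 + eps)) <= 4 ^+ m.+2 * (K1 * K2 * `|q - p| `^ (1 + eps)).
    by rewrite ler_wpM2r // mulr_ge0.
  lra.
move=> u.
have e1 := IH _ _ _ _ (smooth_down s1) (t2 u).
have e2 := IH _ _ _ _ (smooth_down s2) (t1 u).
have := smoothD e1 e2.
have -> : 4 ^+ m.+1 * (2 * K1 * (K2 * `|u|)) + 4 ^+ m.+1 * (2 * K2 * (K1 * `|u|)) =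
  4 ^+ m.+2 * (K1 * K2) * `|u| :> R by rewrite [in RHS]exprS; ring.
exact.
Qed.

Lemma smooth_diff_lipschitz m K g dg p q : smooth_diff m K g dg ->
  D p -> D q -> `|q - p| <= 1 -> `|g q - g p| <= 2 * K * `|q - p|.
Proof.
move=> [[ldg hg] hdg] Dp Dq pq.
have K0 : 0 <= K * `|q - p| := smooth_ge0 (hdg (q - p)) Dp.
have h1 := hg _ _ Dp Dq pq.
have h2 : `|dg p (q - p)| <= K * `|q - p| := smooth_bounded (hdg (q - p)) Dp.
have [|h3 h5 h6 _ E] := @powR_small `|q - p|; first by rewrite normr_ge0.
have h4 : K * `|q - p| `^ (1 + eps) <= K * `|q - p| by rewrite E mulrA ler_piMr.
have := ler_normD (g q - g p - dg p (q - p)) (dg p (q - p)); rewrite subrK.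
by move/le_trans; apply; lra.
Qed.

End Class.
End Smooth.

(** * Composition of jets with smooth maps *)

Section Composition.
Variables (R : realType) (eps : R).
Hypotheses (eps_gt0 : 0 < eps) (eps_le1 : eps <= 1).

Lemma row_norm_le (d : nat) (x : 'rV[R]_d) (c : R) : 0 <= c ->
  (forall l, `|x 0 l| <= c) -> `|x| <= c.
Proof.
move=> c0 H; rewrite [`|x|]mx_normrE; apply: bigmax_le => // -[i j] _ /=.
by rewrite (ord1 i).
Qed.

Lemma row_coord_le (d : nat) (x : 'rV[R]_d) l : `|x 0 l| <= `|x|.
Proof.
rewrite [leRHS]mx_normrE.
by apply: (@le_bigmax _ _ _ _ (fun i : 'I_1 * 'I_d => `|x i.1 i.2|) (0, l)).
Qed.

Lemma smooth_downs (V : normedModType R) (D : set V) m k K g :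
  (k <= m)%N -> smooth eps D m K g -> smooth eps D k (2 ^+ (m - k) * K) g.
Proof.
move=> km; rewrite -{1}(subnK km); elim: (m - k)%N K g => [|i IH] K g sg.
  by rewrite expr0 mul1r.
by rewrite exprSr -mulrA; apply: IH; exact: smooth_down.
Qed.

Section Jets.
Variable d : nat.

(* [h s] stands for the [size s]-th derivative of one coordinate of a Lip map
   on the basis vectors listed in [s]. *)
Definition jet_on (n : nat) (K : R) (X : set 'rV[R]_d) (h : seq 'I_d -> 'rV[R]_d -> R) :=
  [/\ forall s x, (size s <= n)%N -> X x -> `|h s x| <= K,
      forall s x y, (size s < n)%N -> X x -> X y ->
        `|h s x - h s y - \sum_j (x - y) 0 j * h (rcons s j) y|
          <= K * `|x - y| `^ (1 + eps)
    & forall s x y, size s = n -> X x -> X y ->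
        `|h s x - h s y| <= K * `|x - y| `^ eps].

Variables (V : normedModType R) (D : set V).

Lemma jet_taylor_step n K X h (G : V -> 'rV[R]_d) L s p q :
  0 <= K -> 0 <= L -> jet_on n K X h -> (forall p, D p -> X (G p)) ->
  `|G q - G p| <= L * `|q - p| -> (size s < n)%N -> D p -> D q ->
  `|h s (G q) - h s (G p) - \sum_j (G q - G p) 0 j * h (rcons s j) (G p)|
    <= K * L `^ (1 + eps) * `|q - p| `^ (1 + eps).
Proof.
move=> K0 L0 [_ hb _] GX GL sn Dp Dq.
apply: le_trans (hb _ _ _ sn (GX _ Dq) (GX _ Dp)) _.
rewrite -mulrA ler_wpM2l // -powRM //.
by rewrite ler_powR2 // addr_ge0 // ltW.
Qed.

(** Only a Lipschitz bound on [G] enters, so this applies to the flow before any derivative of it is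
    known and starts the bootstrap. *)
Lemma smooth0_comp n K L X h (G : V -> 'rV[R]_d) s :
  0 <= K -> 0 <= L -> jet_on n K X h -> (forall p, D p -> X (G p)) ->
  (forall p q, D p -> D q -> `|q - p| <= 1 -> `|G q - G p| <= L * `|q - p|) ->
  (size s <= n)%N ->
  smooth eps D 0 (K + d%:R * (K * L) + K * L `^ (1 + eps) + K * L `^ eps)
    (fun p => h s (G p)).
Proof.
move=> K0 L0 jh GX GL sn; have [ha _ hc] := jh.
have P1 : 0 <= K * L `^ (1 + eps) by rewrite mulr_ge0 // powR_ge0.
have P2 : 0 <= K * L `^ eps by rewrite mulr_ge0 // powR_ge0.
have P3 : 0 <= d%:R * (K * L) by rewrite !mulr_ge0.
split.
  move=> p Dp; apply: le_trans (ha _ _ sn (GX _ Dp)) _; lra.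
move=> p q Dp Dq pq.
have [|q2 q3 q4 q6 q5] := @powR_small _ _ eps_gt0 eps_le1 `|q - p|; first by rewrite normr_ge0.
have e0 := powR_ge0 `|q - p| eps.
move: sn; rewrite leq_eqVlt => /orP[/eqP sn|sn].
  apply: le_trans (hc _ _ _ sn (GX _ Dq) (GX _ Dp)) _.
  apply: (@le_trans _ _ (K * L `^ eps * `|q - p| `^ eps)).
    by rewrite -mulrA ler_wpM2l // -powRM //; apply: ler_powR2 => //; [exact: ltW|exact: GL].
  rewrite ler_wpM2r //; lra.
have h1 := jet_taylor_step K0 L0 jh GX (GL _ _ Dp Dq pq) sn Dp Dq.
have h2 : `|\sum_j (G q - G p) 0 j * h (rcons s j) (G p)| <= d%:R * (K * L) * `|q - p|.
  apply: le_trans (ler_norm_sum _ _ _) _.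
  rewrite -mulrA mulr_natl -[X in _ *+ X]card_ord -sumr_const; apply: ler_sum => j _.
  rewrite normrM mulrC -mulrA ler_pM //.
    by apply: ha; rewrite ?size_rcons //; exact: GX.
  by apply: le_trans (row_coord_le _ _) _; exact: GL.
have h3 := ler_wpM2l P1 (le_trans q2 q3).
have h4 := ler_wpM2l P3 q3.
have := ler_normD (h s (G q) - h s (G p) - \sum_j (G q - G p) 0 j * h (rcons s j) (G p))
  (\sum_j (G q - G p) 0 j * h (rcons s j) (G p)).
rewrite subrK => /le_trans; apply.
have := mulr_ge0 K0 e0; have := mulr_ge0 P2 e0; lra.
Qed.

Lemma smooth_diff_row_lipschitz m Kg (G : V -> 'rV[R]_d) dG p q : 0 <= Kg ->
  (forall l, smooth_diff eps D m Kg (fun p => G p 0 l) (dG l)) ->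
  D p -> D q -> `|q - p| <= 1 -> `|G q - G p| <= 2 * Kg * `|q - p|.
Proof.
move=> K0 sG Dp Dq pq; apply: row_norm_le => [|l]; first by rewrite !mulr_ge0.
by rewrite !mxE; exact: (smooth_diff_lipschitz eps_gt0 eps_le1 (sG l)).
Qed.

End Jets.

(** The chain rule, by induction on [k]: the derivative of [h s] along [G] is the sum over j of
    [dG j] times [h (rcons s j)] along [G], where the first factor is of class m and the second is
    covered by the induction hypothesis. The case k = m + 1 is the gain of one degree over [dG]. *)
Lemma smooth_comp (d : nat) (V : normedModType R) n m k (K Kg : R) :
  0 <= K -> 0 <= Kg -> (k <= m.+1)%N ->
  exists2 K' : R, 0 <= K' &
  forall (D : set V) X h (G : V -> 'rV[R]_d) dG s,
    jet_on n K X h -> (forall p, D p -> X (G p)) ->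
    (forall l, smooth_diff eps D m Kg (fun p => G p 0 l) (dG l)) ->
    (size s + k <= n)%N -> smooth eps D k K' (fun p => h s (G p)).
Proof.
move=> K0 Kg0; have L0 : 0 <= 2 * Kg by rewrite mulr_ge0.
elim: k => [|k IH] km.
  exists (K + d%:R * (K * (2 * Kg)) + K * (2 * Kg) `^ (1 + eps) + K * (2 * Kg) `^ eps).
    by rewrite !(addr_ge0, mulr_ge0) // powR_ge0.
  move=> D X h G dG s jh GX sG; rewrite addn0 => sn.
  apply: (smooth0_comp K0 L0 jh) => // p q Dp Dq pq.
  exact: (smooth_diff_row_lipschitz Kg0 sG).
have [K1 K10 {}IH] := IH (ltnW km).
set c1 := K * (2 * Kg) `^ (1 + eps).
(* [2 ^+ (m - k)] is the price of lowering [dG] from class m to class k, in which the product is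
   formed; [4 ^+ k.+1] is that of the product. *)
set c2 := 4 ^+ k.+1 * (2 ^+ (m - k) * Kg * K1).
have c10 : 0 <= c1 by rewrite mulr_ge0 // powR_ge0.
have c20 : 0 <= c2 by rewrite !mulr_ge0 ?exprn_ge0.
have P1 : 0 <= d%:R * (Kg * K) by rewrite !mulr_ge0.
have P2 : 0 <= d%:R * c2 by rewrite mulr_ge0.
exists (K + c1 + d%:R * (Kg * K) + d%:R * c2); first by lra.
move=> D X h G dG s jh GX sG skn; have [ha _ _] := jh.
have sn : (size s < n)%N by rewrite (leq_trans _ skn) // addnS ltnS leq_addr.
split.
  move=> p Dp; apply: le_trans (ha _ _ (ltnW sn) (GX _ Dp)) _; lra.
exists (fun p u => \sum_j dG j p u * h (rcons s j) (G p)); split.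
  split.
    move=> p Dp a u v; rewrite mulr_sumr -big_split /=; apply: eq_bigr => j _.
    by have [[-> // _] _] := sG j; ring.
  move=> p q Dp Dq pq.
  have GL := smooth_diff_row_lipschitz Kg0 sG Dp Dq pq.
  have h1 := jet_taylor_step K0 L0 jh GX GL sn Dp Dq.
  have r0 := powR_ge0 `|q - p| (1 + eps).
  have h2 : `|\sum_j ((G q - G p) 0 j - dG j p (q - p)) * h (rcons s j) (G p)| <=
      d%:R * (Kg * K) * `|q - p| `^ (1 + eps).
    apply: le_trans (ler_norm_sum _ _ _) _.
    rewrite -mulrA mulr_natl -[X in _ *+ X]card_ord -sumr_const; apply: ler_sum => j _.
    rewrite normrM mulrAC ler_pM //.
      by have [[_ hg] _] := sG j; rewrite !mxE; exact: hg.
    by apply: ha; rewrite ?size_rcons //; exact: GX.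
  have -> : h s (G q) - h s (G p) - \sum_j dG j p (q - p) * h (rcons s j) (G p) =
     (h s (G q) - h s (G p) - \sum_j (G q - G p) 0 j * h (rcons s j) (G p)) +
     \sum_j ((G q - G p) 0 j - dG j p (q - p)) * h (rcons s j) (G p).
    under [X in _ = _ + X]eq_bigr do rewrite mulrBl.
    by rewrite sumrB; ring.
  apply: le_trans (ler_normD _ _) _.
  have := mulr_ge0 P2 r0; have := mulr_ge0 K0 r0.
  by rewrite -/c1 in h1; lra.
move=> u.
have H j : smooth eps D k (c2 * `|u|) (fun p => dG j p u * h (rcons s j) (G p)).
  have s1 : smooth eps D k (2 ^+ (m - k) * (Kg * `|u|)) (dG j ^~ u).
    by apply: smooth_downs => //; have [_] := sG j; exact.
  have s2 : smooth eps D k K1 (fun p => h (rcons s j) (G p)).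
    by apply: (IH _ _ _ _ _ (rcons s j) jh GX sG); rewrite size_rcons addSnnS.
  have := smoothM eps_gt0 eps_le1 s1 s2.
  by have -> : 4 ^+ k.+1 * (2 ^+ (m - k) * (Kg * `|u|) * K1) = c2 * `|u| by rewrite /c2; ring.
apply: smooth_mono (smooth_sum H).
rewrite sumr_const card_ord -[leLHS]mulr_natl [leLHS]mulrA ler_wpM2r //; lra.
Qed.

End Composition.

(** * The variational equation and spatial derivatives *)

Section SpatialDerivative.
Variables (R : realType) (eps : R).
Hypotheses (eps_gt0 : 0 < eps) (eps_le1 : eps <= 1).
Variables (T : R) (T_gt0 : 0 < T) (Y : normedModType R) (L : finType).

Local Notation I := `]- T, T[.
Local Notation P := (R * Y)%type.

Lemma norm_sum_coef (a x : L -> R) K : (forall j, `|a j| <= K) ->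
  `|\sum_j a j * x j| <= K * \sum_j `|x j|.
Proof.
move=> aK; apply: le_trans (ler_norm_sum _ _ _) _.
by rewrite mulr_sumr; apply: ler_sum => j _; rewrite normrM ler_wpM2r.
Qed.

(** The last quantity equals K |w|^(1 + eps) h^eps. It is the error with which a difference quotient
    of step h solves the variational equation. *)
Lemma small_step (U : set Y) y w (K eta : R) : open U -> U y -> 0 <= K -> 0 < eta ->
  exists h, [/\ 0 < h, U (y + h *: w), `|h *: w| <= 1 &
    h^-1 * (K * `|h *: w| `^ (1 + eps)) <= eta].
Proof.
move=> oU Uy K0 eta0.
have cw : (fun h : R => h *: w) @ (0 : R)^'+ --> (0 : Y).
  rewrite -[X in _ --> X](scale0r w).
  by apply: cvgZl; apply: cvg_at_right_filter; exact: cvg_id.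
have ev1 : \forall h \near (0 : R)^'+, U (y + h *: w).
  have : (fun h : R => y + h *: w) @ (0 : R)^'+ --> y.
    by rewrite -[X in _ --> X]addr0; apply: cvgD => //; exact: cvg_cst.
  by apply; exact: open_nbhs_nbhs.
have ev2 : \forall h \near (0 : R)^'+, `|h *: w| <= 1.
  by move/cvgr0_norm_le : cw => /(_ 1 ltr01).
set c := K * `|w| `^ (1 + eps).
have c0 : 0 <= c by rewrite mulr_ge0 // powR_ge0.
have [de de0 hde] := powR_near0 c0 eps_gt0 eta0.
near (0 : R)^'+ => h.
have h0 : 0 < h by near: h; exact: nbhs_right_gt.
exists h; split => //; [by near: h | by near: h |].
have -> : h^-1 * (K * `|h *: w| `^ (1 + eps)) = c * h `^ eps.
  rewrite normrZ (gtr0_norm h0) powRM ?(ltW h0) // (powR_onePlus (ltW h0)) //.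
  by rewrite /c; field; rewrite gt_eqF.
apply: hde; first exact: ltW.
by near: h; exact: nbhs_right_le.
Unshelve. all: by end_near. Qed.

Section Derivative.
Variable U : set Y.
Hypothesis openU : open U.
Variables (W Phi : L -> P -> R) (A : L -> L -> P -> R) (B : L -> P -> Y -> R).
Variables (lam : L -> Y -> R) (K K1 K2 : R).
Hypotheses (K_ge0 : 0 <= K) (K1_ge0 : 0 <= K1) (K2_ge0 : 0 <= K2).
Hypothesis W_ode : forall t y l, t \in I -> U y ->
  is_derive t 1 (fun s => W l (s, y)) (Phi l (t, y)).
Hypothesis A_le : forall l j t y, t \in I -> U y -> `|A l j (t, y)| <= K.
Hypothesis B_lin : forall l t y, t \in I -> U y -> real_linear (B l (t, y)).
Hypothesis B_le : forall l t y w, t \in I -> U y -> `|B l (t, y) w| <= K1 * `|w|.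
Hypothesis Phi_expand : forall l t y y', t \in I -> U y -> U y' -> `|y' - y| <= 1 ->
  `|Phi l (t, y') - Phi l (t, y) - \sum_j A l j (t, y) * (W j (t, y') - W j (t, y))
     - B l (t, y) (y' - y)| <= K2 * `|y' - y| `^ (1 + eps).
Hypothesis W_init : forall l y y', U y -> U y' -> W l (0, y') - W l (0, y) = lam l (y' - y).
Hypothesis lam_lin : forall l, real_linear (lam l).
Hypothesis lam_le : forall l w, `|lam l w| <= K1 * `|w|.
Hypothesis A_cont : forall l j y, U y -> {in I, continuous (fun s => A l j (s, y))}.
Hypothesis B_cont : forall l y w, U y -> {in I, continuous (fun s => B l (s, y) w)}.

Let C := gronwall_const T L K.

(* The difference quotients of [W] in the direction [w] are approximate
   solutions of the variational equation. *)
Lemma variational_solution y w : U y ->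
  exists k : L -> R -> R, (forall i, k i 0 = lam i w) /\
    forall s i, s \in I ->
      is_derive s 1 (k i) (\sum_j A i j (s, y) * k j s + B i (s, y) w).
Proof.
move=> Uy.
apply: (@linear_ode_exists R T L (fun i j s => A i j (s, y)) (fun i s => B i (s, y) w)
  (fun i => lam i w) K) => //.
- by move=> i j s sI; exact: A_le.
- by move=> i j; exact: A_cont.
- by move=> i; exact: B_cont.
move=> eta eta0; have [h [h0 Uh wh1 hK]] := small_step w openU Uy K2_ge0 eta0.
have hn0 : h != 0 by rewrite gt_eqF.
have yy : y + h *: w - y = h *: w by rewrite addrC addKr.
exists (fun i s => h^-1 * (W i (s, y + h *: w) - W i (s, y))).
exists (fun i s => h^-1 * (Phi i (s, y + h *: w) - Phi i (s, y))).
split.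
- move=> s i sI.
  have hd := is_deriveB (W_ode i sI Uh) (W_ode i sI Uy).
  exact: (is_deriveZ h^-1 hd).
- move=> s i sI; apply: le_trans hK.
  have := Phi_expand i sI Uy Uh; rewrite yy => /(_ wh1) hP.
  have -> : h^-1 * (Phi i (s, y + h *: w) - Phi i (s, y)) -
     (\sum_j A i j (s, y) * (h^-1 * (W j (s, y + h *: w) - W j (s, y))) + B i (s, y) w) =
    h^-1 * (Phi i (s, y + h *: w) - Phi i (s, y) -
      \sum_j A i j (s, y) * (W j (s, y + h *: w) - W j (s, y)) - B i (s, y) (h *: w)).
    rewrite (real_linearZ _ _ (B_lin i sI Uy)).
    under eq_bigr do rewrite mulrCA.
    by rewrite -mulr_sumr; field.
  by rewrite normrM gtr0_norm ?invr_gt0 // ler_pM2l ?invr_gt0.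
- by move=> i; rewrite W_init // yy real_linearZ // mulrA mulVf // mul1r.
Qed.

(** Every clause is a Gronwall estimate for a solution of the variational equation. Linearity in [w]
    has zero data and zero forcing; the bound has initial value and forcing at most [K1 * |w|] each,
    hence the factor 2; the error of the expansion vanishes at time 0 and has forcing
    [K2 * |y' - y|^(1 + eps)]. It serves for the flow, where [B] is 0 and [lam] gives the
    coordinates, and for solutions of linear equations, where [lam] is 0 and [B] carries the
    derivatives of the coefficients. *)
Lemma spatial_derivative : exists Kd : L -> P -> Y -> R,
  [/\ forall l t y, t \in I -> U y -> real_linear (Kd l (t, y)),
      forall l t y w, t \in I -> U y -> `|Kd l (t, y) w| <= C * (2 * K1) * `|w|,
      forall l t y w, t \in I -> U y -> is_derive t 1 (fun s => Kd l (s, y) w)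
        (\sum_j A l j (t, y) * Kd j (t, y) w + B l (t, y) w),
      forall l y w, U y -> Kd l (0, y) w = lam l w
    & forall l t y y', t \in I -> U y -> U y' -> `|y' - y| <= 1 ->
        `|W l (t, y') - W l (t, y) - Kd l (t, y) (y' - y)| <=
          C * K2 * `|y' - y| `^ (1 + eps)].
Proof.
(* The solutions for all base points and directions are chosen at once; outside [U] the value 0 is a
   mere default. *)
have : forall yw : Y * Y, exists k : L -> R -> R, U yw.1 ->
    (forall i, k i 0 = lam i yw.2) /\
    forall s i, s \in I ->
      is_derive s 1 (k i) (\sum_j A i j (s, yw.1) * k j s + B i (s, yw.1) yw.2).
  move=> [y w]; have [Uy|nUy] := pselect (U y).
    by have [k hk] := variational_solution w Uy; exists k.
  by exists (fun _ _ => 0).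
move=> /choice[k hk].
have k0 l y w : U y -> k (y, w) l 0 = lam l w by move=> Uy; case: (hk (y, w) Uy).
have kd l t y w : t \in I -> U y -> is_derive t 1 (k (y, w) l)
        (\sum_j A l j (t, y) * k (y, w) j t + B l (t, y) w).
  by move=> tI Uy; case: (hk (y, w) Uy) => _; exact.
exists (fun l p w => k (p.2, w) l p.1); split => /=.
- move=> l t y tI Uy a u v.
  apply/eqP; rewrite -subr_eq0 -normr_le0.
  rewrite -[X in _ <= X](mulr0 C) -[X in C * X](addr0 0).
  apply: (@gronwall R T L (fun l t => k (y, a *: u + v) l t - (a * k (y, u) l t + k (y, v) l t))
    (fun l t => (\sum_j A l j (t, y) * k (y, a *: u + v) j t + B l (t, y) (a *: u + v)) -
      (a * (\sum_j A l j (t, y) * k (y, u) j t + B l (t, y) u) +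
      (\sum_j A l j (t, y) * k (y, v) j t + B l (t, y) v)))) => //.
  + move=> s sI i; apply: is_deriveB; first exact: kd.
    by apply: is_deriveD; [apply: (is_deriveZ a); exact: kd|exact: kd].
  + move=> s sI i; rewrite addr0 (B_lin i sI Uy).
    apply: le_trans (norm_sum_coef _ (fun j => A_le i j sI Uy)).
    rewrite le_eqVlt; apply/orP; left; apply/eqP; congr (`|_|).
    under [RHS]eq_bigr do rewrite mulrBr mulrDr mulrCA.
    by rewrite sumrB big_split /= -mulr_sumr; ring.
  + by move=> i; rewrite !k0 // lam_lin subrr normr0.
- move=> l t y w tI Uy.
  have -> : C * (2 * K1) * `|w| = C * (K1 * `|w| + K1 * `|w|) by ring.
  have Kw : 0 <= K1 * `|w| by rewrite mulr_ge0.
  apply: (@gronwall R T L (k (y, w))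
    (fun i s => \sum_j A i j (s, y) * k (y, w) j s + B i (s, y) w)) => //.
  + by move=> s sI i; exact: kd.
  + move=> s sI i; apply: le_trans (ler_normD _ _) _; rewrite lerD ?B_le //.
    exact: (norm_sum_coef _ (fun j => A_le i j sI Uy)).
  + by move=> i; rewrite k0.
- by move=> l t y w tI Uy; exact: kd.
- by move=> l y w Uy; exact: k0.
move=> l t y y' tI Uy Uy' yy.
rewrite -mulrA -[X in C * X]add0r.
apply: (@gronwall R T L (fun l t => W l (t, y') - W l (t, y) - k (y, y' - y) l t)
    (fun l t => Phi l (t, y') - Phi l (t, y) -
      (\sum_j A l j (t, y) * k (y, y' - y) j t + B l (t, y) (y' - y)))) => //.
- by rewrite mulr_ge0 // powR_ge0.
- move=> s sI i; apply: is_deriveB; last exact: kd.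
  by apply: is_deriveB; exact: W_ode.
- move=> s sI i.
  have -> : Phi i (s, y') - Phi i (s, y) -
      (\sum_j A i j (s, y) * k (y, y' - y) j s + B i (s, y) (y' - y)) =
    \sum_j A i j (s, y) * (W j (s, y') - W j (s, y) - k (y, y' - y) j s) +
    (Phi i (s, y') - Phi i (s, y) - \sum_j A i j (s, y) * (W j (s, y') - W j (s, y))
     - B i (s, y) (y' - y)).
    under [X in _ = X + _]eq_bigr do rewrite mulrBr.
    by rewrite sumrB; ring.
  apply: le_trans (ler_normD _ _) _; rewrite lerD ?Phi_expand //.
  exact: (norm_sum_coef _ (fun j => A_le i j sI Uy)).
- by move=> i; rewrite k0 // W_init // subrr normr0.
Qed.

End Derivative.
End SpatialDerivative.

(** * From separate to joint expansions in time and space *)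

Section Cylinder.
Variables (R : realType) (eps : R).
Hypotheses (eps_gt0 : 0 < eps) (eps_le1 : eps <= 1).
Variables (T : R) (Y : normedModType R).

Local Notation I := `]- T, T[.
Local Notation P := (R * Y)%type.

Definition cylinder (U : set Y) : set P := `]- T, T[%classic `*` U.

Lemma norm_fst_le (p : P) : `|p.1| <= `|p|.
Proof. by rewrite [leRHS]prod_normE le_max lexx. Qed.

Lemma norm_snd_le (p : P) : `|p.2| <= `|p|.
Proof. by rewrite [leRHS]prod_normE le_max lexx orbT. Qed.

Lemma norm_pair_fst (t t' : R) (y : Y) : `|((t', y) : P) - (t, y)| = `|t' - t|.
Proof. by rewrite [LHS]prod_normE /= subrr normr0 max_l. Qed.

Lemma norm_pair_snd (t : R) (y y' : Y) : `|((t, y') : P) - (t, y)| = `|y' - y|.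
Proof. by rewrite [LHS]prod_normE /= subrr normr0 max_r. Qed.

Lemma norm_0pair (w : Y) : `|(0, w) : P| = `|w|.
Proof. by rewrite [LHS]prod_normE /= normr0 max_r. Qed.

Lemma smooth_diff_mono (V : normedModType R) (D : set V) m K K' g dg :
  K <= K' -> smooth_diff eps D m K g dg -> smooth_diff eps D m K' g dg.
Proof.
move=> KK [[ldg hg] hdg]; split; first split => //.
  move=> p q Dp Dq pq; apply: le_trans (hg _ _ Dp Dq pq) _.
  by rewrite ler_wpM2r // powR_ge0.
by move=> u; apply: smooth_mono (hdg u); rewrite ler_wpM2r.
Qed.

Lemma between_itv (t u s : R) : t \in I -> u \in I ->
  Num.min t u <= s <= Num.max t u -> s \in I.
Proof.
rewrite !in_itv /= => /andP[? ?] /andP[? ?].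
by have /orP[tu|tu] := le_total t u; [rewrite min_l // max_r //|rewrite min_r // max_l //];
  move=> /andP[? ?]; apply/andP; split; lra.
Qed.

Lemma smooth_continuous_fst m K (U : set Y) (g : P -> R) y :
  smooth eps (cylinder U) m K g -> U y -> {in I, continuous (fun s => g (s, y))}.
Proof.
move=> /(smooth_hoelder eps_gt0 eps_le1) sg Uy t tI.
have K0 : 0 <= 2 ^+ m * K := smooth_ge0 sg (conj tI Uy : cylinder U (t, y)).
have {sg} [_ hg] := sg; set M := 2 ^+ m * K in K0 hg.
apply/cvgrPdist_le => eta eta0.
have [de de0 hde] := powR_near0 K0 eps_gt0 eta0.
near=> s.
have sI : s \in I by near: s; exact: near_in_itvoo.
have ts1 : `|t - s| <= 1 by near: s; exact: cvgr_dist_le.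
have ts2 : `|t - s| <= de by near: s; exact: cvgr_dist_le.
have := hg (s, y) (t, y) (conj sI Uy) (conj tI Uy); rewrite norm_pair_fst => /(_ ts1).
by move/le_trans; apply; exact: hde.
Unshelve. all: by end_near. Qed.

Lemma joint_expansion (U : set Y) (W Phi : P -> R) (Kd : P -> Y -> R) m K1 K2 K3 :
  0 <= K1 -> 0 <= K2 -> 0 <= K3 ->
  (forall t y, t \in I -> U y -> is_derive t 1 (fun s => W (s, y)) (Phi (t, y))) ->
  smooth eps (cylinder U) m K1 Phi ->
  (forall t y, t \in I -> U y -> real_linear (Kd (t, y))) ->
  (forall w, smooth eps (cylinder U) m (K2 * `|w|) (Kd ^~ w)) ->
  (forall t y y', t \in I -> U y -> U y' -> `|y' - y| <= 1 ->
     `|W (t, y') - W (t, y) - Kd (t, y) (y' - y)| <= K3 * `|y' - y| `^ (1 + eps)) ->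
  smooth_diff eps (cylinder U) m (2 ^+ m * K1 + K1 + K2 + K3) W
    (fun p u => u.1 * Phi p + Kd p u.2).
Proof.
move=> K10 K20 K30 dW sPhi lKd sKd eW.
have P1 : 0 <= 2 ^+ m * K1 by rewrite mulr_ge0 // exprn_ge0.
split; first split.
- move=> [t y] [tI Uy] a u v.
  have -> : (a *: u + v).1 = a * u.1 + v.1 by [].
  by rewrite [(a *: u + v).2]/(a *: u.2 + v.2) (lKd t y tI Uy); ring.
- move=> [t y] [t' y'] [/= tI Uy] [/= t'I Uy'] pq.
  have t1 : `|t' - t| <= `|(t', y') - (t, y)| := norm_fst_le ((t', y') - (t, y)).
  have y1 : `|y' - y| <= `|(t', y') - (t, y)| := norm_snd_le ((t', y') - (t, y)).
  set r := `|(t', y') - (t, y)| in pq t1 y1 *.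
  have r0 : 0 <= r by exact: normr_ge0.
  have hy := eW _ _ _ tI Uy Uy' (le_trans y1 pq).
  have hy' : K3 * `|y' - y| `^ (1 + eps) <= K3 * r `^ (1 + eps).
    by rewrite ler_wpM2l // ler_powR2 // addr_ge0 // ltW.
  have [|c ctt Ec] := @MVT_any R (fun s => W (s, y')) (fun s => Phi (s, y')) t t'.
    by move=> x xtt; apply: dW => //; exact: between_itv xtt.
  have cI : c \in I := between_itv tI t'I ctt.
  have cr : `|(c, y') - (t, y)| <= r.
    have -> : `|(c, y') - (t, y)| = Num.max `|c - t| `|y' - y| by rewrite [LHS]prod_normE.
    by rewrite ge_max y1 (le_trans (between_dist ctt) t1).
  have [_ hPhi] := smooth_hoelder eps_gt0 eps_le1 sPhi.
  have hP : `|Phi (c, y') - Phi (t, y)| <= 2 ^+ m * K1 * r `^ eps.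
    apply: le_trans (hPhi (t, y) (c, y') _ _ (le_trans cr pq)) _ => //.
    by rewrite ler_wpM2l // ler_powR2 // ltW.
  have -> : W (t', y') - W (t, y) - ((t' - t) * Phi (t, y) + Kd (t, y) (y' - y)) =
    (Phi (c, y') - Phi (t, y)) * (t' - t) +
    (W (t, y') - W (t, y) - Kd (t, y) (y' - y)).
    have : W (t', y') = W (t, y') + Phi (c, y') * (t' - t) by rewrite -Ec; ring.
    by move=> ->; ring.
  apply: le_trans (ler_normD _ _) _.
  have h1 : `|(Phi (c, y') - Phi (t, y)) * (t' - t)| <= 2 ^+ m * K1 * r `^ (1 + eps).
    by rewrite normrM powR_onePlus // [r * _]mulrC mulrA ler_pM.
  have := powR_ge0 r (1 + eps) => rr.
  have := mulr_ge0 K10 rr; have := mulr_ge0 K20 rr; lra.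
move=> [a w] /=.
have sa : smooth eps (cylinder U) m (`|a| * K1) (fun p => a * Phi p) by exact: smooth_scale.
apply: smooth_mono (smoothD sa (sKd w)).
have ha : `|a| <= `|(a, w)| := norm_fst_le (a, w).
have hw : `|w| <= `|(a, w)| := norm_snd_le (a, w).
have := ler_wpM2r K10 ha; have := ler_wpM2l K20 hw.
have rr := normr_ge0 ((a, w) : P).
have := mulr_ge0 P1 rr; have := mulr_ge0 K30 rr; lra.
Qed.

End Cylinder.

(** * Regularity of linear equations with parameters *)

Section LinearODESmooth.
Variables (R : realType) (eps : R).
Hypotheses (eps_gt0 : 0 < eps) (eps_le1 : eps <= 1).
Variables (T : R) (T_gt0 : 0 < T) (Y : normedModType R) (L : finType).

Local Notation I := `]- T, T[.
Local Notation P := (R * Y)%type.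
Local Notation N := (#|L|%:R : R).

Lemma sum_le_card (x : L -> R) c : (forall l, x l <= c) -> \sum_l x l <= N * c.
Proof. by move=> xc; rewrite mulr_natl -sumr_const; apply: ler_sum => l _. Qed.

Lemma norm_sum_le_card (x : L -> R) c : (forall l, `|x l| <= c) -> `|\sum_l x l| <= N * c.
Proof. by move=> xc; apply: le_trans (ler_norm_sum _ _ _) (sum_le_card xc). Qed.

Lemma smooth_sum_cst (V : normedModType R) (D : set V) m K (g : L -> V -> R) :
  (forall l, smooth eps D m K (g l)) -> smooth eps D m (N * K) (fun p => \sum_l g l p).
Proof. by move=> H; have := smooth_sum H; rewrite sumr_const -[K *+ _]mulr_natl. Qed.

(** The constants obtained for linear equations are not proportional to their data. Treating
    directions in the unit ball and rescaling by linearity restores the dependence on |w| that the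
    class demands. *)
Lemma smooth_direction (V W : normedModType R) (D : set V) m K (f : V -> W -> R) w :
  (forall p, D p -> real_linear (f p)) ->
  (forall v, `|v| <= 1 -> smooth eps D m K (f ^~ v)) ->
  smooth eps D m (K * `|w|) (f ^~ w).
Proof.
move=> lf sf; have [->|w0] := eqVneq w 0.
  apply: (@smooth_ext _ _ _ _ _ _ (fun=> 0)).
    by move=> p Dp; rewrite real_linear0 //; exact: lf.
  by rewrite normr0 mulr0 -[X in smooth _ _ _ X](@normr0 _ R); exact: smooth_cst.
have nw : `|w| != 0 by rewrite normr_eq0.
have w1 : `| `|w|^-1 *: w| <= 1 by rewrite normrZ normfV normr_id mulVf.
have := smooth_scale `|w| (sf _ w1); rewrite normr_id mulrC.
apply: smooth_ext => p Dp.
by rewrite -(real_linearZ _ _ (lf p Dp)) scalerA mulfV // scale1r.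
Qed.

Definition linear_ode (U : set Y) (A : L -> L -> P -> R) (B : L -> P -> R)
    (J : L -> P -> R) : Prop :=
  forall t y l, t \in I -> U y ->
    is_derive t 1 (fun s => J l (s, y)) (\sum_j A l j (t, y) * J j (t, y) + B l (t, y)).

Lemma linear_ode_bounded (U : set Y) A B J (K : R) : 0 <= K -> linear_ode U A B J ->
  (forall l j, bounded_on (cylinder T U) K (A l j)) ->
  (forall l, bounded_on (cylinder T U) K (B l)) ->
  (forall l y, U y -> `|J l (0, y)| <= K) ->
  forall l, bounded_on (cylinder T U) (gronwall_const T L K * (K + K)) (J l).
Proof.
move=> K0 dJ bA bB bJ l [t y] [/= tI Uy].
apply: (@gronwall R T L (fun l s => J l (s, y))
  (fun l s => \sum_j A l j (s, y) * J j (s, y) + B l (s, y))) => //.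
- by move=> s sI i; exact: dJ.
- move=> s sI i; apply: le_trans (ler_normD _ _) _; apply: lerD.
    by apply: norm_sum_coef => j; exact: bA.
  exact: bB.
- by move=> i; exact: bJ.
Qed.

(** Time increments are bounded by the mean value inequality, space increments by Gronwall's
    inequality for the difference of two solutions. That difference vanishes at time 0, as the
    initial values do not depend on the point: for the spatial derivative of a flow in a fixed
    direction they are the coordinates of the direction. *)
Lemma linear_ode_hoelder (U : set Y) A B J (K Kb : R) : 0 <= K -> 0 <= Kb ->
  linear_ode U A B J ->
  (forall l j, smooth eps (cylinder T U) 0 K (A l j)) ->
  (forall l, smooth eps (cylinder T U) 0 K (B l)) ->
  (forall l y y', U y -> U y' -> J l (0, y') = J l (0, y)) ->
  (forall l, bounded_on (cylinder T U) Kb (J l)) ->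
  forall l, hoelder_on eps (cylinder T U)
    ((N * (K * Kb) + K) + gronwall_const T L K * (N * (K * Kb) + K)) (J l).
Proof.
move=> K0 Kb0 dJ sA sB J0 bJ l [t y] [t' y'] [/= tI Uy] [/= t'I Uy'] pq.
set M := N * (K * Kb) + K.
have M0 : 0 <= M by rewrite addr_ge0 // !mulr_ge0.
have t1 : `|t' - t| <= `|(t', y') - (t, y)| := norm_fst_le ((t', y') - (t, y)).
have y1 : `|y' - y| <= `|(t', y') - (t, y)| := norm_snd_le ((t', y') - (t, y)).
set r := `|(t', y') - (t, y)| in pq t1 y1 *.
have r0 : 0 <= r by exact: normr_ge0.
have re0 : 0 <= r `^ eps by exact: powR_ge0.
have [|_ rr _ _ _] := @powR_small _ _ eps_gt0 eps_le1 r; first by rewrite r0.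
have h1 : `|J l (t', y') - J l (t, y')| <= M * `|t' - t|.
  apply: (@mean_value_le R (fun s => J l (s, y'))
    (fun s => \sum_j A l j (s, y') * J j (s, y') + B l (s, y'))).
    by move=> s /(between_itv tI t'I) sI; exact: dJ.
  move=> s /(between_itv tI t'I) sI; apply: le_trans (ler_normD _ _) _; apply: lerD.
    apply: norm_sum_le_card => j; rewrite normrM ler_pM //.
      by apply: (smooth_bounded (sA l j)); split.
    by apply: bJ; split.
  by apply: (smooth_bounded (sB l)); split.
have h1' := ler_wpM2l M0 (le_trans t1 rr).
have yle : `|y' - y| <= 1 := le_trans y1 pq.
have hold (g : P -> R) s : smooth eps (cylinder T U) 0 K g -> s \in I ->
    `|g (s, y') - g (s, y)| <= K * r `^ eps.
  move=> [_ hg] sI.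
  apply: le_trans (hg (s, y) (s, y') _ _ _) _; rewrite ?norm_pair_snd //.
  by rewrite ler_wpM2l // ler_powR2 // ltW.
have h2 : `|J l (t, y') - J l (t, y)| <= gronwall_const T L K * (0 + M * r `^ eps).
  apply: (@gronwall R T L (fun l s => J l (s, y') - J l (s, y))
    (fun l s => (\sum_j A l j (s, y') * J j (s, y') + B l (s, y')) -
       (\sum_j A l j (s, y) * J j (s, y) + B l (s, y)))) => //.
  - by rewrite mulr_ge0.
  - by move=> s sI i; apply: is_deriveB; exact: dJ.
  - move=> s sI i.
    have -> : (\sum_j A i j (s, y') * J j (s, y') + B i (s, y')) -
       (\sum_j A i j (s, y) * J j (s, y) + B i (s, y)) =
      \sum_j A i j (s, y) * (J j (s, y') - J j (s, y)) +
      (\sum_j (A i j (s, y') - A i j (s, y)) * J j (s, y') + (B i (s, y') - B i (s, y))).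
      under [X in _ = X + _]eq_bigr do rewrite mulrBr.
      under [X in _ = _ + (X + _)]eq_bigr do rewrite mulrBl.
      by rewrite !sumrB; ring.
    apply: le_trans (ler_normD _ _) _; apply: lerD.
      by apply: norm_sum_coef => j; apply: (smooth_bounded (sA i j)); split.
    apply: le_trans (ler_normD _ _) _; rewrite /M mulrDl; apply: lerD; last exact: hold.
    rewrite -mulrA; apply: norm_sum_le_card => j.
    by rewrite normrM mulrAC ler_pM // ?hold // bJ.
  - by move=> i; rewrite (J0 i y y') // subrr normr0.
have -> : J l (t', y') - J l (t, y) =
  (J l (t', y') - J l (t, y')) + (J l (t, y') - J l (t, y)) by ring.
apply: le_trans (ler_normD _ _) _; rewrite mulrDl lerD //; first exact: le_trans h1'.
by move: h2; rewrite add0r mulrA.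
Qed.

(* The spatial derivatives of [J] solve the linear ODE with the same matrix [A]
   and the inhomogeneity [dA J + dB], which is one degree less smooth. *)
Lemma smooth_linear_ode m (K : R) : 0 <= K -> exists2 K' : R, 0 <= K' &
  forall (U : set Y) A B J, open U -> linear_ode U A B J ->
    (forall l j, smooth eps (cylinder T U) m K (A l j)) ->
    (forall l, smooth eps (cylinder T U) m K (B l)) ->
    (forall l y y', U y -> U y' -> J l (0, y') = J l (0, y)) ->
    (forall l y, U y -> `|J l (0, y)| <= K) ->
    forall l, smooth eps (cylinder T U) m K' (J l).
Proof.
elim: m K => [|m IH] K K0.
  set Kb := gronwall_const T L K * (K + K).
  have C0 : 0 <= gronwall_const T L K := le_trans ler01 (gronwall_const_ge1 T L K).
  have Kb0 : 0 <= Kb by rewrite mulr_ge0 // addr_ge0.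
  set M := N * (K * Kb) + K.
  have M0 : 0 <= M by rewrite addr_ge0 // mulr_ge0 // mulr_ge0.
  set M' := M + gronwall_const T L K * M.
  have M'0 : 0 <= M' by rewrite addr_ge0 // mulr_ge0.
  exists (Kb + M'); first exact: addr_ge0.
  move=> U A B J oU dJ sA sB J0 J0K.
  have bJ : forall l, bounded_on (cylinder T U) Kb (J l).
    by apply: linear_ode_bounded dJ _ _ _ => // *; apply: smooth_bounded; eauto.
  have hJ := linear_ode_hoelder K0 Kb0 dJ sA sB J0 bJ.
  move=> l; split; first by move=> p Dp; apply: le_trans (bJ _ _ Dp) _; rewrite lerDl.
  move=> p q Dp Dq pq; apply: le_trans (hJ l _ _ Dp Dq pq) _.
  by rewrite ler_wpM2r ?powR_ge0 // lerDr.
have K20 : 0 <= 2 * K by rewrite mulr_ge0.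
(* The induction hypothesis serves twice: here for [J], with coefficients lowered by one degree at
   the cost of a factor 2, and below, with [KD], for the spatial derivatives of [J], whose
   inhomogeneity involves [J] and has the bound [K4]. *)
have [KJ KJ0 IHJ] := IH _ K20.
pose K4 := N * (4 ^+ m.+1 * (K * KJ)) + K.
have K40 : 0 <= K4 by rewrite addr_ge0 // !mulr_ge0 // exprn_ge0.
have KK0 : 0 <= 2 * K + K4 by exact: addr_ge0.
have [KD KD0 IHD] := IH _ KK0.
pose K5 := N * (4 ^+ m.+1 * (2 * K * KJ)) + 2 * K.
have K50 : 0 <= K5 by rewrite addr_ge0 // !mulr_ge0 // exprn_ge0.
pose K2 := N * (K * KJ) + N * (K * (2 ^+ m * KJ)) + K.
have K2_0 : 0 <= K2 by rewrite !addr_ge0 // !mulr_ge0 // exprn_ge0.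
pose K1 := N * (K * KJ) + K.
have K10 : 0 <= K1 by rewrite addr_ge0 // !mulr_ge0.
set C := gronwall_const T L K.
have C0 : 0 <= C := le_trans ler01 (gronwall_const_ge1 T L K).
have CK2 : 0 <= C * K2 by exact: mulr_ge0.
have K6_0 : 0 <= 2 ^+ m * K5 by rewrite mulr_ge0 // exprn_ge0.
exists (KJ + (2 ^+ m * K5 + K5 + KD + C * K2)); first by lra.
move=> U A B J oU dJ sA sB J0 J0K.
set D := cylinder T U.
have sJ : forall l, smooth eps D m KJ (J l).
  apply: (IHJ U A B J) => //.
  - by move=> l j; exact: smooth_down.
  - by move=> l; exact: smooth_down.
  - by move=> l y Uy; apply: le_trans (J0K _ _ Uy) _; lra.
have /choice[dA hdA] : forall lj : L * L, exists dg, expands_on eps D K (A lj.1 lj.2) dg /\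
    forall u, smooth eps D m (K * `|u|) (dg ^~ u).
  by move=> [l j]; have [_] := sA l j.
have /choice[dB hdB] : forall l, exists dg, expands_on eps D K (B l) dg /\
    forall u, smooth eps D m (K * `|u|) (dg ^~ u).
  by move=> l; have [_] := sB l.
pose Bw l (p : P) (w : Y) := \sum_j dA (l, j) p (0, w) * J j p + dB l p (0, w).
have lin0 (f : P -> R) : real_linear f -> real_linear (fun w : Y => f (0, w)).
  move=> lf a u v; rewrite -lf; congr f.
  by apply/pair_equal_spec; split => //=; rewrite scaler0 addr0.
have sBw l w : smooth eps D m (K4 * `|w|) (fun p => Bw l p w).
  rewrite /K4 mulrDl; apply: smoothD; last first.
    by have [_ /(_ (0, w))] := hdB l; rewrite norm_0pair.
  rewrite -mulrA; apply: smooth_sum_cst => j.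
  have [_ /(_ (0, w))] := hdA (l, j); rewrite norm_0pair => h.
  have := smoothM eps_gt0 eps_le1 h (sJ j).
  by have -> : 4 ^+ m.+1 * (K * `|w| * KJ) = 4 ^+ m.+1 * (K * KJ) * `|w| by ring.
pose Phi l (p : P) := \sum_j A l j p * J j p + B l p.
have sPhi l : smooth eps D m K5 (Phi l).
  rewrite /K5; apply: smoothD; last exact: smooth_down.
  apply: smooth_sum_cst => j; apply: smoothM => //.
  exact: smooth_down.
have [] := @spatial_derivative R eps eps_gt0 T T_gt0 Y L U oU J Phi A Bw
  (fun _ _ => 0) K K1 K2 => //.
- by move=> l j t y tI Uy; apply: (smooth_bounded (sA l j)); split.
- move=> l t y tI Uy a u v; rewrite /Bw.
  have Dty : D (t, y) by split.
  have [[lB _] _] := hdB l.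
  rewrite (lin0 _ (lB _ Dty)).
  under eq_bigr => j _.
    have [[lA _] _] := hdA (l, j).
    rewrite (lin0 _ (lA _ Dty)) mulrDl -mulrA; over.
  by rewrite big_split /= -mulr_sumr; ring.
- move=> l t y w tI Uy; rewrite /Bw /K1 mulrDl.
  have Dty : D (t, y) by split.
  apply: le_trans (ler_normD _ _) _; apply: lerD.
    rewrite -mulrA; apply: norm_sum_le_card => j; rewrite normrM mulrAC ler_pM //.
      have [_ /(_ (0, w))] := hdA (l, j); rewrite norm_0pair => h.
      exact: (smooth_bounded h Dty).
    exact: (smooth_bounded (sJ j) Dty).
  have [_ /(_ (0, w))] := hdB l; rewrite norm_0pair => h.
  exact: (smooth_bounded h Dty).
- move=> l t y y' tI Uy Uy' yy.
  have Dp : D (t, y) by split.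
  have Dq : D (t, y') by split.
  have Epq : (t, y') - (t, y) = (0, y' - y) :> P.
    by apply/pair_equal_spec; split => //=; rewrite subrr.
  have npq : `|((t, y') : P) - (t, y)| = `|y' - y| by rewrite norm_pair_snd.
  have r0 := powR_ge0 `|y' - y| (1 + eps).
  have hA j : `|A l j (t, y') - A l j (t, y) - dA (l, j) (t, y) (0, y' - y)| <=
      K * `|y' - y| `^ (1 + eps).
    have [[_ h] _] := hdA (l, j).
    by rewrite -Epq -npq; apply: h; rewrite ?npq.
  have hB : `|B l (t, y') - B l (t, y) - dB l (t, y) (0, y' - y)| <=
      K * `|y' - y| `^ (1 + eps).
    have [[_ h] _] := hdB l.
    by rewrite -Epq -npq; apply: h; rewrite ?npq.
  have hJ j : `|J j (t, y') - J j (t, y)| <= 2 ^+ m * KJ * `|y' - y| `^ eps.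
    have [_ h] := smooth_hoelder eps_gt0 eps_le1 (sJ j).
    by rewrite -npq; apply: h; rewrite ?npq.
  (* What is left of the increment of [A J] is the expansion error of [A] times [J], plus the
     differential of [A] times the increment of [J]; the latter is of order r times r^eps, because
     [J] is already known to be Hoelder. *)
  have -> : Phi l (t, y') - Phi l (t, y) -
      \sum_j A l j (t, y) * (J j (t, y') - J j (t, y)) - Bw l (t, y) (y' - y) =
    \sum_j (A l j (t, y') - A l j (t, y) - dA (l, j) (t, y) (0, y' - y)) * J j (t, y') +
    \sum_j dA (l, j) (t, y) (0, y' - y) * (J j (t, y') - J j (t, y)) +
    (B l (t, y') - B l (t, y) - dB l (t, y) (0, y' - y)).
    rewrite /Phi /Bw.
    under [\sum_j A l j (t, y) * (J j (t, y') - J j (t, y))]eq_bigr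
      do rewrite mulrBr.
    under [\sum_j dA (l, j) (t, y) (0, y' - y) * (J j (t, y') - J j (t, y))]eq_bigr
      do rewrite mulrBr.
    under [\sum_j (A l j (t, y') - A l j (t, y) - dA (l, j) (t, y) (0, y' - y)) * J j (t, y')]eq_bigr
      do rewrite 2!mulrBl.
    by rewrite !sumrB; ring.
  rewrite /K2 !mulrDl.
  apply: le_trans (ler_normD _ _) _; apply: lerD => //.
  apply: le_trans (ler_normD _ _) _; apply: lerD.
    rewrite -mulrA; apply: norm_sum_le_card => j; rewrite normrM mulrAC ler_pM //.
    exact: (smooth_bounded (sJ j) Dq).
  rewrite -mulrA; apply: norm_sum_le_card => j.
  rewrite normrM powR_onePlus // mulrACA ler_pM //.
  have [_ /(_ (0, y' - y))] := hdA (l, j); rewrite norm_0pair => h.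
  exact: (smooth_bounded h Dp).
- by move=> l y y' Uy Uy'; rewrite (J0 l y y') // subrr.
- by move=> l a u v; rewrite mulr0 addr0.
- by move=> l w; rewrite normr0 mulr_ge0.
- by move=> l j y Uy; exact: (smooth_continuous_fst eps_gt0 eps_le1 (sA l j)).
- by move=> l y w Uy; exact: (smooth_continuous_fst eps_gt0 eps_le1 (sBw l w)).
move=> Kd [lKd bKd dKd Kd0 eKd].
have sKd1 w : `|w| <= 1 -> forall l, smooth eps D m KD (fun p => Kd l p w).
  move=> w1; apply: (IHD U A (fun l p => Bw l p w)) => //.
  - by move=> t y l tI Uy; exact: dKd.
  - by move=> l j; apply: smooth_mono (smooth_down eps_gt0 eps_le1 (sA l j)); rewrite lerDl.
  - move=> l; apply: smooth_mono (sBw l w).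
    by have := ler_wpM2l K40 w1; lra.
  - by move=> l y y' Uy Uy'; rewrite !Kd0.
  - by move=> l y Uy; rewrite Kd0 // normr0.
have sKd l w : smooth eps D m (KD * `|w|) (fun p => Kd l p w).
  apply: (@smooth_direction _ _ D m KD (Kd l) w) => [[t y] [tI Uy]|v v1]; [exact: lKd|exact: sKd1].
move=> l.
have SD : smooth_diff eps D m (2 ^+ m * K5 + K5 + KD + C * K2) (J l)
    (fun p u => u.1 * Phi l p + Kd l p u.2).
  apply: joint_expansion => //.
  - by move=> t y tI Uy; exact: dJ.
  - by move=> t y; exact: lKd.
  - by move=> t y y'; exact: eKd.
split.
  by move=> p Dp; apply: le_trans (smooth_bounded (sJ l) Dp) _; lra.
exists (fun p u => u.1 * Phi l p + Kd l p u.2).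
by apply: smooth_diff_mono SD; rewrite lerDr.
Qed.

End LinearODESmooth.

(** * Smoothness of flows *)

Section FlowSmooth.
Variables (R : realType) (eps : R).
Hypotheses (eps_gt0 : 0 < eps) (eps_le1 : eps <= 1).
Variables (T : R) (T_gt0 : 0 < T) (d : nat).

Local Notation I := `]- T, T[.
Local Notation Y := 'rV[R]_d.
Local Notation P := (R * 'rV[R]_d)%type.

(** Gronwall's inequality needs this at every distance, since two orbits may drift apart beyond 1;
    there the bound [2 * K] on the difference of the values is enough. *)
Lemma jet_lipschitz n K (X : set Y) h x y : 0 <= K -> (0 < n)%N ->
  jet_on eps n K X h -> X x -> X y ->
  `|h [::] x - h [::] y| <= (d%:R * K + 2 * K) * `|x - y|.
Proof.
move=> K0 n0 [ha hb _] Xx Xy.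
have r0 := normr_ge0 (x - y).
have P0 : 0 <= d%:R * K * `|x - y| by rewrite !mulr_ge0.
have P1 : 0 <= K * `|x - y| by rewrite mulr_ge0.
have [xy1|xy1] := leP `|x - y| 1; last first.
  have h1 := ha [::] x isT Xx; have h2 := ha [::] y isT Xy.
  have h3 := ler_wpM2l K0 (ltW xy1).
  have := ler_normB (h [::] x) (h [::] y); rewrite mulrDl; lra.
have [|q1 _ _ _ _] := @powR_small _ _ eps_gt0 eps_le1 `|x - y|; first by rewrite r0.
have h1 := hb [::] x y n0 Xx Xy.
have h2 : `|\sum_j (x - y) 0 j * h (rcons [::] j) y| <= d%:R * (K * `|x - y|).
  rewrite -[d in d%:R]card_ord; apply: norm_sum_le_card => j.
  by rewrite normrM mulrC ler_pM ?row_coord_le // ha.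
have h3 := ler_wpM2l K0 q1.
have := ler_normD (h [::] x - h [::] y - \sum_j (x - y) 0 j * h (rcons [::] j) y)
  (\sum_j (x - y) 0 j * h (rcons [::] j) y).
rewrite subrK; move/le_trans; apply; lra.
Qed.

Section Flow.
Variables (n : nat) (K : R) (X : set Y) (h : 'I_d -> seq 'I_d -> Y -> R).
Variables (U : set Y) (G : P -> Y).
Hypotheses (n_gt0 : (0 < n)%N) (K_ge0 : 0 <= K) (openU : open U).
Hypothesis h_jet : forall l, jet_on eps n K X (h l).
Hypothesis G_in : forall p, cylinder T U p -> X (G p).
Hypothesis G_ode : forall t y l, t \in I -> U y ->
  is_derive t 1 (fun s => G (s, y) 0 l) (h l [::] (G (t, y))).
Hypothesis G_init : forall y, U y -> G (0, y) = y.

Let C := gronwall_const T 'I_d (d%:R * K + 2 * K).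

Let C_ge0 : 0 <= C.
Proof. exact: le_trans ler01 (gronwall_const_ge1 _ _ _). Qed.

Lemma flow_lipschitz_snd t y y' : t \in I -> U y -> U y' ->
  `|G (t, y') - G (t, y)| <= C * `|y' - y|.
Proof.
move=> tI Uy Uy'; apply: row_norm_le => [|l]; first by rewrite mulr_ge0.
rewrite !mxE -[X in C * X]addr0.
have L0 : 0 <= d%:R * K + 2 * K by rewrite addr_ge0 // mulr_ge0.
apply: (@gronwall R T 'I_d (fun l s => G (s, y') 0 l - G (s, y) 0 l)
  (fun l s => h l [::] (G (s, y')) - h l [::] (G (s, y)))) => //.
- by move=> s sI i; apply: is_deriveB; exact: G_ode.
- move=> s sI i; rewrite addr0.
  apply: le_trans (jet_lipschitz K_ge0 n_gt0 (h_jet i) (G_in (conj sI Uy' : cylinder T U (s, y')))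
    (G_in (conj sI Uy : cylinder T U (s, y)))) _.
  rewrite ler_wpM2l //; apply: row_norm_le => [|j]; first exact: sumr_ge0.
  by rewrite !mxE (bigD1 j) //= lerDl sumr_ge0.
- move=> i; rewrite !G_init //.
  by have := row_coord_le (y' - y) i; rewrite !mxE.
Qed.

Lemma flow_lipschitz p q : cylinder T U p -> cylinder T U q ->
  `|G q - G p| <= (K + C) * `|q - p|.
Proof.
case: p q => [t y] [t' y'] [/= tI Uy] [/= t'I Uy'].
have t1 : `|t' - t| <= `|(t', y') - (t, y)| := norm_fst_le ((t', y') - (t, y)).
have y1 : `|y' - y| <= `|(t', y') - (t, y)| := norm_snd_le ((t', y') - (t, y)).
have -> : G (t', y') - G (t, y) = (G (t', y') - G (t, y')) + (G (t, y') - G (t, y)).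
  by rewrite addrA subrK.
apply: le_trans (ler_normD _ _) _; rewrite mulrDl lerD //; last first.
  by apply: le_trans (flow_lipschitz_snd tI Uy Uy') _; rewrite ler_wpM2l.
apply: row_norm_le => [|l]; first by rewrite mulr_ge0.
apply: (@le_trans _ _ (K * `|t' - t|)); last by rewrite ler_wpM2l.
rewrite !mxE.
apply: (@mean_value_le R (fun s => G (s, y') 0 l) (fun s => h l [::] (G (s, y')))).
  by move=> s /(between_itv tI t'I) sI; exact: G_ode.
move=> s /(between_itv tI t'I) sI; have [ha _ _] := h_jet l.
by apply: ha => //; apply: G_in; split.
Qed.

Lemma flow_jet_smooth0 l s : (size s <= n)%N ->
  smooth eps (cylinder T U) 0 (K + d%:R * (K * (K + C)) + K * (K + C) `^ (1 + eps) +
    K * (K + C) `^ eps) (fun p => h l s (G p)).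
Proof.
move=> sn; apply: (smooth0_comp eps_gt0 eps_le1 K_ge0 _ (h_jet l)) => //.
- exact: addr_ge0.
- by move=> p q Dp Dq _; exact: flow_lipschitz.
Qed.

(** An instance of [spatial_derivative] with [W] the flow. The factor [K * C^(1 + eps)] is the
    Taylor error of the vector field between two points of the flow at distance at most
    [C * |y' - y|]. *)
Lemma flow_variation : exists Kd : 'I_d -> P -> Y -> R,
  [/\ forall l t y, t \in I -> U y -> real_linear (Kd l (t, y)),
      forall w, linear_ode T U (fun l j p => h l [:: j] (G p)) (fun _ _ => 0)
        (fun l p => Kd l p w),
      forall l y w, U y -> Kd l (0, y) w = w 0 l
    & forall l t y y', t \in I -> U y -> U y' -> `|y' - y| <= 1 ->
        `|G (t, y') 0 l - G (t, y) 0 l - Kd l (t, y) (y' - y)| <=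
          gronwall_const T 'I_d K * (K * C `^ (1 + eps)) * `|y' - y| `^ (1 + eps)].
Proof.
have [] := @spatial_derivative R eps eps_gt0 T T_gt0 Y 'I_d U openU
  (fun l p => G p 0 l) (fun l p => h l [::] (G p)) (fun l j p => h l [:: j] (G p))
  (fun _ _ _ => 0) (fun l w => w 0 l) K 1 (K * C `^ (1 + eps)) => //.
- by rewrite mulr_ge0 // powR_ge0.
- move=> l j t y tI Uy; have [ha _ _] := h_jet l.
  by apply: ha => //; apply: G_in; split.
- by move=> l t y tI Uy a u v; rewrite mulr0 addr0.
- by move=> l t y w tI Uy; rewrite normr0 mulr_ge0.
- move=> l t y y' tI Uy Uy' yy; rewrite subr0.
  have GL := flow_lipschitz_snd tI Uy Uy'.
  have := @jet_taylor_step R eps eps_gt0 d P (cylinder T U) n K X (h l) G C [::] (t, y) (t, y')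
    K_ge0 C_ge0 (h_jet l) G_in.
  rewrite norm_pair_snd => /(_ GL n_gt0 (conj tI Uy) (conj tI Uy')).
  rewrite (eq_bigr (fun j => h l [:: j] (G (t, y)) * (G (t, y') 0 j - G (t, y) 0 j))) //.
  by move=> j _; rewrite !mxE mulrC.
- by move=> l y y' Uy Uy'; rewrite !G_init // !mxE.
- by move=> l a u v; rewrite !mxE.
- by move=> l w; rewrite mul1r row_coord_le.
- move=> l j y Uy.
  exact: (smooth_continuous_fst eps_gt0 eps_le1 (@flow_jet_smooth0 l [:: j] n_gt0)).
- by move=> l y w Uy t tI; exact: cvg_cst.
move=> Kd [lKd _ dKd Kd0 eKd]; exists Kd; split => // w t y l tI Uy.
exact: dKd.
Qed.

End Flow.

(* One step of the bootstrap: [dG] is as smooth as [H^0 o G] and [H^1 o G]. *)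
Lemma flow_smooth_step n m K KA : 0 <= K -> 0 <= KA -> (0 < n)%N ->
  exists2 K' : R, 0 <= K' &
  forall X h (U : set Y) (G : P -> Y), open U ->
    (forall l, jet_on eps n K X (h l)) -> (forall p, cylinder T U p -> X (G p)) ->
    (forall t y l, t \in I -> U y ->
      is_derive t 1 (fun s => G (s, y) 0 l) (h l [::] (G (t, y)))) ->
    (forall y, U y -> G (0, y) = y) ->
    (forall l s, (size s <= 1)%N -> smooth eps (cylinder T U) m KA (fun p => h l s (G p))) ->
    exists dG, forall l, smooth_diff eps (cylinder T U) m K' (fun p => G p 0 l) (dG l).
Proof.
move=> K0 KA0 n0.
have KA1 : 0 <= KA + 1 by rewrite addr_ge0.
have [K2 K20 H2] := smooth_linear_ode eps_gt0 eps_le1 T_gt0 [the normedModType R of Y] 'I_d m KA1.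
set K3 := gronwall_const T 'I_d K *
  (K * gronwall_const T 'I_d (d%:R * K + 2 * K) `^ (1 + eps)).
have K30 : 0 <= K3.
  rewrite mulr_ge0 ?mulr_ge0 ?powR_ge0 //.
  exact: le_trans ler01 (gronwall_const_ge1 _ _ _).
exists (2 ^+ m * KA + KA + K2 + K3); first by rewrite !addr_ge0 // mulr_ge0 // exprn_ge0.
move=> X h U G oU hj GX dG G0 sh.
have [Kd [lKd oKd Kd0 eKd]] := flow_variation n0 K0 oU hj GX dG G0.
exists (fun l p u => u.1 * h l [::] (G p) + Kd l p u.2) => l.
apply: joint_expansion => //.
- exact: (sh l [::] isT).
- by move=> t y; exact: lKd.
- move=> w; apply: (@smooth_direction _ _ _ _ (cylinder T U) m K2 (Kd l) w).
    by move=> [t y] [tI Uy]; exact: lKd.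
  move=> v v1; apply: H2 (oKd v) _ _ _ _ l => //.
  + by move=> i j; apply: smooth_mono (sh i [:: j] _); rewrite // lerDl.
  + by move=> i; apply: smooth_mono (smooth_cst eps (cylinder T U) m 0); rewrite normr0.
  + by move=> i y y' Uy Uy'; rewrite !Kd0.
  + move=> i y Uy; rewrite Kd0 //; apply: le_trans (row_coord_le _ _) _.
    by apply: le_trans v1 _; rewrite lerDr.
- by move=> t y y'; exact: eKd.
Qed.

(** Passing from m to m + 1 requires the values and first derivatives of the vector field along the
    flow to be of class m + 1, hence its derivatives up to order m + 2 <= n. This is why the
    bootstrap ends at m = n - 1. *)
Lemma flow_smooth n m K : 0 <= K -> (m < n)%N -> exists2 K' : R, 0 <= K' &
  forall X h (U : set Y) (G : P -> Y), open U ->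
    (forall l, jet_on eps n K X (h l)) -> (forall p, cylinder T U p -> X (G p)) ->
    (forall t y l, t \in I -> U y ->
      is_derive t 1 (fun s => G (s, y) 0 l) (h l [::] (G (t, y)))) ->
    (forall y, U y -> G (0, y) = y) ->
    exists dG, forall l, smooth_diff eps (cylinder T U) m K' (fun p => G p 0 l) (dG l).
Proof.
move=> K0; elim: m => [|m IH] mn.
  set C := gronwall_const T 'I_d (d%:R * K + 2 * K).
  have C0 : 0 <= C := le_trans ler01 (gronwall_const_ge1 _ _ _).
  have KA0 : 0 <= K + d%:R * (K * (K + C)) + K * (K + C) `^ (1 + eps) + K * (K + C) `^ eps.
    by rewrite !(addr_ge0, mulr_ge0) ?powR_ge0.
  have [K' K'0 H] := flow_smooth_step 0 K0 KA0 mn.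
  exists K' => // X h U G oU hj GX dG G0; apply: (H X h U G oU hj GX dG G0) => // l s s1.
  by apply: (flow_jet_smooth0 mn K0 hj GX dG G0); exact: leq_trans mn.
have [Km Km0 {}IH] := IH (ltnW mn).
have [KA KA0 HA] := @smooth_comp R eps eps_gt0 eps_le1 d [the normedModType R of P] n m m.+1 K Km
  K0 Km0 (leqnn _).
have [K' K'0 H] := flow_smooth_step m.+1 K0 KA0 (leq_ltn_trans (leq0n _) mn).
exists K' => // X h U G oU hj GX dG G0; apply: (H X h U G oU hj GX dG G0) => // l s s1.
have [dG' sG] := IH X h U G oU hj GX dG G0.
apply: (HA _ X (h l) G dG' s (hj l) GX sG).
by apply: leq_trans mn; rewrite -[X in (_ <= X)%N]add1n leq_add2r.
Qed.

End FlowSmooth.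

(** * Iterated directional derivatives *)

Section IteratedDerivatives.
Variables (R : realType) (eps : R).
Hypotheses (eps_gt0 : 0 < eps) (eps_le1 : eps <= 1).
Variables (V : normedModType R) (D : set V).
Hypothesis openD : open D.

Lemma open_step p (u : V) : D p -> \forall h \near (0 : R), D (h *: u + p).
Proof.
move=> Dp; have : (fun h : R => h *: u + p) @ (0 : R) --> p.
  rewrite -[X in _ --> X](add0r p) -[X in _ --> (X + _)](scale0r u).
  by apply: cvgD; [apply: cvgZl; exact: cvg_id|exact: cvg_cst].
by apply; exact: open_nbhs_nbhs.
Qed.

Lemma near_powR_le (eta : R) : 0 < eta -> \forall h \near (0 : R)^'+, h `^ eps <= eta.
Proof.
move=> eta0; have /cvgr0_norm_le /(_ eta eta0) := @powR_cvg0 R eps eps_gt0.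
by apply: filterS => h; rewrite ger0_norm // powR_ge0.
Qed.

Lemma expands_is_derive K g dg p u : expands_on eps D K g dg -> D p ->
  is_derive p u g (dg p u).
Proof.
move=> [lg hg] Dp; apply: is_derive_approx => eta eta0.
set c := `|K| * `|u| `^ (1 + eps).
have c0 : 0 <= c by rewrite mulr_ge0 // powR_ge0.
have [de de0 hde] := powR_near0 c0 eps_gt0 eta0.
have w0 : 0 < (`|u| + 1)^-1 by rewrite invr_gt0 ltr_wpDl.
near=> h.
have hD : D (h *: u + p) by near: h; apply: nbhs_dnbhs; exact: open_step.
have h1 : `|h| <= (`|u| + 1)^-1 by near: h; apply: dnbhs0_le.
have h2 : `|h| <= de by near: h; apply: dnbhs0_le.
have hp : h *: u + p - p = h *: u by rewrite addrK.
have hu1 : `|h *: u + p - p| <= 1.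
  rewrite hp normrZ; apply: le_trans (ler_wpM2r (normr_ge0 u) h1) _.
  by rewrite mulrC ler_pdivrMr ?ltr_wpDl // mul1r lerDl.
have := hg p _ Dp hD hu1; rewrite hp (real_linearZ _ _ (lg _ Dp)) => /le_trans; apply.
apply: (@le_trans _ _ (c * (`|h| * `|h| `^ eps))).
  rewrite normrZ powRM // (powR_onePlus (normr_ge0 h)) // /c.
  have Q : 0 <= `|h| * `|h| `^ eps * `|u| `^ (1 + eps) by rewrite !mulr_ge0 ?powR_ge0.
  by have := ler_wpM2r Q (ler_norm K); lra.
by rewrite mulrCA mulrC ler_wpM2r // hde.
Unshelve. all: by end_near. Qed.

Lemma derive_ext (g g' : V -> R) p w : (forall q, D q -> g q = g' q) -> D p ->
  'D_w g p = 'D_w g' p.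
Proof.
move=> E Dp; apply: near_eq_derive; apply: filterS (open_nbhs_nbhs (conj openD Dp)) => q.
exact: E.
Qed.

(** On an open set an expansion determines its linear part, so the witness hidden in [smooth] may be
    replaced by the directional derivative, which can be iterated and permuted. *)
Lemma smooth_derive m K g : smooth eps D m.+1 K g ->
  expands_on eps D K g (fun p u => 'D_u g p) /\
  forall u, smooth eps D m (K * `|u|) ('D_u g).
Proof.
move=> [_ [dg [eg sg]]].
have E p u : D p -> 'D_u g p = dg p u.
  by move=> Dp; case: (expands_is_derive u eg Dp).
split; last by move=> u; apply: smooth_ext (sg u) => p Dp; rewrite E.
case: eg => lg hg; split.
  by move=> p Dp a u v; rewrite !E // lg.
by move=> p q Dp Dq pq; rewrite E //; exact: hg.
Qed.

Lemma smooth_is_derive m K g p u : smooth eps D m.+1 K g -> D p ->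
  is_derive p u g ('D_u g p).
Proof. by move=> /smooth_derive[eg _]; exact: (expands_is_derive u eg). Qed.

Definition dirs (g : V -> R) (ws : seq V) : V -> R := foldl (fun f w => 'D_w f) g ws.

Arguments dirs : simpl never.

Lemma dirs_cons g w ws : dirs g (w :: ws) = dirs ('D_w g) ws.
Proof. by []. Qed.

Lemma dirs_rcons g ws w : dirs g (rcons ws w) = 'D_w (dirs g ws).
Proof. by rewrite /dirs foldl_rcons. Qed.

Lemma dirs_cat g ws ws' : dirs g (ws ++ ws') = dirs (dirs g ws) ws'.
Proof. by rewrite /dirs foldl_cat. Qed.

Lemma dirs_ext g g' ws p : (forall q, D q -> g q = g' q) -> D p ->
  dirs g ws p = dirs g' ws p.
Proof.
elim: ws g g' => [|w ws IH] g g' E Dp; first exact: E.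
by rewrite !dirs_cons; apply: IH => // q Dq; exact: derive_ext.
Qed.

Lemma smooth_dirs m K g ws : smooth eps D m K g -> (size ws <= m)%N ->
  smooth eps D (m - size ws) (K * \prod_(w <- ws) `|w|) (dirs g ws).
Proof.
elim: ws m K g => [|w ws IH] [|m] K g sg wsm //; rewrite ?big_nil ?mulr1 //.
rewrite big_cons dirs_cons mulrA subSS; apply: IH => //.
by have [_] := smooth_derive sg; exact.
Qed.

Lemma smooth_dirs_bounded m K g ws p : smooth eps D m K g -> (size ws <= m)%N -> D p ->
  `|dirs g ws p| <= K * \prod_(w <- ws) `|w|.
Proof. by move=> sg wsm; exact: (smooth_bounded (smooth_dirs sg wsm)). Qed.

Lemma derive_real_linear m K g p : smooth eps D m.+1 K g -> D p ->
  real_linear (fun u => 'D_u g p).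
Proof. by move=> /smooth_derive[[lg _] _]; exact: lg. Qed.

Lemma difference_algebra (a1 a2 a3 a4 h b1 b2 b0 x c1 c2 : R) :
  a1 - a2 - (a3 - a4) = (b1 - b2) * h ->
  a1 - a2 - a3 + a4 - h * h * c2 = h * ((b1 - b0 - (x * c1 + h * c2)) - (b2 - b0 - x * c1)).
Proof.
move=> E; have -> : a1 - a2 - a3 + a4 = a1 - a2 - (a3 - a4) by ring.
by rewrite E; ring.
Qed.

Lemma norm_common (z h x y a b : R) :
  `|z - h * x| <= a -> `|z - h * y| <= b -> `|h * (x - y)| <= a + b.
Proof.
move=> ha hb; have -> : h * (x - y) = (z - h * y) - (z - h * x) by ring.
by apply: le_trans (ler_normB _ _) _; rewrite addrC lerD.
Qed.

(* Expanding ['D_u g] along the mean value of the second difference, whose left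
   part is symmetric in [u] and [v], gives Schwarz's theorem. *)
Lemma second_difference K g p u v : smooth eps D 2 K g -> D p ->
  exists M, \forall h \near (0 : R)^'+,
    `|g (p + h *: u + h *: v) - g (p + h *: u) - g (p + h *: v) + g p
      - h * h * 'D_v ('D_u g) p| <= M * (h * h * h `^ eps).
Proof.
move=> sg Dp; have K0 := smooth_ge0 sg Dp.
have [_ /(_ u) s1] := smooth_derive sg.
have [[l1 h1] _] := smooth_derive s1.
set c := `|u| + `|v|.
have c0 : 0 <= c by exact: addr_ge0.
exists (2 * (K * `|u|) * c `^ (1 + eps)).
have /nbhs_ballP[r /= r0 rD] : nbhs p D by exact: open_nbhs_nbhs.
(* Below this threshold the parallelogram at [p] with sides [h *: u] and [h *: v] lies in [D] and
   within distance 1 of [p]. *)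
have e0 : 0 < Num.min r 1 / (c + 1) by rewrite divr_gt0 ?ltr_wpDl // lt_min r0 ltr01.
near=> h.
have h0 : 0 < h by near: h; exact: nbhs_right_gt.
have hle : h < Num.min r 1 / (c + 1) by near: h; exact: nbhs_right_lt.
have hc : h * c < Num.min r 1.
  move: hle; rewrite ltr_pdivlMr ?ltr_wpDl // mulrDr mulr1 => /(le_lt_trans _); apply.
  by rewrite lerDl ltW.
have inD (a b : R) : 0 <= a <= h -> 0 <= b <= h ->
    `|a *: u + b *: v| <= h * c /\ D (p + (a *: u + b *: v)).
  move=> /andP[a0 ah] /andP[b0 bh].
  have nle : `|a *: u + b *: v| <= h * c.
    apply: le_trans (ler_normD _ _) _.
    by rewrite !normrZ !ger0_norm // mulrDr lerD // ler_wpM2r.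
  split => //; apply: rD; rewrite -ball_normE /= opprD addrA subrr sub0r normrN.
  by apply: (le_lt_trans nle); apply: (lt_le_trans hc); rewrite ge_min lexx.
have hc1 : h * c <= 1 by apply: ltW; apply: (lt_le_trans hc); rewrite ge_min lexx orbT.
have h00 : 0 <= h <= h by rewrite lexx ltW.
have H (a b : R) : 0 <= a <= h -> 0 <= b <= h ->
    `|'D_u g (p + (a *: u + b *: v)) - 'D_u g p - 'D_(a *: u + b *: v) ('D_u g) p| <=
      K * `|u| * (h * c) `^ (1 + eps).
  move=> ha hb; have [n1 D1] := inD a b ha hb.
  have := h1 p (p + (a *: u + b *: v)) Dp D1.
  rewrite addrAC subrr add0r => /(_ (le_trans n1 hc1)) /le_trans; apply.
  by rewrite ler_wpM2l ?mulr_ge0 // ler_powR2 // addr_ge0 // ltW.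
have der (a b : R) : 0 <= a <= h -> 0 <= b <= h ->
    is_derive a 1 (fun s => g (p + (s *: u + b *: v))) ('D_u g (p + (a *: u + b *: v))).
  move=> ha hb; have [n1 D1] := inD a b ha hb.
  have dg := smooth_is_derive u sg D1.
  apply: is_derive_approx => eta eta0.
  apply: filterS (is_derive_near dg eta0) => k.
  suff -> : p + ((k *: 1 + a) *: u + b *: v) = k *: u + (p + (a *: u + b *: v)) by [].
  by rewrite [k *: 1]mulr1 scalerDl -[k *: u + a *: u + _]addrA; exact: addrCA.
have [|x] := @MVT_any R (fun s => g (p + (s *: u + h *: v)) - g (p + (s *: u + 0 *: v)))
   (fun s => 'D_u g (p + (s *: u + h *: v)) - 'D_u g (p + (s *: u + 0 *: v))) 0 h.
  move=> x; rewrite min_l ?max_r ?(ltW h0) // => xh.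
  by apply: is_deriveB; apply: der => //; rewrite lexx ltW.
rewrite min_l ?max_r ?(ltW h0) // => xh.
have H1 := H _ _ xh h00.
have h0h : 0 <= (0 : R) <= h by rewrite lexx ltW.
have H2 := H x 0 xh h0h.
have ll := l1 _ Dp.
rewrite !scale0r !addr0 !add0r subr0 in H2 *.
rewrite (real_linearD _ _ ll) (real_linearZ _ _ ll) (real_linearZ h _ ll) in H1.
rewrite (real_linearZ _ _ ll) in H2.
move=> E.
have -> : g (p + h *: u + h *: v) - g (p + h *: u) - g (p + h *: v) + g p
      - h * h * 'D_v ('D_u g) p =
  h * (('D_u g (p + (x *: u + h *: v)) - 'D_u g p -
        (x * 'D_u ('D_u g) p + h * 'D_v ('D_u g) p)) -
       ('D_u g (p + x *: u) - 'D_u g p - x * 'D_u ('D_u g) p)).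
  by rewrite -[p + _ + _]addrA; exact: difference_algebra.
rewrite normrM (gtr0_norm h0).
have -> : 2 * (K * `|u|) * c `^ (1 + eps) * (h * h * h `^ eps) =
  h * (2 * (K * `|u|) * c `^ (1 + eps) * (h * h `^ eps)) by ring.
rewrite ler_pM2l //.
apply: le_trans (ler_normB _ _) _.
have := lerD H1 H2; rewrite powRM ?(ltW h0) // (powR_onePlus (ltW h0)) // => /le_trans; apply.
by rewrite le_eqVlt; apply/orP; left; apply/eqP; ring.
Unshelve. all: by end_near. Qed.

(** The second differences in the two orders coincide, so the mixed derivatives differ by O(h^eps)
    after division by h^2. *)
Lemma derive_swap K g p u v : smooth eps D 2 K g -> D p ->
  'D_v ('D_u g) p = 'D_u ('D_v g) p.
Proof.
move=> sg Dp; have [M1 H1] := second_difference u v sg Dp.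
have [M2 H2] := second_difference v u sg Dp.
apply/eqP; rewrite -subr_eq0 -normr_le0.
have M0 : 0 <= `|M1| + `|M2| by exact: addr_ge0.
apply: (ler_all_eps M0) => eta eta0; rewrite add0r.
near (0 : R)^'+ => h.
have h0 : 0 < h by near: h; exact: nbhs_right_gt.
have he : h `^ eps <= eta by near: h; exact: near_powR_le.
have hh : 0 < h * h by rewrite mulr_gt0.
rewrite -(ler_pM2l hh) -[X in X * `|_|](gtr0_norm hh) -normrM.
have E1 : `|g (p + h *: u + h *: v) - g (p + h *: u) - g (p + h *: v) + g p
      - h * h * 'D_v ('D_u g) p| <= M1 * (h * h * h `^ eps) by near: h.
have E2 : `|g (p + h *: v + h *: u) - g (p + h *: v) - g (p + h *: u) + g p
      - h * h * 'D_u ('D_v g) p| <= M2 * (h * h * h `^ eps) by near: h.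
rewrite [p + h *: v + h *: u]addrAC in E2.
have P : 0 <= h * h * h `^ eps by rewrite mulr_ge0 ?powR_ge0 // ltW.
rewrite [_ - g (p + h *: v) - g (p + h *: u)]addrAC in E2.
apply: (le_trans (norm_common E1 E2)).
rewrite -mulrDl [leRHS]mulrCA.
apply: (@le_trans _ _ ((`|M1| + `|M2|) * (h * h * h `^ eps))).
  by rewrite ler_wpM2r // lerD // ler_norm.
by rewrite ler_wpM2l // ler_wpM2l // ltW.
Unshelve. all: by end_near. Qed.

Lemma dirs_move m K g s1 w s2 p : smooth eps D m K g -> (size (s1 ++ w :: s2) <= m)%N ->
  D p -> dirs g (s1 ++ w :: s2) p = dirs g (w :: s1 ++ s2) p.
Proof.
elim: s1 m K g => [//|a s1 IH] m K g sg sm Dp.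
have {sm} [k Em sm] : exists2 k, m = k.+2 & (size (s1 ++ w :: s2) <= k.+1)%N.
  by move: sm; rewrite cat_cons /= size_cat /= addnS; case: m {sg} => [|[|k]] // sm; exists k.
rewrite {}Em in sg.
have [_ /(_ a) sa] := smooth_derive sg.
rewrite cat_cons dirs_cons (IH _ _ _ sa sm Dp) !dirs_cons.
apply: dirs_ext Dp => q Dq.
have sg2 := @smooth_downs R eps eps_gt0 eps_le1 V D k.+2 2 K g isT sg.
exact: (derive_swap _ _ sg2 Dq).
Qed.

(** The head of [s1] is moved to the front of [s2], and the remaining directions are compared for
    the derivative of [g] along it. *)
Lemma dirs_perm m K g s1 s2 p : smooth eps D m K g -> (size s1 <= m)%N ->
  perm_eq s1 s2 -> D p -> dirs g s1 p = dirs g s2 p.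
Proof.
elim: s1 s2 m K g => [|w s1 IH] s2 m K g sg sm.
  by rewrite perm_sym => /perm_nilP ->.
move=> ps Dp; have ws2 : w \in s2 by rewrite -(perm_mem ps) mem_head.
move: ws2 ps.
case/path.splitPr => t1 t2 ps.
have st : (size (t1 ++ w :: t2) <= m)%N by rewrite -(perm_size ps).
rewrite (dirs_move sg st Dp).
case: m sg sm {st} => [|m] sg sm; first by case: (notF sm).
rewrite !dirs_cons; have [_ /(_ w) s1'] := smooth_derive sg.
apply: (IH _ _ _ _ s1' sm _ Dp).
rewrite -(perm_cons w); apply: (perm_trans ps).
by rewrite -[w :: t2]cat1s perm_catCA.
Qed.

Lemma is_derive_line g y (u : V) (s l : R) : is_derive (y + s *: u) u g l ->
  is_derive s 1 (fun s => g (y + s *: u)) l.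
Proof.
move=> dg; apply: is_derive_approx => eta eta0.
apply: filterS (is_derive_near dg eta0) => k.
suff -> : y + (k *: 1 + s) *: u = k *: u + (y + s *: u) by [].
by rewrite [k *: 1]mulr1 scalerDl; exact: addrCA.
Qed.

Lemma is_derive_taylor_term (i : nat) (c s : R) :
  is_derive s 1 (fun s : R => (i.+1)`!%:R^-1 * (s ^+ i.+1 * c)) (i`!%:R^-1 * (s ^+ i * c)).
Proof.
have h : is_derive s 1 (fun s : R => s ^+ i.+1) (i.+1%:R * s ^+ i).
  have -> : (fun s : R => s ^+ i.+1) = (@id R) ^+ i.+1 by rewrite exprfctE.
  by apply: (is_derive_eq (@is_deriveX R R (@id R) i.+1 s 1 1 _)); exact: mulr1.
have h2 := is_deriveZ ((i.+1)`!%:R^-1 * c) h.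
have -> : (fun s : R => (i.+1)`!%:R^-1 * (s ^+ i.+1 * c)) =
   ((i.+1)`!%:R^-1 * c) \*: (fun s : R => s ^+ i.+1).
  apply/funext => x.
  by change ((i.+1)`!%:R^-1 * (x ^+ i.+1 * c) = (i.+1)`!%:R^-1 * c * x ^+ i.+1); ring.
apply: (is_derive_eq h2).
change ((i.+1)`!%:R^-1 * c * (i.+1%:R * s ^+ i) = i`!%:R^-1 * (s ^+ i * c)).
rewrite factS natrM; field.
by rewrite nat1r !pnatr_eq0 -lt0n fact_gt0.
Qed.

(** Along the ray, the derivative of the Taylor remainder of [g] is that of ['D_u g], one order
    lower and with constant [K * |u|]; the mean value inequality then climbs back. At order 0 the
    Hoelder condition serves for increments of norm at most 1; for longer ones the values differ by
    at most [2 * K], whence the factor 2. *)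
Lemma taylor_ray m K g y (u : V) : smooth eps D m K g ->
  (forall s, 0 <= s <= 1 -> D (y + s *: u)) ->
  forall s, 0 <= s <= 1 ->
  `|g (y + s *: u) - \sum_(i < m.+1) i`!%:R^-1 * (s ^+ i * dirs g (nseq i u) y)|
    <= 2 * K * `|u| `^ (m%:R + eps).
Proof.
move=> sg DD; have Dy : D y.
  by have := DD 0; rewrite scale0r addr0; apply; rewrite lexx ler01.
elim: m K g sg => [|m IH] K g sg s s01.
  have K0 := smooth_ge0 sg Dy.
  rewrite big_ord1 fact0 invr1 expr0 !mul1r /= add0r.
  have nE : `|y + s *: u - y| = s * `|u|.
    by rewrite addrC addKr normrZ ger0_norm //; case/andP: s01.
  have su : s * `|u| <= `|u| by rewrite ler_piMl //; case/andP: s01.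
  have su0 : 0 <= s * `|u| by rewrite mulr_ge0 //; case/andP: s01.
  have [le1|gt1] := leP (s * `|u|) 1.
    have [_ hg] := sg; apply: le_trans (hg _ _ Dy (DD _ s01) _) _; rewrite nE //.
    have h1 : (s * `|u|) `^ eps <= `|u| `^ eps by apply: ler_powR2 => //; exact: ltW.
    have := ler_wpM2l K0 h1; have := mulr_ge0 K0 (powR_ge0 `|u| eps); lra.
  have h1 : 1 <= `|u| `^ eps.
    have <- : 1 `^ eps = 1 :> R by rewrite powR1.
    by apply: ler_powR2 => //; [exact: ltW|lra].
  have [bg _] := sg.
  apply: le_trans (ler_normB _ _) _.
  have := bg _ (DD _ s01); have := bg _ Dy; have := ler_wpM2l K0 h1; lra.
have [eg /(_ u) su] := smooth_derive sg.
pose phi (s : R) := g (y + s *: u) - \sum_(i < m.+2) i`!%:R^-1 * (s ^+ i * dirs g (nseq i u) y).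
pose dphi (s : R) := 'D_u g (y + s *: u) -
  \sum_(i < m.+1) i`!%:R^-1 * (s ^+ i * dirs ('D_u g) (nseq i u) y).
have dphiP (x : R) : 0 <= x <= 1 -> is_derive x 1 phi (dphi x).
  move=> x01; apply: is_deriveB.
    by apply: is_derive_line; exact: (smooth_is_derive u sg (DD _ x01)).
  have -> : (fun s : R => \sum_(i < m.+2) i`!%:R^-1 * (s ^+ i * dirs g (nseq i u) y)) =
      (fun s => cst (g y) s +
        \sum_(i < m.+1) (i.+1)`!%:R^-1 * (s ^+ i.+1 * dirs g (nseq i.+1 u) y)).
    by apply/funext => z; rewrite big_ord_recl /= fact0 invr1 expr0 !mul1r.
  rewrite -[X in is_derive _ _ _ X]add0r; apply: is_deriveD.
  by apply: is_derive_bigsum => i; exact: is_derive_taylor_term.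
have phi0 : phi 0 = 0.
  rewrite /phi scale0r addr0 big_ord_recl /= fact0 invr1 expr0 !mul1r big1 ?addr0 ?subrr //.
  by move=> i _; rewrite exprS !mul0r mulr0.
have s0 : 0 <= s by case/andP: s01.
rewrite -/(phi s) -[phi s]subr0 -phi0.
have K0 := smooth_ge0 sg Dy.
have M0 : 0 <= 2 * K * `|u| `^ (m.+1%:R + eps) by rewrite !mulr_ge0 // powR_ge0.
apply: (@le_trans _ _ (2 * K * `|u| `^ (m.+1%:R + eps) * `|s - 0|)); last first.
  by rewrite subr0 ger0_norm // ler_piMr //; case/andP: s01.
have x01 (x : R) : Num.min 0 s <= x <= Num.max 0 s -> 0 <= x <= 1.
  by rewrite min_l // max_r // => /andP[-> xs]; rewrite (le_trans xs) //; case/andP: s01.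
apply: (mean_value_le (df := dphi)) => x /x01 xx; first exact: dphiP.
apply: le_trans (IH _ _ su x xx) _.
have -> : m.+1%:R + eps = 1 + (m%:R + eps) by rewrite -natr1; ring.
rewrite powR_onePlus ?ltr_wpDl //.
by rewrite le_eqVlt; apply/orP; left; apply/eqP; ring.
Qed.

End IteratedDerivatives.

(** * Jets on tensor powers *)

Section TensorLists.
Variables (R : realType) (E : vectType R).

(* Elementary tensors are indexed by lists, which avoids casts between the types
   ['I_k] for provably equal values of [k]. *)
Definition tlist (ws : seq E) : tpower E (size ws) :=
  tens (fun i : 'I_(size ws) => nth 0 ws i).

Definition vlist (k : nat) (v : 'I_k -> E) : seq E := [seq v i | i <- enum 'I_k].

Lemma size_vlist k (v : 'I_k -> E) : size (vlist v) = k.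
Proof. by rewrite size_map size_enum_ord. Qed.

Lemma nth_vlist k (v : 'I_k -> E) (i : 'I_k) : nth 0 (vlist v) i = v i.
Proof. by rewrite (nth_map i) ?size_enum_ord // nth_ord_enum. Qed.

Lemma vlist_nth k ws : size ws = k -> vlist (fun i : 'I_k => nth 0 ws i) = ws.
Proof.
move=> <-; apply: (@eq_from_nth _ 0); rewrite size_vlist // => i si.
by rewrite (nth_vlist _ (Ordinal si)).
Qed.

Lemma eq_tens k (v w : 'I_k -> E) : v =1 w -> tens v = tens w.
Proof. by move=> vw; apply/ffunP => I; rewrite !ffunE; apply: eq_bigr => i _; rewrite vw. Qed.

(** Both sides lie in [A], whatever the degree, because [phi] is given in all degrees. The equation
    [size ws = k] can thus be eliminated without a cast between tensor powers. *)
Lemma tens_transport (A : Type) (phi : forall k, tpower E k -> A) k (v : 'I_k -> E) ws :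
  size ws = k -> (forall i, v i = nth 0 ws i) -> phi k (tens v) = phi _ (tlist ws).
Proof. by move=> sk; case: _ / sk v => v H; congr (phi _ _); exact: eq_tens. Qed.

Lemma tens_vlist (A : Type) (phi : forall k, tpower E k -> A) k (v : 'I_k -> E) :
  phi k (tens v) = phi _ (tlist (vlist v)).
Proof. by apply: tens_transport => [|i]; rewrite ?size_vlist ?nth_vlist. Qed.

Lemma tprod_vlist (A : Type) (phi : forall k, tpower E k -> A) p q
    (v : 'I_p -> E) (w : 'I_q -> E) :
  phi _ (tprod (tens v) (tens w)) = phi _ (tlist (vlist v ++ vlist w)).
Proof.
have -> : tprod (tens v) (tens w) =
    tens (fun i : 'I_(p + q) => nth 0 (vlist v ++ vlist w) i).
  apply/ffunP => I; rewrite !ffunE big_split_ord /=; congr (_ * _).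
    apply: eq_bigr => i _; rewrite ffunE nth_cat size_vlist ltn_ord.
    by rewrite (nth_vlist v i).
  apply: eq_bigr => i _; rewrite ffunE nth_cat size_vlist ltnNge leq_addr /=.
  by rewrite addKn (nth_vlist w i).
by apply: tens_transport => //; rewrite size_cat !size_vlist.
Qed.

Lemma vlist_cst k (u : E) : vlist (fun _ : 'I_k => u) = nseq k u.
Proof.
apply: (@eq_from_nth _ 0); rewrite size_vlist ?size_nseq // => i ik.
by rewrite (nth_vlist _ (Ordinal ik)) nth_nseq ik.
Qed.

Lemma tens_rcons_linear ws (a : R) (u v : E) (k := (size ws).+1) :
  tens (fun i : 'I_k => nth 0 (rcons ws (a *: u + v)) i) =
  a *: tens (fun i : 'I_k => nth 0 (rcons ws u) i) + tens (fun i : 'I_k => nth 0 (rcons ws v) i).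
Proof.
apply/ffunP => I; rewrite !ffunE !big_ord_recr /=.
have Eq w : \prod_(i < size ws) coord (vbasis {:E}) (I (widen_ord (leqnSn (size ws)) i))
    (nth 0 (rcons ws w) i) =
  \prod_(i < size ws) coord (vbasis {:E}) (I (widen_ord (leqnSn (size ws)) i)) (nth 0 ws i).
  by apply: eq_bigr => i _; rewrite nth_rcons ltn_ord.
rewrite !Eq !nth_rcons ltnn eqxx linearP /=.
by rewrite mulrDr mulrCA.
Qed.

Section Multilinear.
Variable N : forall k, tpower E k -> R.
Hypothesis hN : tensor_norms N.

Lemma base_norm_is_norm : is_norm (base_norm N).
Proof.
have [hn _ _] := hN; have [n0 nD nZ] := hn 1%N.
have tvecP (a : R) u v : tvec (a *: u + v) = a *: tvec u + tvec v :> tpower E 1.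
  by apply/ffunP => I; rewrite !ffunE !big_ord1 linearP.
split => [x /n0 Ex|x y|a x]; rewrite /base_norm.
- apply/eqP; rewrite (coord_vbasis (memvf x)); apply/eqP.
  apply: big1 => i _; move/ffunP/(_ [ffun=> i]) : Ex; rewrite !ffunE big_ord1 ffunE => ->.
  by rewrite scale0r.
- by have := tvecP 1 x y; rewrite !scale1r => ->; exact: nD.
- have := tvecP a x 0; rewrite addr0 => ->.
  have -> : tvec 0 = 0 :> tpower E 1.
    by apply/ffunP => I; rewrite !ffunE big_ord1 linear0.
  by rewrite addr0 nZ.
Qed.

(** Appending one vector at a time gives the product. That the empty tensor has norm 1 follows from
    the same rule: appending a nonzero vector [w0] to it gives N(1) N(w0) = N(w0), and N(w0)
    cancels. *)
Lemma norm_tlist ws : (exists w : E, w != 0) ->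
  N (tlist ws) = \prod_(w <- ws) base_norm N w.
Proof.
move=> [w0 w0n]; have [hn hM _] := hN.
have bn := base_norm_is_norm.
have vw w : vlist (fun _ : 'I_1 => w) = [:: w] by rewrite vlist_cst.
have step us w : N (tlist (rcons us w)) = N (tlist us) * base_norm N w.
  rewrite /base_norm -hM /tlist /tvec.
  have -> : N (tprod (tens (fun i : 'I_(size us) => us`_i)) (tens (fun _ : 'I_1 => w))) =
     N (tlist (us ++ [:: w])).
    by rewrite (tprod_vlist N) vw vlist_nth.
  by rewrite cats1.
elim/last_ind: ws => [|ws w IH]; last by rewrite step IH -cats1 big_cat big_seq1.
rewrite big_nil.
have b0 : base_norm N w0 != 0 by apply: contra w0n => /eqP /(let: And3 h _ _ := bn in h) ->.
apply: (mulIf b0); rewrite mul1r -step /=.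
by rewrite /base_norm /tlist /tvec; congr (N _); apply: eq_tens => i; rewrite (ord1 i).
Qed.

End Multilinear.

Section JetLists.
Variables (F : vectType R) (f : jet E F).

Definition jetl (ws : seq E) (x : E) : F := f (size ws) x (tlist ws).

Lemma jet_tens k (v : 'I_k -> E) x : f k x (tens v) = jetl (vlist v) x.
Proof. exact: (tens_vlist (fun k t => f k x t)). Qed.

Lemma jet_tprod k (v : 'I_k -> E) u i x :
  f (k + i)%N x (tprod (tens v) (tpow u i)) = jetl (vlist v ++ nseq i u) x.
Proof. by rewrite (tprod_vlist (fun k t => f k x t)) vlist_cst. Qed.

Lemma jet_base_nil x : jet_base f x = jetl [::] x.
Proof. by rewrite /jet_base /tone jet_tens; congr (jetl _ _); rewrite /vlist enum_ord0. Qed.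

Lemma remainder_list n k (v : 'I_k -> E) x y :
  remainder n f x y (tens v) = jetl (vlist v) x -
    \sum_(i < (n - k).+1) i`!%:R^-1 *: jetl (vlist v ++ nseq i (x - y)) y.
Proof.
rewrite /remainder jet_tens; congr (_ - _); apply: eq_bigr => i _.
by rewrite jet_tprod.
Qed.

Lemma jetl_rcons_linear ws x (a : R) u v :
  jetl (rcons ws (a *: u + v)) x = a *: jetl (rcons ws u) x + jetl (rcons ws v) x.
Proof.
have H w : jetl (rcons ws w) x =
    f (size ws).+1 x (tens (fun i : 'I_(size ws).+1 => nth 0 (rcons ws w) i)).
  rewrite /jetl; apply/esym.
  by apply: (tens_transport (fun k t => f k x t)); rewrite ?size_rcons.
by rewrite !H tens_rcons_linear linearP.
Qed.

End JetLists.

Lemma big_ffunS k (J : finType) (G : {ffun 'I_k.+1 -> J} -> R) :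
  \sum_I G I = \sum_j \sum_(I : {ffun 'I_k -> J})
    G [ffun i => if unlift ord0 i is Some i' then I i' else j].
Proof.
rewrite pair_big /=.
pose h (p : J * {ffun 'I_k -> J}) : {ffun 'I_k.+1 -> J} :=
  [ffun i => if unlift ord0 i is Some i' then p.2 i' else p.1].
rewrite (reindex h) //.
pose h' (I : {ffun 'I_k.+1 -> J}) : J * {ffun 'I_k -> J} :=
  (I ord0, [ffun i => I (lift ord0 i)]).
apply: onW_bij; exists h'.
  move=> [j I]; rewrite /h' /h /=; congr (_, _); first by rewrite ffunE unlift_none.
  by apply/ffunP => i; rewrite !ffunE liftK.
move=> I; apply/ffunP => i; rewrite /h /h' ffunE /=.
by case: unliftP => [i' ->|->]; rewrite ?ffunE.
Qed.

Definition elist k (I : {ffun 'I_k -> 'I_(\dim {:E})}) : seq E :=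
  vlist (fun i => (vbasis {:E})`_(I i)).

(** Linearity in the last slot is enough, since symmetry brings every slot there. The lemma makes a
    linear map defined through its values on basis tensors agree with [mu] on all elementary
    tensors. *)
Lemma symmetric_multilinear_expand k (mu : seq E -> R) ws :
  size ws = k ->
  (forall s a u v, (size s).+1 = k ->
     mu (rcons s (a *: u + v)) = a * mu (rcons s u) + mu (rcons s v)) ->
  (forall s s', size s = k -> perm_eq s s' -> mu s = mu s') ->
  mu ws = \sum_(I : {ffun 'I_k -> 'I_(\dim {:E})})
    (\prod_(i < k) coord (vbasis {:E}) (I i) (nth 0 ws i)) * mu (elist I).
Proof.
elim: k mu ws => [|k IH] mu ws sws lmu pmu.
  rewrite (size0nil sws) (big_pred1 [ffun i => (widen_ord (leq0n _) i)]); last first.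
    by move=> I; apply/esym/eqP/ffunP => -[].
  by rewrite big_ord0 mul1r /elist /vlist enum_ord0.
case: ws sws => [//|w ws] [sws].
have lsum s (r : 'I_(\dim {:E}) -> R) (b : 'I_(\dim {:E}) -> E) : size s = k ->
    mu (rcons s (\sum_j r j *: b j)) = \sum_j r j * mu (rcons s (b j)).
  move=> ss.
  have mu0 : mu (rcons s 0) = 0.
    have := lmu s 1 0 0; rewrite ss scaler0 addr0 mul1r => /(_ erefl) => h; lra.
  have : forall t : seq 'I_(\dim {:E}),
    mu (rcons s (\sum_(j <- t) r j *: b j)) = \sum_(j <- t) r j * mu (rcons s (b j)).
    elim=> [|j t IHt]; first by rewrite !big_nil.
    by rewrite !big_cons lmu ?ss // IHt.
  exact.
have rot1 s u : size s = k -> mu (rcons s u) = mu (u :: s).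
  by move=> ss; apply: pmu; rewrite ?size_rcons ?ss // perm_rcons.
rewrite -rot1 // {1}(coord_vbasis (memvf w)) lsum // big_ffunS.
apply: eq_bigr => j _; rewrite rot1 //.
rewrite (IH (fun s => mu ((vbasis {:E})`_j :: s))) //; first last.
- by move=> s s' ss ps; apply: pmu; rewrite /= ?ss // perm_cons.
- move=> s a u v ss; rewrite -!rcons_cons; apply: lmu.
  by rewrite /= ss.
rewrite mulr_sumr; apply: eq_bigr => I _.
rewrite big_ord_recl /= ffunE unlift_none -mulrA; congr (_ * (_ * _)).
  by apply: eq_bigr => i _; rewrite ffunE liftK.
congr mu; rewrite /elist /vlist enum_ordSl /= ffunE unlift_none; congr (_ :: _).
rewrite -map_comp; apply: eq_map => i /=.
by rewrite ffunE liftK.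
Qed.

End TensorLists.

(** * Equivalence of norms in finite dimension *)

Section NormEquivalence.
Variable R : realType.

Section IsNorm.
Variables (E : lmodType R) (N : E -> R).
Hypothesis hN : is_norm N.

Lemma is_norm0 : N 0 = 0.
Proof. by have [_ _ nZ] := hN; have := nZ 0 0; rewrite scale0r normr0 mul0r. Qed.

Lemma is_norm_ge0 x : 0 <= N x.
Proof.
have [_ nD nZ] := hN; have := nD x (- 1 *: x).
rewrite nZ normrN1 mul1r scaleN1r subrr is_norm0; lra.
Qed.

Lemma is_norm_sum (L : finType) (x : L -> E) : N (\sum_l x l) <= \sum_l N (x l).
Proof.
have [_ nD _] := hN.
elim/big_ind2 : _ => //; first by rewrite is_norm0.
by move=> u a v c ua vc; apply: le_trans (nD _ _) _; exact: lerD.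
Qed.

Lemma is_norm_dist x y : `|N x - N y| <= N (x - y).
Proof.
have [_ nD nZ] := hN.
have := nD (x - y) y; rewrite subrK => h1.
have := nD (y - x) x; rewrite subrK => h2.
have E1 : N (y - x) = N (x - y).
  by have := nZ (- 1) (x - y); rewrite normrN1 mul1r scaleN1r opprB.
rewrite E1 in h2; rewrite ler_norml; apply/andP; split; lra.
Qed.

End IsNorm.

Lemma normr_is_norm (V : normedModType R) : is_norm (fun x : V => `|x|).
Proof. by split => [x /normr0_eq0|x y|a x] //; [exact: ler_normD|exact: normrZ]. Qed.

(** In coordinates, [N1] is at most a multiple of the sup norm, and [N2] has a positive minimum on
    the compact unit sphere. *)
Lemma norm_le_norm (E : vectType R) (N1 N2 : E -> R) : is_norm N1 -> is_norm N2 ->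
  exists2 C, 0 <= C & forall x, N1 x <= C * N2 x.
Proof.
move=> h1 h2.
pose k := \dim {:E}.
pose e (i : 'I_k) : E := (vbasis {:E})`_i.
pose phi (r : 'rV[R]_k) : E := \sum_i r 0 i *: e i.
have phiB r s : phi r - phi s = phi (r - s).
  rewrite /phi -sumrB; apply: eq_bigr => i _.
  by rewrite -scalerBl !mxE.
have bound (N : E -> R) : is_norm N -> forall r, N (phi r) <= (\sum_i N (e i)) * `|r|.
  move=> hN r; apply: le_trans (is_norm_sum hN _) _.
  rewrite mulr_suml; apply: ler_sum => i _; have [_ _ ->] := hN.
  by rewrite mulrC ler_wpM2l ?is_norm_ge0 // row_coord_le.
have S1 : 0 <= \sum_i N1 (e i) by apply: sumr_ge0 => i _; exact: is_norm_ge0.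
have S2 : 0 <= \sum_i N2 (e i) by apply: sumr_ge0 => i _; exact: is_norm_ge0.
have phiK x : x = phi (\row_i coord (vbasis {:E}) i x).
  by rewrite {1}(coord_vbasis (memvf x)); apply: eq_bigr => i _; rewrite mxE.
have phi_eq0 r : phi r = 0 -> r = 0.
  move=> r0; apply/rowP => i; rewrite mxE.
  by have /freeP/(_ (fun i => r 0 i) r0) := basis_free (vbasisP {:E}); exact.
have cN : continuous (fun r => N2 (phi r)).
  move=> r; apply/(@cvgrPdist_le _ _ _ (nbhs r)) => eta eta0.
  have d0 : 0 < eta / (\sum_i N2 (e i) + 1) by rewrite divr_gt0 // ltr_wpDl.
  near=> s.
  apply: le_trans (is_norm_dist h2 _ _) _; rewrite phiB.
  apply: le_trans (bound _ h2 _) _.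
  have rs : `|r - s| <= eta / (\sum_i N2 (e i) + 1) by near: s; exact: cvgr_dist_le.
  apply: le_trans (ler_wpM2l S2 rs) _.
  by rewrite mulrA ler_pdivrMr ?ltr_wpDl // mulrC ler_pM2l // lerDl.
pose S := [set r : 'rV[R]_k | `|r| = 1].
(* An empty sphere means that the space is zero, where the constant 0 will do. *)
have [[r0 Sr0]|S0] := pselect (S !=set0); last first.
  exists 0 => // x; rewrite mul0r (phiK x); set r := \row_i _.
  have [->|r0] := eqVneq r 0.
    rewrite (_ : phi 0 = 0) ?is_norm0 // /phi big1 // => i _.
    by rewrite mxE scale0r.
  exfalso; apply: S0; exists (`|r|^-1 *: r).
  by rewrite /S /= normrZ normfV normr_id mulVf // normr_eq0.
have cS : compact S.
  apply: bounded_closed_compact.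
    by exists 1; split => // M M1 r; rewrite /S /= => ->; exact: ltW.
  rewrite (_ : S = (fun r => `|r|) @^-1` [set x | x = 1]) //.
  apply: closed_comp; last exact: closed_eq.
  by move=> r _; exact: norm_continuous.
have [|c cS' minc] := EVT_min_rV (ex_intro _ r0 Sr0) cS (f := fun r => N2 (phi r)).
  by apply: continuous_subspaceT.
rewrite inE in cS'.
have cpos : 0 < N2 (phi c).
  rewrite lt_def is_norm_ge0 // andbT; apply/eqP => N0.
  have [h _ _] := h2; have c0 := phi_eq0 _ (h _ N0).
  by move: cS'; rewrite /S /= c0 normr0 => /eqP; rewrite eq_sym oner_eq0.
have low r : N2 (phi c) * `|r| <= N2 (phi r).
  have [->|rn0] := eqVneq r 0; first by rewrite normr0 mulr0 is_norm_ge0.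
  have rn : 0 < `|r| by rewrite normr_gt0.
  have : N2 (phi c) <= N2 (phi (`|r|^-1 *: r)).
    by apply: minc; rewrite inE /S /= normrZ normfV normr_id mulVf // gt_eqF.
  have -> : phi (`|r|^-1 *: r) = `|r|^-1 *: phi r.
    by rewrite /phi scaler_sumr; apply: eq_bigr => i _; rewrite mxE scalerA.
  have [_ _ ->] := h2; rewrite normfV normr_id => h.
  by rewrite -ler_pdivlMr // mulrC.
exists (\sum_i N1 (e i) / N2 (phi c)); first by rewrite -mulr_suml divr_ge0 // ltW.
move=> x; rewrite (phiK x); set r := \row_i _.
apply: le_trans (bound _ h1 r) _; rewrite -mulr_suml -mulrA ler_wpM2l //.
by rewrite mulrC ler_pdivlMr // mulrC low.
Unshelve. all: by end_near. Qed.

Lemma coord_sum_is_norm (E : vectType R) :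
  is_norm (fun x : E => \sum_i `|coord (vbasis {:E}) i x|).
Proof.
split => [x x0|x y|a x].
- rewrite (coord_vbasis (memvf x)); apply: big1 => i _.
  have /eqP := x0; rewrite psumr_eq0 // => /allP /(_ i (mem_index_enum i)).
  by rewrite normr_eq0 => /eqP ->; rewrite scale0r.
- by rewrite -big_split /=; apply: ler_sum => i _; rewrite linearD ler_normD.
- by rewrite mulr_sumr; apply: eq_bigr => i _; rewrite linearZ normrM.
Qed.

Lemma linfun_linear (E F : vectType R) (g : E -> F) :
  (forall a u v, g (a *: u + v) = a *: g u + g v) -> linfun g =1 g.
Proof.
move=> lg x.
pose gl : {linear E -> F} := HB.pack g (GRing.isLinear.Build R E F *:%R g lg).
exact: (lfunE gl x).
Qed.

(** Rank-one maps: as [y] runs over a basis of F and [j] over the indices, they form the basis in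
    which dG is expanded. *)
Definition coord_hom (E F : vectType R) (y : F) (j : 'I_(\dim {:E})) : 'Hom(E, F) :=
  linfun (fun u : E => coord (vbasis {:E}) j u *: y).

Lemma coord_homE (E F : vectType R) (y : F) (j : 'I_(\dim {:E})) u :
  coord_hom y j u = coord (vbasis {:E}) j u *: y.
Proof.
by rewrite linfun_linear // => a v w; rewrite linearP /= scalerDl scalerA.
Qed.

Lemma opnorm_coord_bound (E F : vectType R) (NE : E -> R) (NF : F -> R) (L : finType)
    (y : L -> F) : is_norm NE -> is_norm NF -> exists2 C, 0 <= C &
  forall (r : L * 'I_(\dim {:E}) -> R) M, (forall l, `|r l| <= M) ->
    opnorm NE NF (\sum_l r l *: coord_hom (y l.1) l.2) <= C * M.
Proof.
move=> hE hF; have [c c0 hc] := norm_le_norm (coord_sum_is_norm E) hE.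
exists (\sum_(l : L * 'I_(\dim {:E})) c * NF (y l.1)).
  by apply: sumr_ge0 => l _; rewrite mulr_ge0 // is_norm_ge0.
move=> r M rM; apply: ge_sup.
  by exists (NF ((\sum_l r l *: coord_hom (y l.1) l.2) 0)), 0 => //=; rewrite is_norm0.
move=> _ [v /= v1 <-]; rewrite sum_lfunE.
apply: le_trans (is_norm_sum hF _) _; rewrite mulr_suml; apply: ler_sum => l _.
rewrite scale_lfunE coord_homE; have [_ _ nZ] := hF; rewrite !nZ.
have y0 := is_norm_ge0 hF (y l.1).
have cv : `|coord (vbasis {:E}) l.2 v| <= c.
  apply: le_trans (le_trans (hc v) _); last by rewrite ler_piMr.
  by rewrite (bigD1 l.2) //= lerDl sumr_ge0.
rewrite [leRHS]mulrC; apply: ler_pM => //; first exact: mulr_ge0.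
by rewrite ler_wpM2r.
Qed.

End NormEquivalence.

(** * From smooth coordinates to Lip jets *)

Section SmoothJet.
Variables (R : realType) (eps : R).
Hypotheses (eps_gt0 : 0 < eps) (eps_le1 : eps <= 1).
Variable d : nat.
Local Notation P := (R * 'rV[R]_d)%type.
Variable NP : forall k, tpower P k -> R.
Hypothesis hNP : tensor_norms NP.
Variables (F : vectType R) (NF : F -> R) (L : finType) (b : L -> F) (cF cP : R).
Hypotheses (cF_ge0 : 0 <= cF) (cP_ge1 : 1 <= cP).
Hypothesis cP_le : forall p : P, `|p| <= cP * base_norm NP p.
Hypothesis cF_le : forall (r : L -> R) M, (forall l, `|r l| <= M) ->
  NF (\sum_l r l *: b l) <= cF * M.

Lemma norm_prod_vlist k (v : 'I_k -> P) :
  \prod_(w <- vlist v) `|w| <= cP ^+ k * NP (tens v).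
Proof.
have cP0 : 0 <= cP := le_trans ler01 cP_ge1.
have bn := base_norm_is_norm hNP.
rewrite (tens_vlist NP) norm_tlist //; last first.
  by exists (1, 0); apply/eqP => -[/eqP]; rewrite oner_eq0.
rewrite -[X in cP ^+ X](size_vlist v).
elim: (vlist v) => [|w ws IH] /=; first by rewrite !big_nil expr0 mul1r.
rewrite !big_cons exprS mulrACA ler_pM //.
elim: ws {IH} => [|z ws IH]; rewrite ?big_nil ?big_cons //.
exact: mulr_ge0.
Qed.

(** In degree k the jet contracts a tensor with the derivatives of each [c l] along lists of basis
    vectors; by multilinearity and Schwarz's theorem it takes the value [dirs (c l) ws] on every
    elementary tensor. The remainders are then Taylor remainders of these derivatives on the segment
    from y to x, which stays in [D]. In the constant, [2 * K] comes from Taylor's formula, [cP ^+ m]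
    from the norms of the k <= m tensor factors, [cP ^+ m.+1] from the power of |x - y|, whose
    exponent is at most m + 1, and [cF] from the norm of F. *)
Lemma smooth_lip_jet m K (D : set P) (c : L -> P -> R) : 0 <= K -> open D ->
  (forall x y, D x -> D y -> forall s, 0 <= s <= 1 -> D (y + s *: (x - y))) ->
  (forall l, smooth eps D m K (c l)) ->
  exists f : jet P F,
    [/\ forall p, D p -> jet_base f p = \sum_l c l p *: b l,
        forall k x, (k <= m)%N -> D x -> symmetric_map (f k x)
      & lip_bound NP NF m eps D f (cF * (2 * K * cP ^+ m * cP ^+ m.+1))].
Proof.
move=> K0 oD cD sc.
have cP0 : 0 <= cP := le_trans ler01 cP_ge1.
pose f : jet P F := fun k p => linfun (fun a : tpower P k =>
  \sum_l (\sum_I a I * dirs (c l) (elist I) p) *: b l).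
have fE k p (a : tpower P k) : f k p a =
    \sum_l (\sum_I a I * dirs (c l) (elist I) p) *: b l.
  rewrite /f linfun_linear // => {}a u v.
  rewrite scaler_sumr -big_split /=; apply: eq_bigr => l _.
  rewrite scalerA -scalerDl mulr_sumr -big_split /=; congr (_ *: _).
  by apply: eq_bigr => I _; rewrite !ffunE mulrDl mulrA.
have fL ws p : (size ws <= m)%N -> D p -> jetl f ws p = \sum_l dirs (c l) ws p *: b l.
  move=> wsm Dp; rewrite /jetl fE; apply: eq_bigr => l _; congr (_ *: _).
  rewrite (@symmetric_multilinear_expand R _ (size ws) (fun s => dirs (c l) s p) ws erefl).
  - by apply: eq_bigr => I _; rewrite ffunE.
  - move=> s a u v ss; rewrite !dirs_rcons.
    have ss' : (size s < m)%N by rewrite ss.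
    have sd := smooth_dirs eps_gt0 oD (sc l) (ltnW ss').
    rewrite -(subnSK ss') in sd.
    exact: (derive_real_linear eps_gt0 oD sd Dp).
  - move=> s s' ss ps; apply: (dirs_perm eps_gt0 eps_le1 oD (sc l) _ ps Dp).
    by rewrite ss.
have fV k (v : 'I_k -> P) p : (k <= m)%N -> D p ->
    f k p (tens v) = \sum_l dirs (c l) (vlist v) p *: b l.
  by move=> km Dp; rewrite jet_tens fL // size_vlist.
have prodK l k (v : 'I_k -> P) p : (k <= m)%N -> D p ->
    `|dirs (c l) (vlist v) p| <= K * (cP ^+ k * NP (tens v)).
  move=> km Dp; apply: le_trans (smooth_dirs_bounded eps_gt0 oD (sc l) _ Dp) _.
    by rewrite size_vlist.
  by rewrite ler_wpM2l // norm_prod_vlist.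
have NPv k (v : 'I_k -> P) : 0 <= NP (tens v) by have [hn _ _] := hNP; exact: is_norm_ge0.
have cPk k : (k <= m)%N -> cP ^+ k <= cP ^+ m by move=> km; rewrite ler_weXn2l.
have cPm : 1 <= cP ^+ m.+1 by rewrite exprn_ege1.
have cPm0 : 0 <= cP ^+ m by rewrite exprn_ge0.
exists f; split.
- by move=> p Dp; rewrite jet_base_nil fL.
- move=> k x km Dx s v; rewrite !fV //; apply: eq_bigr => l _; congr (_ *: _).
  apply: (dirs_perm eps_gt0 eps_le1 oD (sc l) _ _ Dx); first by rewrite size_vlist.
  rewrite /vlist (_ : [seq v (s i) | i <- _] = map v [seq s i | i <- enum 'I_k]); last first.
    exact: (map_comp v (fun i => s i)).
  apply: seq.perm_map; apply: uniq_perm.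
  + by rewrite map_inj_uniq ?enum_uniq //; exact: perm_inj.
  + exact: enum_uniq.
  + move=> i; rewrite mem_enum; apply/mapP; exists ((s^-1)%g i); rewrite ?mem_enum //.
    by rewrite permKV.
- split; first by rewrite !mulr_ge0 // exprn_ge0.
  move=> k km x y Dx Dy v; split.
    rewrite fV //; apply: le_trans (cF_le (fun l => prodK l k v x km Dx)) _.
    rewrite -!mulrA ler_wpM2l //.
    have h := ler_wpM2r (NPv k v) (cPk k km).
    have h2 : cP ^+ m * NP (tens v) <= cP ^+ m * (cP ^+ m.+1 * NP (tens v)).
      by rewrite ler_wpM2l // ler_peMl.
    have h3 := ler_wpM2l K0 (le_trans h h2).
    have h0 : 0 <= K * (cP ^+ k * NP (tens v)) by rewrite mulr_ge0 // mulr_ge0 // exprn_ge0.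
    lra.
  rewrite remainder_list fL ?size_vlist //.
  have -> : \sum_l dirs (c l) (vlist v) x *: b l -
      \sum_(i < (m - k).+1) i`!%:R^-1 *: jetl f (vlist v ++ nseq i (x - y)) y =
    \sum_l (dirs (c l) (vlist v) x -
      \sum_(i < (m - k).+1) i`!%:R^-1 * dirs (dirs (c l) (vlist v)) (nseq i (x - y)) y) *: b l.
    under [X in _ - X]eq_bigr => i _.
      rewrite fL //; last first.
        by rewrite size_cat size_vlist size_nseq -leq_subRL // -ltnS.
      rewrite scaler_sumr; over.
    rewrite exchange_big /= -sumrB; apply: eq_bigr => l _.
    rewrite scalerBl scaler_suml; congr (_ - _); apply: eq_bigr => i _.
    by rewrite scalerA dirs_cat.
  set M := 2 * (K * (cP ^+ k * NP (tens v))) * (`|x - y| `^ (m%:R + eps - k%:R)).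
  have hM l : `|dirs (c l) (vlist v) x -
      \sum_(i < (m - k).+1) i`!%:R^-1 * dirs (dirs (c l) (vlist v)) (nseq i (x - y)) y| <= M.
    have sd := smooth_dirs eps_gt0 oD (sc l) (_ : size (vlist v) <= m)%N.
    rewrite size_vlist in sd; have {}sd := sd km.
    have ray s : 0 <= s <= 1 -> D (y + s *: (x - y)) by exact: cD.
    have h1 : 0 <= (1 : R) <= 1 by rewrite ler01 lexx.
    have := taylor_ray eps_gt0 oD sd ray h1; rewrite scale1r subrKC => hray.
    rewrite (eq_bigr (fun i : 'I_(m - k).+1 =>
      i`!%:R^-1 * dirs (dirs (c l) (vlist v)) (nseq i (x - y)) y)) in hray; last first.
      by move=> i _; rewrite expr1n mul1r.
    apply: le_trans hray _; rewrite /M natrB // [m%:R + eps - _]addrAC ler_wpM2r ?powR_ge0 //.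
    by rewrite ler_pM2l // ler_wpM2l // norm_prod_vlist.
  apply: le_trans (cF_le hM) _; rewrite /M.
  have bn0 := is_norm_ge0 (base_norm_is_norm hNP) (x - y).
  have ex0 : 0 <= m%:R + eps - k%:R.
    by rewrite addrAC -natrB // addr_ge0 // ltW.
  have h1 : `|x - y| `^ (m%:R + eps - k%:R) <=
      cP ^+ m.+1 * base_norm NP (x - y) `^ (m%:R + eps - k%:R).
    apply: le_trans (ler_powR2 ex0 (normr_ge0 _) (cP_le _)) _.
    rewrite powRM // ler_wpM2r ?powR_ge0 // -powR_mulrn // ler_powR //.
    by rewrite -natr1 lerBlDr -addrA lerD2l (le_trans eps_le1) // lerDl.
  have h2 := ler_wpM2r (NPv k v) (cPk k km).
  rewrite -!mulrA ler_wpM2l // ler_wpM2l // ler_wpM2l //.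
  rewrite [leRHS]mulrA.
  have -> : cP ^+ m * cP ^+ m.+1 * (base_norm NP (x - y) `^ (m%:R + eps - k%:R) * NP (tens v)) =
    (cP ^+ m * NP (tens v)) * (cP ^+ m.+1 * base_norm NP (x - y) `^ (m%:R + eps - k%:R)).
    by ring.
  by rewrite mulrA ler_pM ?powR_ge0 // mulr_ge0 // exprn_ge0.
Qed.

End SmoothJet.

(** * Frechet derivatives from first-order expansions *)

Section FrechetDerivative.
Variable R : realType.

Lemma differentiable_approx (V W : normedModType R) (f df : V -> W) (p : V) (K : R) :
  (forall a u v, df (a *: u + v) = a *: df u + df v) ->
  (forall u, `|df u| <= K * `|u|) ->
  (forall eta, 0 < eta -> \forall h \near (0 : V), `|f (h + p) - f p - df h| <= eta * `|h|) ->
  differentiable f p /\ 'd f p =1 df.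
Proof.
move=> ldf bdf adf.
pose g : {linear V -> W} := HB.pack df (GRing.isLinear.Build R V W *:%R df ldf).
have cg : continuous g.
  apply: bounded_linear_continuous; apply/linear_boundedP.
  exists K; split; first exact: num_real.
  by move=> r Kr x; apply: le_trans (bdf x) _; rewrite ler_wpM2r // ltW.
have og : f \o shift p = cst (f p) + g +o_ 0 id.
  apply/eqaddoP => eta eta0; apply: filterS (adf _ eta0) => h.
  by rewrite /= opprD addrA.
have dE := diff_unique cg og.
split; last by move=> u; rewrite dE.
by apply/diff_locallyP; rewrite dE; split.
Qed.

Lemma expands_differentiable (d : nat) (V : normedModType R) (D : set V) eps K
    (G : V -> 'rV[R]_d) (dG : 'I_d -> V -> V -> R) p :
  0 < eps -> eps <= 1 -> 0 <= K -> open D -> D p ->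
  (forall l, smooth_diff eps D 0 K (fun p => G p 0 l) (dG l)) ->
  differentiable G p /\ forall u, 'd G p u = \row_l dG l p u.
Proof.
move=> eps0 eps1 K0 oD Dp sG.
apply: (@differentiable_approx _ _ G (fun u => \row_l dG l p u) p K).
- move=> a u v; apply/rowP => l; rewrite !mxE.
  by have [[lG _] _] := sG l; rewrite lG.
- move=> u; apply: row_norm_le => [|l]; first by rewrite mulr_ge0.
  by rewrite mxE; have [_ /(_ u)/smooth_bounded] := sG l; apply.
move=> eta eta0.
have [de de0 hde] := powR_near0 K0 eps0 eta0.
have evD : \forall h \near (0 : V), D (h + p).
  have : (fun h : V => h + p) @ (0 : V) --> p.
    rewrite -[X in _ --> X](add0r p); apply: cvgD; [exact: cvg_id|exact: cvg_cst].
  by apply; exact: open_nbhs_nbhs.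
near=> h.
have hD : D (h + p) by near: h.
have h1 : `|h| <= 1 by near: h; exact: nbhs0_le.
have h2 : `|h| <= de by near: h; exact: nbhs0_le.
have hp : h + p - p = h by rewrite addrK.
apply: row_norm_le => [|l]; first by rewrite mulr_ge0 // ltW.
rewrite !mxE; have [[_ hG] _] := sG l.
have := hG p _ Dp hD; rewrite hp => /(_ h1) /le_trans; apply.
by rewrite powR_onePlus // mulrCA mulrC ler_wpM2r // hde.
Unshelve. all: by end_near. Qed.

End FrechetDerivative.

(** * From Lip jets to coordinates in the sup norm *)

Section LipToJet.
Variables (R : realType) (n d : nat).
Hypotheses (n_gt0 : (0 < n)%N) (d_gt0 : (0 < d)%N).
Local Notation Y := 'rV[R]_d.
Variable NX : forall k, tpower Y k -> R.
Hypothesis hNX : tensor_norms NX.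

Definition row_jet (H : jet Y Y) (l : 'I_d) (s : seq 'I_d) (x : Y) : R :=
  jetl H [seq delta_mx 0 j | j <- s] x 0 l.

Variables (cX : R).
Hypotheses (cX_ge1 : 1 <= cX).
Hypothesis le_base : forall x : Y, `|x| <= cX * base_norm NX x.
Hypothesis base_le : forall x : Y, base_norm NX x <= cX * `|x|.

Lemma norm_delta_le (j : 'I_d) : `|delta_mx 0 j : Y| <= 1.
Proof.
apply: row_norm_le => // l; rewrite mxE /=.
by case: eqP => _; rewrite ?normr0 ?normr1.
Qed.

Lemma norm_tlist_le ws : NX (tlist ws) <= cX ^+ size ws * \prod_(w <- ws) `|w|.
Proof.
have cX0 : 0 <= cX := le_trans ler01 cX_ge1.
have bn := base_norm_is_norm hNX.
rewrite norm_tlist //; last first.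
  exists (const_mx 1); apply/eqP => /rowP /(_ (Ordinal d_gt0)); rewrite !mxE => /eqP.
  by rewrite oner_eq0.
elim: ws => [|w ws IH] /=; first by rewrite !big_nil expr0 mul1r.
rewrite !big_cons exprS mulrACA ler_pM ?is_norm_ge0 //.
elim: ws {IH} => [|z ws IH]; rewrite ?big_nil ?big_cons //.
by rewrite mulr_ge0 ?is_norm_ge0.
Qed.

Section Bounds.
Variables (eps M : R) (V : set Y) (H : jet Y Y).
Hypotheses (eps_gt0 : 0 < eps) (eps_le1 : eps <= 1).
Hypothesis lipH : lip_bound NX (base_norm NX) n eps V H M.

Let M_ge0 : 0 <= M. Proof. by case: lipH. Qed.
Let cX_ge0 : 0 <= cX. Proof. exact: le_trans ler01 cX_ge1. Qed.

Lemma prod_norm_ge0 (ws : seq Y) : 0 <= \prod_(w <- ws) `|w|.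
Proof. by elim/big_ind : _ => // x y; exact: mulr_ge0. Qed.

Lemma jetl_le ws x : (size ws <= n)%N -> V x ->
  `|jetl H ws x| <= cX * M * cX ^+ n * \prod_(w <- ws) `|w|.
Proof.
move=> wn Vx; have [_ /(_ _ wn x x Vx Vx (fun i => nth 0 ws i)) [h _]] := lipH.
rewrite jet_tens vlist_nth // (tens_vlist NX) vlist_nth // in h.
apply: le_trans (le_base _) _; rewrite -!mulrA ler_wpM2l //.
apply: le_trans h _; rewrite ler_wpM2l //; apply: le_trans (norm_tlist_le _) _.
by rewrite ler_wpM2r ?prod_norm_ge0 // ler_weXn2l.
Qed.

Lemma jetl_remainder_le ws x y : (size ws <= n)%N -> V x -> V y ->
  `|jetl H ws x - \sum_(i < (n - size ws).+1) i`!%:R^-1 *: jetl H (ws ++ nseq i (x - y)) y|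
  <= cX * M * cX ^+ n.+1 * cX ^+ n * `|x - y| `^ (n%:R + eps - (size ws)%:R) *
     \prod_(w <- ws) `|w|.
Proof.
move=> wn Vx Vy; have [_ /(_ _ wn x y Vx Vy (fun i => nth 0 ws i)) [_ h]] := lipH.
rewrite remainder_list vlist_nth // (tens_vlist NX) vlist_nth // in h.
apply: le_trans (le_base _) _.
have ex0 : 0 <= n%:R + eps - (size ws)%:R.
  by rewrite addrAC -natrB // addr_ge0 // ltW.
have b0 := is_norm_ge0 (base_norm_is_norm hNX) (x - y).
(* The exponent lies between 0 and n + 1 and 1 <= [cX], so the power of [cX] caused by the change of
   norm is at most [cX ^+ n.+1]. *)
have h1 : base_norm NX (x - y) `^ (n%:R + eps - (size ws)%:R) <=
    cX ^+ n.+1 * `|x - y| `^ (n%:R + eps - (size ws)%:R).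
  apply: le_trans (ler_powR2 ex0 b0 (base_le _)) _.
  rewrite powRM // ler_wpM2r ?powR_ge0 // -powR_mulrn // ler_powR //.
  by rewrite -natr1 lerBlDr -addrA lerD2l (le_trans eps_le1) // lerDl.
have h2 : NX (tlist ws) <= cX ^+ n * \prod_(w <- ws) `|w|.
  apply: le_trans (norm_tlist_le _) _.
  by rewrite ler_wpM2r ?prod_norm_ge0 // ler_weXn2l.
have N0 : 0 <= NX (tlist ws) by have [hn _ _] := hNX; exact: is_norm_ge0.
have -> : cX * M * cX ^+ n.+1 * cX ^+ n * `|x - y| `^ (n%:R + eps - (size ws)%:R) *
     \prod_(w <- ws) `|w| =
  cX * (M * (cX ^+ n.+1 * `|x - y| `^ (n%:R + eps - (size ws)%:R)) *
    (cX ^+ n * \prod_(w <- ws) `|w|)) by ring.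
rewrite ler_wpM2l //; apply: le_trans h _.
by rewrite ler_pM ?mulr_ge0 ?powR_ge0 // ler_wpM2l.
Qed.

Lemma jetl_rcons_sum ws x (r : 'I_d -> R) (b : 'I_d -> Y) :
  jetl H (rcons ws (\sum_j r j *: b j)) x = \sum_j r j *: jetl H (rcons ws (b j)) x.
Proof.
have H0 : jetl H (rcons ws 0) x = 0.
  have := jetl_rcons_linear H ws x 1 0 0; rewrite scaler0 addr0 scale1r.
  by move/eqP; rewrite -[X in X == _]addr0 (inj_eq (addrI _)) eq_sym => /eqP.
elim: (index_enum _) => [|j t IHt]; first by rewrite !big_nil.
by rewrite !big_cons jetl_rcons_linear IHt.
Qed.

(** [cX * M * cX ^+ n] bounds every entry of the jet. It is counted twice for two values and [d]
    times for a linear term, when the points are far apart, and [n] times for the Taylor terms of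
    degree at least 2, when they are close. The last summand bounds the Lip remainder. *)
Definition jet_const : R :=
  (2 + d%:R + n%:R) * (cX * M * cX ^+ n) + cX * M * cX ^+ n.+1 * cX ^+ n.

Lemma prod_delta_le (s : seq 'I_d) :
  \prod_(w <- [seq (delta_mx 0 j : Y) | j <- s]) `|w| <= 1.
Proof.
rewrite big_map; elim: s => [|j s IH]; first by rewrite big_nil.
rewrite big_cons mulr_ile1 ?norm_delta_le //.
by elim/big_ind : _ => // x y; exact: mulr_ge0.
Qed.

Lemma row_jet_le l s x : (size s <= n)%N -> V x ->
  `|row_jet H l s x| <= cX * M * cX ^+ n.
Proof.
move=> sn Vx; apply: le_trans (row_coord_le _ _) _.
apply: le_trans (jetl_le _ Vx) _; first by rewrite size_map.
by rewrite ler_piMr ?prod_delta_le // !mulr_ge0 // exprn_ge0.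
Qed.

Lemma row_jet_sum l s (u x : Y) :
  jetl H (rcons [seq delta_mx 0 j | j <- s] u) x 0 l =
  \sum_j u 0 j * row_jet H l (rcons s j) x.
Proof.
rewrite {1}(row_sum_delta u) jetl_rcons_sum summxE; apply: eq_bigr => j _.
by rewrite mxE /row_jet map_rcons.
Qed.

Lemma powR_le_exp (r a b : R) : 0 <= r <= 1 -> 0 < a -> a <= b -> r `^ b <= r `^ a.
Proof.
move=> /andP[r0 r1] a0 ab; have [->|rn] := eqVneq r 0.
  by rewrite !powR0 ?gt_eqF // (lt_le_trans a0).
by apply: ger_powR => //; rewrite r1 lt_def rn r0.
Qed.

(** A Lip jet comes with Taylor polynomials up to order n, of which only the part of degree 1 is
    kept. For r <= 1 a term of degree i >= 2 is O(r^2), hence O(r^(1 + eps)); for r > 1 the triangle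
    inequality suffices. *)
Lemma row_jet_jet_on l : jet_on eps n jet_const V (row_jet H l).
Proof.
set B := cX * M * cX ^+ n.
have B0 : 0 <= B by rewrite !mulr_ge0 // exprn_ge0.
set B' := cX * M * cX ^+ n.+1 * cX ^+ n.
have B'0 : 0 <= B' by rewrite !mulr_ge0 // exprn_ge0.
have dB : 0 <= d%:R * B by rewrite mulr_ge0.
have nB : 0 <= n%:R * B by rewrite mulr_ge0.
have KE : jet_const = 2 * B + d%:R * B + n%:R * B + B'.
  by rewrite /jet_const -/B -/B'; ring.
have rest s x y : (size s <= n)%N -> V x -> V y ->
    `|row_jet H l s x - \sum_(i < (n - size s).+1) i`!%:R^-1 *
      jetl H ([seq delta_mx 0 j | j <- s] ++ nseq i (x - y)) y 0 l| <=
    B' * `|x - y| `^ (n%:R + eps - (size s)%:R).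
  move=> sn Vx Vy; set ws := [seq delta_mx 0 j | j <- s].
  have wn : (size ws <= n)%N by rewrite size_map.
  have h := jetl_remainder_le wn Vx Vy.
  have p1 : \prod_(w <- ws) `|w| <= 1 by exact: prod_delta_le.
  rewrite -/B' in h.
  have h0 : 0 <= B' * `|x - y| `^ (n%:R + eps - (size ws)%:R) by rewrite mulr_ge0 ?powR_ge0.
  have {}h := le_trans h (ler_piMr h0 p1).
  rewrite size_map in h; apply: le_trans h; apply: le_trans (row_coord_le _ l).
  rewrite !mxE summxE /row_jet -/ws.
  by under [in X in _ <= X]eq_bigr do rewrite mxE.
split.
- move=> s x sn Vx; apply: le_trans (row_jet_le l sn Vx) _; rewrite KE -/B; lra.
- move=> s x y sn Vx Vy.
  set r := `|x - y|; have r0 : 0 <= r by exact: normr_ge0.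
  have hx := row_jet_le l (ltnW sn) Vx; have hy := row_jet_le l (ltnW sn) Vy.
  rewrite -/B in hx hy.
  have hs : `|\sum_j (x - y) 0 j * row_jet H l (rcons s j) y| <= d%:R * B * r.
    rewrite -mulrA -[d in d%:R]card_ord; apply: norm_sum_le_card => j.
    rewrite normrM mulrC ler_pM ?row_coord_le //.
    by apply: row_jet_le => //; rewrite size_rcons.
  have [r1|r1] := leP r 1; last first.
    have rr : r <= r `^ (1 + eps).
      rewrite -{1}(powRr1 r0); apply: ler_powR; first exact: ltW.
      by rewrite lerDl ltW.
    have q1 := ler_wpM2l dB rr.
    have rp : 1 <= r `^ (1 + eps) by apply: le_trans rr; exact: ltW.
    have q2 := ler_wpM2l B0 rp.
    have P1 : 0 <= n%:R * B * r `^ (1 + eps) by rewrite mulr_ge0 ?powR_ge0.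
    have P2 : 0 <= B' * r `^ (1 + eps) by rewrite mulr_ge0 ?powR_ge0.
    apply: le_trans (ler_normB _ _) _.
    have := ler_normB (row_jet H l s x) (row_jet H l s y).
    rewrite KE; lra.
  have [|q2 q3 q4 q6 q5] := @powR_small _ _ eps_gt0 eps_le1 r; first by rewrite r0.
  have h := rest s x y (ltnW sn) Vx Vy.
  have [q Eq] : exists q, (n - size s)%N = q.+1.
    by exists (n - size s).-1; rewrite prednK // subn_gt0.
  have qn : (q.+1 <= n)%N by rewrite -Eq leq_subr.
  (* The terms of degree 0 and 1 are split off; [Z] gathers those of degree at least 2. *)
  rewrite Eq !big_ord_recl /= !fact0 factS fact0 muln1 invr1 !mul1r cats0 cats1 in h.
  rewrite row_jet_sum -/(row_jet H l s y) in h.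
  set X := row_jet H l s x - _ - _.
  set Z := \sum_(i < q) _ in h.
  have hZ : `|Z| <= n%:R * B * r `^ (1 + eps).
    apply: (@le_trans _ _ (q%:R * (B * r `^ (1 + eps)))).
      rewrite -[q in q%:R]card_ord; apply: norm_sum_le_card => i.
      rewrite normrM normfV normr_nat.
      have f1 : ((bump 0 (bump 0 i))`!%:R)^-1 <= 1 :> R.
        by rewrite invf_le1 ?ltr0n ?fact_gt0 // ler1n fact_gt0.
      apply: (@le_trans _ _ (1 * (B * r ^+ i.+2))).
        apply: ler_pM => //.
        apply: le_trans (row_coord_le _ _) _.
        apply: le_trans (jetl_le _ Vy) _.
          by rewrite size_cat size_map /= size_nseq -leq_subRL ?(ltnW sn) // Eq !ltnS ltn_ord.
        rewrite -/B ler_wpM2l // big_cat /= -[leRHS]mul1r.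
        apply: ler_pM; rewrite ?prod_norm_ge0 ?prod_delta_le //.
        by rewrite !big_cons big_nseq iter_mulr_1 -!exprS lexx.
      rewrite mul1r ler_wpM2l //.
      apply: le_trans q6; rewrite -expr2.
      by rewrite ler_wiXn2l.
    rewrite mulrA ler_wpM2r ?powR_ge0 // ler_wpM2r // ler_nat ltnW //.
  (* As [size s < n], the exponent of the Lip remainder is at least 1 + eps. *)
  have hp : r `^ (n%:R + eps - (size s)%:R) <= r `^ (1 + eps).
    apply: powR_le_exp; rewrite ?r0 //; first by rewrite addr_gt0.
    rewrite [leRHS]addrAC -natrB ?(ltnW sn) // Eq lerD2r ler1n //.
  have q1 := ler_wpM2l B'0 hp.
  have -> : X = (row_jet H l s x - (row_jet H l s y +
     (\sum_j (x - y) 0 j * row_jet H l (rcons s j) y + Z))) + Z by rewrite /X; ring.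
  apply: le_trans (ler_normD _ _) _.
  have P1 : 0 <= B * r `^ (1 + eps) by rewrite mulr_ge0 ?powR_ge0.
  have P2 : 0 <= d%:R * B * r `^ (1 + eps) by rewrite mulr_ge0 ?powR_ge0.
  rewrite KE; lra.
- move=> s x y sn Vx Vy.
  have := rest s x y; rewrite sn leqnn subnn => /(_ isT Vx Vy).
  rewrite big_ord1 fact0 invr1 mul1r cats0 -/(row_jet H l s y) addrAC subrr add0r.
  move/le_trans; apply; rewrite ler_wpM2r ?powR_ge0 // KE; lra.
Qed.

End Bounds.
End LipToJet.

(** * The Lip bound on the derivative of the flow *)

Section FlowLip.
Variables (R : realType) (n d : nat).
Hypotheses (n_gt0 : (0 < n)%N) (d_gt0 : (0 < d)%N).
Local Notation Y := 'rV[R]_d.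
Local Notation P := (R * 'rV[R]_d)%type.
Variables (NX : forall k, tpower Y k -> R) (NP : forall k, tpower P k -> R).
Hypotheses (hNX : tensor_norms NX) (hNP : tensor_norms NP).

Lemma real_linear_sum (V : lmodType R) (f : V -> R) (I : finType) (r : I -> R) (v : I -> V) :
  real_linear f -> f (\sum_i r i *: v i) = \sum_i r i * f (v i).
Proof.
move=> lf; elim: (index_enum _) => [|i s IH]; first by rewrite !big_nil real_linear0.
by rewrite !big_cons lf IH.
Qed.

Lemma cylinder_open (T : R) (U : set Y) : open U -> open (cylinder T U).
Proof.
move=> oU; rewrite openE => -[t y] [/= tI Uy]; exists (`]- T, T[%classic, U) => //=.
by split; [exact: near_in_itvoo|exact: open_nbhs_nbhs].
Qed.

Lemma cylinder_convex (T : R) (U : set Y) (x y : P) (s : R) : convex_set U ->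
  cylinder T U x -> cylinder T U y -> 0 <= s <= 1 -> cylinder T U (y + s *: (x - y)).
Proof.
move=> cU [/= x1 x2] [/= y1 y2] /andP[s0 s1]; split => /=.
  move: x1 y1; rewrite !in_itv /= => /andP[? ?] /andP[? ?].
  have a1 : 0 < x.1 + T by lra.
  have a2 : 0 < y.1 + T by lra.
  have a3 : 0 < T - x.1 by lra.
  have a4 : 0 < T - y.1 by lra.
  have -> : s *: (x.1 - y.1 : R^o) = s * (x.1 - y.1) by [].
  have [->|sn0] := eqVneq s 0; first by apply/andP; split; lra.
  have s00 : 0 < s by rewrite lt_def sn0.
  have b1 := mulr_gt0 s00 a1; have b3 := mulr_gt0 s00 a3.
  have s11 : 0 <= 1 - s by rewrite subr_ge0.
  have b2 := mulr_ge0 s11 (ltW a2); have b4 := mulr_ge0 s11 (ltW a4).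
  apply/andP; split; lra.
have := cU x.2 y.2 (Itv01 s0 s1); rewrite !inE => /(_ x2 y2).
rewrite -[conv _ _ _]/(s *: x.2 + (1 - s) *: y.2).
by rewrite scalerBl scale1r scalerBr addrCA.
Qed.

Lemma lip_bound_mono (E F : vectType R) (NE : forall k, tpower E k -> R) (NF : F -> R)
    k eps (U : set E) (f : jet E F) M M' :
  tensor_norms NE -> M <= M' -> lip_bound NE NF k eps U f M -> lip_bound NE NF k eps U f M'.
Proof.
move=> [hn _ _] MM [M0 h]; split; first exact: le_trans MM.
move=> j jk x y Ux Uy v; have [h1 h2] := h j jk x y Ux Uy v.
have N0 := is_norm_ge0 (hn j) (tens v).
split; first by apply: le_trans h1 _; rewrite ler_wpM2r.
by apply: le_trans h2 _; rewrite ler_wpM2r // ler_wpM2r // powR_ge0.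
Qed.

(** Bounds are upward closed, so every number above the infimum is one; the added 1 avoids showing
    that the infimum is attained. *)
Lemma lip_norm_succ (E F : vectType R) (NE : forall k, tpower E k -> R) (NF : F -> R)
    k eps (U : set E) (f : jet E F) : tensor_norms NE -> is_lip NE NF k eps U f ->
  lip_bound NE NF k eps U f (lip_norm NE NF k eps U f + 1).
Proof.
move=> hN [_ [M hM]].
have hi : has_inf [set M | lip_bound NE NF k eps U f M].
  by split; [exists M|exists 0 => M' []].
have [M' hM' /ltW M'lt] := inf_adherent ltr01 hi.
exact: lip_bound_mono M'lt hM'.
Qed.

Lemma flow_lip_bound (M eps T : R) : exists C : R,
  forall (V : set Y) (H : jet Y Y) (U : set Y) (G : P -> Y),
    0 < eps -> eps <= 1 -> lip_bound NX (base_norm NX) n eps V H M ->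
    0 < T -> open U -> convex_set U -> is_flow V (jet_base H) T U G ->
    (forall p, cylinder T U p -> differentiable G p) /\
    exists dG : jet P 'Hom(P, Y),
      [/\ forall p, cylinder T U p -> jet_base dG p = linfun ('d G p),
          forall k x, (k <= n.-1)%N -> cylinder T U x -> symmetric_map (dG k x)
        & lip_bound NP (opnorm (base_norm NP) (base_norm NX)) n.-1 eps (cylinder T U) dG C].
Proof.
(* The constant is chosen before the hypotheses on [eps], [T] and [M] are available. If these are
   inadmissible the claim is vacuous and 0 is a default. *)
have [[[eps0 eps1] [T0 M0]]|no] := pselect ((0 < eps /\ eps <= 1) /\ (0 < T /\ 0 <= M)); last first.
  by exists 0 => V H U G e0 e1 [M0 _] T0; case: no.
have bX := base_norm_is_norm hNX; have bP := base_norm_is_norm hNP.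
have [c1 c10 hc1] := norm_le_norm (normr_is_norm [the normedModType R of Y]) bX.
have [c2 c20 hc2] := norm_le_norm bX (normr_is_norm [the normedModType R of Y]).
have [c3 c30 hc3] := norm_le_norm (normr_is_norm [the normedModType R of P]) bP.
pose cX := 1 + c1 + c2; pose cP := 1 + c3.
have cX1 : 1 <= cX by rewrite /cX; lra.
have cP1 : 1 <= cP by rewrite /cP; lra.
have hX1 x : `|x| <= cX * base_norm NX x.
  by apply: le_trans (hc1 x) _; rewrite ler_wpM2r ?is_norm_ge0 // /cX; lra.
have hX2 x : base_norm NX x <= cX * `|x|.
  by apply: le_trans (hc2 x) _; rewrite ler_wpM2r // /cX; lra.
have hP x : `|x| <= cP * base_norm NP x.
  by apply: le_trans (hc3 x) _; rewrite ler_wpM2r ?is_norm_ge0 // /cP; lra.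
pose K := jet_const n d cX M.
have K0 : 0 <= K.
  by rewrite addr_ge0 // !mulr_ge0 ?addr_ge0 ?exprn_ge0 // (le_trans ler01).
have nn : (n.-1 < n)%N by rewrite prednK.
have [K' K'0 HF] := flow_smooth eps0 eps1 T0 d K0 nn.
have [cF cF0 hF] := opnorm_coord_bound (fun l : 'I_d => delta_mx 0 l : Y) bP bX.
pose e (j : 'I_(\dim {:P})) : P := (vbasis {:P})`_j.
pose S := \sum_j `|e j|.
have S0 : 0 <= S by exact: sumr_ge0.
(* The constant of [smooth_lip_jet] at order [n.-1], for coordinates of dG with bound [K' * S]: [K']
   is the flow constant and [S] dominates the norm of each basis vector [e j]. *)
exists (cF * (2 * (K' * S) * cP ^+ n.-1 * cP ^+ n.-1.+1)).
move=> V H U G _ _ lipH _ oU cU [GV fl].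
set D := cylinder T U.
have oD : open D by exact: cylinder_open.
have hj l := row_jet_jet_on d_gt0 hNX cX1 hX1 hX2 eps0 eps1 lipH l.
have GX p : D p -> V (G p) by case: p => t y [tI Uy]; exact: GV.
have dG0 t y l : t \in `]- T, T[ -> U y ->
    is_derive t 1 (fun s => G (s, y) 0 l) (row_jet H l [::] (G (t, y))).
  move=> tI Uy; have [dv _ dE _] := fl y Uy.
  have dvt := dv t tI; have /derivable_mxP /(_ 0 l) dl := dvt.
  have := dE t tI; rewrite derive1E derive_mx // jet_base_nil => /matrixP /(_ 0 l).
  rewrite mxE => El; rewrite /row_jet -El.
  exact/derivableP.
have G0 y : U y -> G (0, y) = y by move=> Uy; have [] := fl y Uy.
have [dG sG] := HF V (row_jet H) U G oU hj GX dG0 G0.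
(* Differentiability of [G] is read off at class 0, to which the differential is lowered at the cost
   of [2 ^+ n.-1]. *)
have sG0 l : smooth_diff eps D 0 (2 ^+ n.-1 * K') (fun p => G p 0 l) (dG l).
  have [[lG hG] sd] := sG l; split; first split => //.
    move=> p q Dp Dq pq; apply: le_trans (hG _ _ Dp Dq pq) _.
    rewrite ler_wpM2r ?powR_ge0 // ler_peMl //.
    by rewrite exprn_ege1 // ler1n.
  by move=> u; rewrite -mulrA; exact: smooth_hoelder.
have K20 : 0 <= 2 ^+ n.-1 * K' by rewrite mulr_ge0 // exprn_ge0.
have dif p : D p -> differentiable G p /\ forall u, 'd G p u = \row_l dG l p u.
  by move=> Dp; exact: expands_differentiable sG0.
split; first by move=> p /dif[].
pose c (lj : 'I_d * 'I_(\dim {:P})) (p : P) := dG lj.1 p (e lj.2).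
have sc lj : smooth eps D n.-1 (K' * S) (c lj).
  have [_ /(_ (e lj.2))] := sG lj.1; apply: smooth_mono; rewrite ler_wpM2l //.
  by rewrite /S (bigD1 lj.2) //= lerDl sumr_ge0.
have KS : 0 <= K' * S by exact: mulr_ge0.
have cD x y : D x -> D y -> forall s, 0 <= s <= 1 -> D (y + s *: (x - y)).
  by move=> Dx Dy s s01; exact: cylinder_convex.
have [f [f0 fs fb]] := smooth_lip_jet eps0 eps1 hNP cF0 cP1 hP hF KS oD cD sc.
exists f; split => // p Dp; rewrite f0 //.
apply/lfunP => u; rewrite lfunE /=; have [_ ->] := dif p Dp.
rewrite sum_lfunE [RHS]row_sum_delta.
rewrite -(pair_bigA _ (fun l j => (c (l, j) p *: coord_hom (delta_mx 0 l : Y) j) u)) /=.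
apply: eq_bigr => l _; rewrite mxE.
have [[lG _] _] := sG l.
rewrite [in RHS](coord_vbasis (memvf u)) (real_linear_sum _ _ (lG p Dp)) scaler_suml.
by apply: eq_bigr => j _; rewrite scale_lfunE coord_homE scalerA mulrC.
Qed.

End FlowLip.

Theorem theorem2p13 (R : realType) (n d : nat) (hn : (0 < n)%N) (hd : (0 < d)%N)
    (NX : forall k, tpower 'rV[R]_d k -> R)
    (NP : forall k, tpower (R * 'rV[R]_d)%type k -> R)
    (hNX : tensor_norms NX) (hNP : tensor_norms NP) :
  exists C : R -> R -> R -> R,
  forall (eps : R) (V : set 'rV[R]_d) (H : jet 'rV[R]_d 'rV[R]_d)
         (T : R) (U : set 'rV[R]_d) (G : R * 'rV[R]_d -> 'rV[R]_d),
    0 < eps -> eps <= 1 ->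
    is_lip NX (base_norm NX) n eps V H ->
    0 < T -> open U -> convex_set U ->
    is_flow V (jet_base H) T U G ->
    let D := `]-T, T[%classic `*` U in
    (forall p, D p -> differentiable G p) /\
    exists dG : jet (R * 'rV[R]_d)%type 'Hom((R * 'rV[R]_d)%type, 'rV[R]_d),
      [/\ forall p, D p -> jet_base dG p = linfun ('d G p),
          is_lip NP (opnorm (base_norm NP) (base_norm NX)) n.-1 eps D dG
        & lip_norm NP (opnorm (base_norm NP) (base_norm NX)) n.-1 eps D dG
            <= C (lip_norm NX (base_norm NX) n eps V H) eps T].
Proof.
(* The existence of a constant for each triple becomes a function of the triple, which is evaluated
   at the norm of [H] plus 1 because a genuine Lip bound is required there. *)
pose B M eps T := cid (flow_lip_bound hn hd hNX hNP M eps T).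
exists (fun M eps T => sval (B (M + 1) eps T)).
move=> eps V H T U G e0 e1 lipH T0 oU cU fl D.
set M := lip_norm NX (base_norm NX) n eps V H.
have [dif [dG [dG0 sdG bdG]]] := svalP (B (M + 1) eps T) V H U G e0 e1
  (lip_norm_succ hNX lipH) T0 oU cU fl.
split; first exact: dif.
exists dG; split; first exact: dG0.
  by split => //; exists (sval (B (M + 1) eps T)).
by apply: ge_inf => //; exists 0 => M' [].
Qed.
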